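(* Let $F(t)=\sum_{i\ge0}F_it^i\in S[[t]]$, $S=k[x,y,z]$, be a homogeneous power series of degree $n>0$ (each $F_i\in S$ homogeneous of degree $n$ or zero) with $F_0\ne0$, such that the generic fiber $C^\ast\subset\mathbb P^2_{k((t))}$ is smooth. Let $F_0=\prod_{\nu}F_{\nu,0}^{n_\nu}$ with $F_{\nu,0}$ irreducible and pairwise non-associate, and $C_\nu=Z(F_{\nu,0})\subset\mathbb P^2_k$. Suppose that for each $\nu$ with $n_\nu>1$ there exist an integer $n(\nu)\ge1$ and a decomposition $$A_\nu F(t)=\big(F_{\nu,0}B_{\nu,0}+B_{\nu,1}t+\cdots+B_{\nu,n(\nu)-1}t^{n(\nu)-1}\big)^{n_\nu}+\Delta_{\nu,n(\nu)}t^{n(\nu)}+O(t^{n(\nu)+1}),$$ where $A_\nu,B_{\nu,j},\Delta_{\nu,n(\nu)}\in S$ are homogeneous polynomials such that $\gcd(A_\nu\Delta_{\nu,n(\nu)},F_{\nu,0})=1$. Then $$\lim_{t\to0}(C^\ast)^\vee=\sum_\nu n_\nu C_\nu^\vee+\sum_\nu\Big[\sum_{\nu'\ne\nu}n_{\nu'}(C_\nu\cdot C_{\nu'})^\vee\Big]+\sum_{\nu}(n_\nu-1)\Big[\big(Z(\Delta_{\nu,n(\nu)})\cdot C_\nu\big)^\vee-\big(Z(A_\nu)\cdot C_\nu\big)^\vee\Big]$$ as divisors on $(\mathbb P^2_k)^\vee$ (terms of the last sum with $n_\nu=1$ are zero).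
   Context: $k$ is an algebraically closed field of characteristic zero; $(\mathbb P^2)^\vee$ is the plane of lines in $\mathbb P^2$. $C^\ast$ is the plane curve over $k((t))$ cut out by $F(t)$, and $(C^\ast)^\vee\subset(\mathbb P^2_{k((t))})^\vee$ is its dual curve. Limit: $\lim_{t\to0}(C^\ast)^\vee$ is the schematic boundary (flat limit): the special fiber over $t=0$, as an effective divisor on $(\mathbb P^2_k)^\vee$, of the closure of $(C^\ast)^\vee$ in $(\mathbb P^2_{k[[t]]})^\vee$. Equivalently, if the discriminant of the restriction of $F(t)$ to a variable line is written $t^\alpha\Delta'$ with $\Delta'$ not divisible by $t$, the limit is the divisor of zeros of $\Delta'|_{t=0}$. Dual of an integral curve: for an integral curve $C=Z(G)\subset\mathbb P^2_k$ of degree $d$, $C^\vee$ is the divisor on $(\mathbb P^2_k)^\vee$ of degree $d(d-1)$ which is the zero divisor of $\ell\mapsto\operatorname{disc}(G|_\ell)$, the discriminant of the binary form of degree $d$ obtained by restricting $G$ to the line $\ell$. It consists of the usual dual curve together with the lines dual to the singular points of $C$, with multiplicities; it is zero if $d=1$. For a point $P\in\mathbb P^2_k$, $P^\vee\subset(\mathbb P^2_k)^\vee$ is the line consisting of all lines through $P$. For plane curves $C,D$ without common components, $(C\cdot D)^\vee:=\sum_{P\in C\cap D}i_P(C,D)\,P^\vee$, where $i_P(C,D)$ is the intersection multiplicity, i.e. the multiplicity of $P$ in the cycle $C\cdot D$; it is zero if one of the curves is the zero locus of a nonzero constant. $O(t^r)$ denotes terms of order at least $r$ in $t$. *)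

(* Defs.v *)
From HB Require Import structures.
From mathcomp Require Import all_boot all_order all_algebra.
From mathcomp Require Import boolp classical_sets fsbigop.
From mathcomp Require Export mpoly.

Set Implicit Arguments.
Unset Strict Implicit.
Unset Printing Implicit Defensive.

Import GRing.Theory.

Local Open Scope ring_scope.

Record fps (R : Type) := Fps { fps_coef : nat -> R }.
Arguments fps_coef {R} _ _.

Lemma fpsP (R : Type) (a b : fps R) : fps_coef a =1 fps_coef b -> a = b.
Proof. by case: a b => [a] [b] /= /funext ->. Qed.

HB.instance Definition _ (R : Type) := gen_eqMixin (fps R).
HB.instance Definition _ (R : Type) := gen_choiceMixin (fps R).

Section FpsZmod.
Variable R : zmodType.
Implicit Types a b c : fps R.

Definition fps_zero : fps R := Fps (fun=> 0).
Definition fps_opp a : fps R := Fps (fun i => - fps_coef a i).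
Definition fps_add a b : fps R := Fps (fun i => fps_coef a i + fps_coef b i).

Fact fps_addA : associative fps_add.
Proof. by move=> a b c; apply: fpsP => i /=; rewrite addrA. Qed.
Fact fps_addC : commutative fps_add.
Proof. by move=> a b; apply: fpsP => i /=; rewrite addrC. Qed.
Fact fps_add0 : left_id fps_zero fps_add.
Proof. by move=> a; apply: fpsP => i /=; rewrite add0r. Qed.
Fact fps_addN : left_inverse fps_zero fps_opp fps_add.
Proof. by move=> a; apply: fpsP => i /=; rewrite addNr. Qed.

HB.instance Definition _ := GRing.isZmodule.Build (fps R)
  fps_addA fps_addC fps_add0 fps_addN.
End FpsZmod.

Section FpsRing.
Variable R : comNzRingType.
Implicit Types a b c : fps R.

Definition fps_one : fps R := Fps (fun i => (i == 0%N)%:R).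
Definition fps_mul a b : fps R :=
  Fps (fun n => \sum_(i < n.+1) fps_coef a i * fps_coef b (n - i)).

Let trunc n a : {poly R} := \poly_(i < n.+1) fps_coef a i.

Let coef_fps_mul n i a b (p q : {poly R}) : (i <= n)%N ->
    (forall j, (j <= n)%N -> fps_coef a j = p`_j) ->
    (forall j, (j <= n)%N -> fps_coef b j = q`_j) ->
  fps_coef (fps_mul a b) i = (p * q)`_i.
Proof.
move=> lein pa qb; rewrite coefM; apply: eq_bigr => j _.
have lej : (j <= i)%N by rewrite -ltnS.
by rewrite pa ?qb ?(leq_trans _ lein) // leq_subr.
Qed.

Let truncE n a j : (j <= n)%N -> fps_coef a j = (trunc n a)`_j.
Proof. by move=> lej; rewrite coef_poly ltnS lej. Qed.

Fact fps_mulC : commutative fps_mul.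
Proof.
move=> a b; apply: fpsP => n; have ha := @truncE n a; have hb := @truncE n b.
by rewrite (coef_fps_mul (leqnn n) ha hb) (coef_fps_mul (leqnn n) hb ha) mulrC.
Qed.
Fact fps_mulA : associative fps_mul.
Proof.
move=> a b c; apply: fpsP => n; have lenn := leqnn n.
have ha := @truncE n a; have hb := @truncE n b; have hc := @truncE n c.
have hbc j (lej : (j <= n)%N) := coef_fps_mul lej hb hc.
have hab j (lej : (j <= n)%N) := coef_fps_mul lej ha hb.
by rewrite (coef_fps_mul lenn ha hbc) (coef_fps_mul lenn hab hc) mulrA.
Qed.
Fact fps_mul1 : left_id fps_one fps_mul.
Proof.
move=> a; apply: fpsP => n /=; rewrite big_ord_recl /= mul1r subn0.
by rewrite big1 ?addr0 // => i _; rewrite mul0r.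
Qed.
Fact fps_mulDl : left_distributive fps_mul +%R.
Proof.
move=> a b c; apply: fpsP => n /=; rewrite -big_split /=.
by apply: eq_bigr => i _; rewrite mulrDl.
Qed.
Fact fps_one_neq0 : fps_one != 0.
Proof.
apply/eqP => /(congr1 (fun a => fps_coef a 0)) /= /eqP.
by rewrite oner_eq0.
Qed.

HB.instance Definition _ := GRing.Zmodule_isComNzRing.Build (fps R)
  fps_mulA fps_mulC fps_mul1 fps_mulDl fps_one_neq0.

Definition fps_unit : pred (fps R) := fun a => `[< exists b, b * a = 1 >].
Definition fps_inv a : fps R :=
  if fps_unit a then xget a [set b | b * a = 1] else a.

Fact fps_mulV : {in fps_unit, left_inverse 1 fps_inv *%R}.
Proof.
move=> a ua; rewrite /fps_inv; have -> : fps_unit a by [].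
by have /asboolP := ua; case: xgetP => // na [b /na].
Qed.
Fact fps_unitPl a b : b * a = 1 -> a \in fps_unit.
Proof. by move=> ba; apply/asboolP; exists b. Qed.
Fact fps_inv_out : {in [predC fps_unit], fps_inv =1 id}.
Proof. by move=> a na; rewrite /fps_inv ifN. Qed.

HB.instance Definition _ := GRing.ComNzRing_hasMulInverse.Build (fps R)
  fps_mulV fps_unitPl fps_inv_out.
End FpsRing.

Section FpsDomain.
Variable R : idomainType.

Fact fps_integral (a b : fps R) : a * b = 0 -> (a == 0) || (b == 0).
Proof.
have low c : c != 0 -> exists2 i, fps_coef c i != 0 &
    forall j, (j < i)%N -> fps_coef c j = 0.
  move=> c0; have ex : exists i, fps_coef c i != 0.
    apply: contrapT => /forallNP h; move/eqP: c0; apply.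
    by apply: fpsP => i; apply/eqP; apply: contrapT => /negP /h.
  case: (ex_minnP ex) => i ci imin; exists i => // j ltj; apply/eqP.
  by apply: contraTT ltj => /imin; rewrite -leqNgt.
move=> ab0; rewrite -implyNb; apply/implyP => /low[i ai amin].
apply: contraT => /low[j bj bmin].
have : fps_coef (a * b) (i + j) = 0 by rewrite ab0.
have lti : (i < (i + j).+1)%N by rewrite ltnS leq_addr.
rewrite /= (bigD1 (Ordinal lti)) //= addKn big1 ?addr0 => [|l].
  by move/eqP; rewrite mulf_eq0 (negPf ai) (negPf bj).
rewrite -val_eqE /= neq_ltn => /orP[/amin ->|ltl]; first by rewrite mul0r.
by rewrite bmin ?mulr0 // ltn_subLR ?ltn_add2r // -ltnS ltn_ord.
Qed.

HB.instance Definition _ := GRing.ComUnitRing_isIntegral.Build (fps R)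
  fps_integral.
End FpsDomain.

Definition laurent (k : idomainType) : fieldType := {fraction (fps k)}.

Definition to_laurent (k : idomainType) : fps k -> laurent k :=
  @FracField.tofrac (fps k).

(* A homogeneous power series sum_i F_i t^i of degree n, viewed in
   k[[t]][x, y, z]; the index m ranges over the monomials of degree <= n. *)
Definition series_form (k : idomainType) (n : nat) (F : nat -> {mpoly k[3]}) :
    {mpoly (fps k)[3]} :=
  \sum_(m : 'X_{1..3 < n.+1}) Fps (fun i => (F i)@_m) *: 'X_[m].

Definition generic_fiber (k : idomainType) (n : nat)
    (F : nat -> {mpoly k[3]}) : {mpoly (laurent k)[3]} :=
  map_mpoly (@to_laurent k) (series_form n F).

(* The Jacobian criterion at all points with values in all field extensions
   of K. *)
Definition smooth_curve (K : fieldType) (G : {mpoly K[3]}) : Prop :=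
  forall (L : fieldType) (iota : {rmorphism K -> L}) (p : 'I_3 -> L),
    (exists i, p i != 0) ->
    ~ (mmap iota p G = 0 /\ forall i, mmap iota p (mderiv i G) = 0).

Definition irreducible_elt (R : unitRingType) (p : R) : Prop :=
  [/\ p != 0, p \isn't a GRing.unit &
      forall a b, p = a * b -> (a \is a GRing.unit) || (b \is a GRing.unit)].

Definition associated (R : unitRingType) (p q : R) : Prop :=
  exists2 u, u \is a GRing.unit & p = u * q.

Definition divides (R : comNzRingType) (p q : R) : Prop :=
  exists h, q = h * p.

(* gcd(p, q) = 1 *)
Definition coprime_elt (R : comUnitRingType) (p q : R) : Prop :=
  forall h, divides h p -> divides h q -> h \is a GRing.unit.

(* Divisors on a projective plane over K: families of multiplicities indexed by
   the prime divisors. A prime divisor is given by one of its equations; all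
   multiplicities below only depend on the equation up to a scalar. *)
Record prime_divisor (K : fieldType) := PrimeDivisor {
  pd_form :> {mpoly K[3]};
  _ : irreducible_elt pd_form;
  _ : pd_form \is homog mdeg }.

Definition divisor (K : fieldType) := prime_divisor K -> int.

(* The largest e with Q ^+ e dividing G; for G != 0 and Q nonconstant, such an
   e is at most the degree of G, that is, less than msize G. *)
Definition mult_along (K : fieldType) (Q G : {mpoly K[3]}) : nat :=
  \max_(e < msize G | `[< divides (Q ^+ e) G >]) e.

Definition zero_divisor (K : fieldType) (G : {mpoly K[3]}) : divisor K :=
  fun Q => mult_along Q G.

(* The discriminant of the binary form sum_i f`_i s^i r^(d-i) of degree d,
   as the resultant of its two partial derivatives, which are binary forms of
   degree d - 1; it is +- d^(d-2) times the discriminant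
   f`_d^(2d-2) * prod_(i < j) (x_i - x_j)^2, and it is 1 for d = 1. The
   derivatives with respect to s and r have the coefficients of f^`() and
   f *+ d - 'X * f^`(). The Sylvester matrix of the library uses the actual
   degrees of the polynomials, instead of d - 1. *)
Definition binary_disc (R : comNzRingType) (d : nat) (f : {poly R}) : R :=
  \det (col_mx
    (\matrix_(i < d.-1) poly_rV ('X^i * f^`()) : 'M_(d.-1, d.-1 + d.-1))
    (\matrix_(i < d.-1) poly_rV ('X^i * (f *+ d - 'X * f^`())))).

(* G (s p + r q), with s = 'X and r = 1 *)
Definition restrict_line (R : comNzRingType) (G : {mpoly R[3]})
    (p q : 'I_3 -> R) : {poly R} :=
  mmap (@polyC R) (fun i => (p i)%:P * 'X + (q i)%:P) G.

(* The coordinates of the line spanned by p and q: the line with coordinates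
   (u, v, w) is u x + v y + w z = 0. Indices are taken modulo 3. *)
Definition join_line (R : comNzRingType) (p q : 'I_3 -> R) : 'I_3 -> R :=
  fun i => p (i + 1) * q (i + 2%:R) - p (i + 2%:R) * q (i + 1).

(* D is l |-> disc (G restricted to l), as a form of degree d(d-1) in the
   coordinates of the line l, where d = deg G. The discriminant only depends on
   p and q through join_line p q, by SL2-invariance. *)
Definition is_line_disc (K : fieldType) (G D : {mpoly K[3]}) : Prop :=
  let d := (msize G).-1 in
  D \is (d * d.-1).-homog /\
  forall p q : 'I_3 -> K,
    D.@[join_line p q] = binary_disc d (restrict_line G p q).

(* For a form G over an infinite field there is exactly one such D; it is an
   equation of the dual of the curve Z(G). *)
Definition dual_form (K : fieldType) (G : {mpoly K[3]}) : {mpoly K[3]} :=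
  xget 0 [set D | is_line_disc G D].

Definition dual_divisor (K : fieldType) (G : {mpoly K[3]}) : divisor K :=
  zero_divisor (dual_form G).

(* The (homogeneous) ideal of the closure in the projective plane over k[[t]]
   of the curve Z(D) over k((t)) *)
Definition closure_ideal (k : fieldType) (D : {mpoly (laurent k)[3]}) :
    set {mpoly (fps k)[3]} :=
  [set H | divides D (map_mpoly (@to_laurent k) H)].

(* The ideal of the fiber of this closure over t = 0 *)
Definition special_fiber_ideal (k : fieldType) (D : {mpoly (laurent k)[3]}) :
    set {mpoly k[3]} :=
  [set map_mpoly (fun a : fps k => fps_coef a 0%N) H | H in closure_ideal D].

(* The limit for t -> 0 of the curve Z(D) over k((t)) is the effective divisor
   E, i.e., the special fiber above is the closed subscheme Z(P) for a form
   P with divisor E. *)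
Definition limit_divisor (k : fieldType) (D : {mpoly (laurent k)[3]})
    (E : divisor k) : Prop :=
  exists P : {mpoly k[3]},
    [/\ P != 0, P \is homog mdeg,
        special_fiber_ideal D = [set H | divides P H]%classic &
        E =1 zero_divisor P].

(* The points of the projective plane, each given by its homogeneous
   coordinates with first nonzero coordinate 1. *)
Definition normalized (K : fieldType) (v : 'rV[K]_3) : bool :=
  [exists i, (v 0 i == 1) && [forall (j : 'I_3 | (j < i)%N), v 0 j == 0]].

Definition proj_point (K : fieldType) := {v : 'rV[K]_3 | normalized v}.

Definition pt_coord (K : fieldType) (P : proj_point K) : 'I_3 -> K :=
  fun i => sval P 0 i.

(* P^\vee, the line of all lines through P *)
Definition dual_line (K : fieldType) (P : proj_point K) : divisor K :=
  zero_divisor (\sum_i pt_coord P i *: 'X_i).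

Definition frac_form (K : fieldType) (a s : {mpoly K[3]}) :
    {fraction {mpoly K[3]}} :=
  FracField.tofrac a / FracField.tofrac s.

(* The local ring at P of the projective plane, inside the fraction field of
   K[x, y, z] *)
Definition local_ring (K : fieldType) (P : proj_point K) :
    set {fraction {mpoly K[3]}} :=
  [set h | exists a s d, [/\ a \is d.-homog, s \is d.-homog,
                              s.@[pt_coord P] != 0 & h = frac_form a s]].

(* The ideal of the curve Z(f) in the local ring at P *)
Definition local_ideal (K : fieldType) (P : proj_point K) (f : {mpoly K[3]}) :
    set {fraction {mpoly K[3]}} :=
  [set h | exists a s d, [/\ f * a \is d.-homog, s \is d.-homog,
                              s.@[pt_coord P] != 0 & h = frac_form (f * a) s]].

(* The quotient of the local ring at P by the ideal of Z(f) and Z(g) has a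
   K-basis with r elements. *)
Definition local_quotient_dim (K : fieldType) (P : proj_point K)
    (f g : {mpoly K[3]}) (r : nat) : Prop :=
  exists e : 'I_r -> {fraction {mpoly K[3]}},
    (forall i, local_ring P (e i)) /\
    (forall h, local_ring P h ->
      exists! c : {ffun 'I_r -> K}, exists h1 h2,
        [/\ local_ideal P f h1, local_ideal P g h2 &
            h = \sum_i FracField.tofrac (c i)%:MP * e i + (h1 + h2)]).

(* i_P(Z(f), Z(g)) *)
Definition intersection_mult (K : fieldType) (f g : {mpoly K[3]})
    (P : proj_point K) : nat :=
  xget 0%N [set r | local_quotient_dim P f g r].

(* (Z(f) . Z(g))^\vee; the sum is finite if f and g are coprime. *)
Definition dual_cycle (K : fieldType) (f g : {mpoly K[3]}) : divisor K :=
  fun Q => \sum_(P \in [set P : proj_point K | f.@[pt_coord P] = 0 /\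
                                         g.@[pt_coord P] = 0])
    (intersection_mult f g P)%:Z * dual_line P Q.

(* Main.v *)
Require Import Defs.
From HB Require Import structures.
From mathcomp Require Import all_boot all_order all_algebra.
From mathcomp Require Import boolp classical_sets fsbigop.
From mathcomp Require Import perm separable mpoly ring zify.

(* For forms f and g, let R(f, g) be the form whose value at a line l is the
   resultant of the restrictions of f and g to l [line_res].

   The divisor of R(f, g) is (Z(f) . Z(g))^\vee. If R(f, g) is divisible exactly i
   times by the equation of P^\vee, then in suitable affine coordinates (e, r)
   at P the Sylvester matrix of f and g, as polynomials in r over K[e], has a
   determinant e^i u with u(0) != 0, and its cokernel, localized at e = 0, is
   the local ring at P modulo (f, g); this cokernel has dimension i.

   On a general line l, each root x of f_v|l lifts to m_v roots of F(t)|l over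
   k[[t^(1/M)]]. If m_v > 1, the equation A F = Phi^m + Delta t^N + ... gives them
   by two applications of Hensel's lemma: Phi has a simple root xi above x, and
   the roots are xi + tau^e Y, where Y runs over lifts of the m-th roots of
   - Delta(x) / Phi'(x)^m. The product of the F'(rho) over these roots rho thus has a
   leading coefficient w with
     w A(x)^(m-1) = m^m f_v'(x)^m (prod_(w != v) f_w(x)^(m_w)) Delta(x)^(m-1).
   By Poisson's formula, taking the product over all x and v yields, up to a
   constant, the identity of forms
     P prod_v R(f_v, A_v)^(m_v - 1) =
       prod_v disc(f_v)^(m_v) (prod_(w != v) R(f_v, f_w)^(m_w)) R(f_v, Delta_v)^(m_v - 1),
   where P is an equation of the limit and disc(f) is the dual form of f. *)

Set Implicit Arguments.
Unset Strict Implicit.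
Unset Printing Implicit Defensive.

Import GRing.Theory.

Local Open Scope ring_scope.

(** * Factorial rings *)

(** Closures and limits are reduced to leading coefficients. A form over k((t)) has a multiple over
    k[[t]] with nonzero reduction P, which generates the ideal of the special fiber, so it suffices
    to know P at enough lines up to one constant. The discriminant on a line determines P there
    through its leading coefficient only, and t = tau^M does not alter leading coefficients; hence
    exponents never have to be tracked. The constants in Poisson's formula depend on degrees and
    multiplicities alone, which turns values on a dense set of lines into an identity of forms. The
    resultants with A_v stay on the left, so that this identity has no denominators. Two obstacles
    shape the rest. A resultant on a line is given by two spanning points; it has to be shown to be
    a form in the coordinates of the line, valid over every K-algebra, since the local computation
    runs along a line over K[e]. Restrictions may lose degree, so resultants carry formal degrees,
    and the first spanning point of a good line is chosen off the curve. *)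

Section Divides.
Variable R : comNzRingType.
Implicit Types p q r : R.

Lemma divides_refl p : divides p p.
Proof. by exists 1; rewrite mul1r. Qed.

Lemma divides0 p : divides p 0.
Proof. by exists 0; rewrite mul0r. Qed.

Lemma divides_mull p q r : divides p r -> divides p (q * r).
Proof. by case=> h ->; exists (q * h); rewrite mulrA. Qed.

Lemma divides_mulr p q r : divides p q -> divides p (q * r).
Proof. by move=> pq; rewrite mulrC; apply: divides_mull. Qed.

Lemma divides_trans q p r : divides p q -> divides q r -> divides p r.
Proof. by move=> pq [h ->]; apply: divides_mull. Qed.

Lemma divides_add p q r : divides p q -> divides p r -> divides p (q + r).
Proof. by move=> [h ->] [h' ->]; exists (h + h'); rewrite mulrDl. Qed.

Lemma divides_opp p q : divides p q -> divides p (- q).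
Proof. by move=> [h ->]; exists (- h); rewrite mulNr. Qed.

Lemma divides_sub p q r : divides p q -> divides p r -> divides p (q - r).
Proof. by move=> pq pr; apply/divides_add/divides_opp. Qed.

Lemma divides_sum (J : Type) (s : seq J) (P : pred J) (E : J -> R) p :
  (forall i, P i -> divides p (E i)) -> divides p (\sum_(i <- s | P i) E i).
Proof.
move=> pE; elim/big_rec: _ => [|i x Pi px]; first exact: divides0.
by apply: divides_add => //; apply: pE.
Qed.

Lemma divides_exp p i j : (i <= j)%N -> divides (p ^+ i) (p ^+ j).
Proof. by move=> ij; exists (p ^+ (j - i)); rewrite -exprD subnK. Qed.

End Divides.

Section Factorial.
Variable R : idomainType.
Implicit Types p q a b : R.

Definition prime_elt p : Prop :=
  [/\ p != 0, p \isn't a GRing.unit &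
      forall a b, divides p (a * b) -> divides p a \/ divides p b].

(** Factorizations into primes rather than irreducibles: uniqueness and the primality of irreducible
    elements follow from their existence, which is thus all that has to pass to polynomial rings. *)
Definition factorial_ring : Prop :=
  forall a, a != 0 -> exists u (s : seq R),
    [/\ u \is a GRing.unit, forall p, p \in s -> prime_elt p
      & a = u * \prod_(p <- s) p].

Lemma unit_dividesl (u p q : R) :
  u \is a GRing.unit -> divides (u * p) q <-> divides p q.
Proof.
move=> uU; split=> [[h ->]|[h ->]]; first by exists (h * u); rewrite mulrA.
by exists (h / u); rewrite mulrA divrK.
Qed.

Lemma prime_elt_assoc u p : u \is a GRing.unit -> prime_elt p -> prime_elt (u * p).
Proof.
move=> uU [p0 pU pM]; split=> [||a b].
- by rewrite mulf_neq0 //; apply: contraTneq uU => ->; rewrite unitr0.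
- by rewrite unitrM uU.
by rewrite !unit_dividesl //; apply: pM.
Qed.

Lemma prime_elt_ndivides_unit p u :
  prime_elt p -> u \is a GRing.unit -> ~ divides p u.
Proof.
by case=> _ pU _ uU [h hE]; move: uU pU; rewrite hE unitrM => /andP[_ ->].
Qed.

Lemma prime_divides_prod p (s : seq R) : prime_elt p ->
  divides p (\prod_(q <- s) q) -> exists2 q, q \in s & divides p q.
Proof.
move=> pp; elim: s => [|q s IHs].
  by rewrite big_nil => /(prime_elt_ndivides_unit pp (unitr1 _)).
rewrite big_cons; case: pp => _ _ pM /pM[pq|/IHs[r rs pr]].
  by exists q; rewrite ?mem_head.
by exists r; rewrite // inE rs orbT.
Qed.

Lemma prime_divides_exp p a e : prime_elt p -> divides p (a ^+ e) -> divides p a.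
Proof.
move=> pp; elim: e => [|e IHe].
  by rewrite expr0 => /(prime_elt_ndivides_unit pp (unitr1 _)).
by rewrite exprS; case: (pp) => _ _ pM /pM[].
Qed.

Lemma prime_divides_prime p q : prime_elt p -> prime_elt q -> divides p q ->
  exists2 u, u \is a GRing.unit & q = u * p.
Proof.
move=> [_ pU _] [q0 qU qM] [h qE].
have [] : divides q h \/ divides q p by apply: qM; rewrite -qE; apply: divides_refl.
  case=> h' hE; move/eqP: qE; rewrite hE -[X in X == _]mul1r mulrAC.
  rewrite (inj_eq (mulIf q0)) => /eqP pU'; case/negP: pU.
  by apply/unitrPr; exists h'; rewrite mulrC.
case=> h' pE; exists h => //; move/eqP: qE; rewrite pE mulrA -[X in X == _]mul1r.
rewrite (inj_eq (mulIf q0)) => /eqP hU.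
by apply/unitrPr; exists h'.
Qed.

Lemma factorial_irreducible_prime p :
  factorial_ring -> irreducible_elt p -> prime_elt p.
Proof.
move=> fR [p0 pU pirr]; have [u [[|q s] [uU sp pE]]] := fR p p0.
  by rewrite pE big_nil mulr1 uU in pU.
have qp : prime_elt q by apply: sp; rewrite mem_head.
have /pirr : p = q * (u * \prod_(p <- s) p) by rewrite pE big_cons mulrCA.
case: (qp) => _ /negPf-> _ /= rU; rewrite pE big_cons mulrCA mulrC.
exact: prime_elt_assoc.
Qed.

End Factorial.

Section PolyFactorial.
Variable R : idomainType.
Hypothesis fR : factorial_ring R.
Implicit Types (p c : R) (g h : {poly R}).

Lemma divides_polyC p h : divides p%:P h <-> forall i, divides p h`_i.
Proof.
split=> [[q ->] i|ph].
  by rewrite coefMC; exists q`_i.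
have [E hE] := choice ph; exists (\poly_(i < size h) E i).
apply/polyP=> i; rewrite coefMC coef_poly; case: ltnP => // hi.
by rewrite nth_default // mul0r.
Qed.

(** Gauss's lemma. If i and j are the lowest indices of coefficients of [a] and [b] not divisible by
    [p], then all terms but one of the coefficient of index i + j of [a * b] are divisible by
    [p]. *)
Lemma prime_elt_polyC p : prime_elt p -> prime_elt p%:P.
Proof.
move=> pp; have [p0 pU pM] := pp; split=> [||a b pab].
- by rewrite polyC_eq0.
- by rewrite poly_unitE size_polyC p0 /= coefC eqxx.
apply: contrapT => /not_orP[pa pb].
have low h : ~ divides p%:P h -> exists2 i, ~ divides p h`_i &
    forall j, (j < i)%N -> divides p h`_j.
  move=> ph; have ex : exists i, `[< ~ divides p h`_i >].
    apply: contrapT => /forallNP nph; apply/ph/divides_polyC => i.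
    by apply: contrapT => ni; apply: (nph i); apply/asboolP.
  case: (ex_minnP ex) => i /asboolP ni imin; exists i => // j ltj.
  by apply: contrapT => /asboolP/imin; rewrite leqNgt ltj.
have [i ai amin] := low a pa; have [j bj bmin] := low b pb.
have := (divides_polyC p (a * b)).1 pab (i + j)%N.
have lti : (i < (i + j).+1)%N by rewrite ltnS leq_addr.
rewrite coefM (bigD1 (Ordinal lti)) //= addKn => pS.
have /pM[] // : divides p (a`_i * b`_j).
set S := (X in _ + X) in pS; rewrite -[X in divides _ X](addrK S).
apply: divides_sub => //; apply: divides_sum => l.
rewrite -val_eqE /= neq_ltn => /orP[/amin pl|ltl]; first exact: divides_mulr.
by apply/divides_mull/bmin; rewrite ltn_subLR ?ltn_add2r // -ltnS ltn_ord.
Qed.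

(** By Gauss's lemma each prime factor of [c] divides [g] or [h], so [c] can be distributed over the
    two factors. This brings identities over the fraction field back to [R]. *)
Lemma cancel_const c g h (w : {poly R}) : c != 0 -> c *: w = g * h ->
  exists g' h' a b, [/\ w = g' * h', g = a *: g', h = b *: h', a != 0 & b != 0].
Proof.
move=> c0; have [u [s [uU sp cE]]] := fR c0; rewrite {c c0}cE.
elim: s sp g h w => [|p s IHs] sp g h w.
  have u0 : u != 0 by apply: contraTneq uU => ->; rewrite unitr0.
  rewrite big_nil mulr1 => wE; exists (u^-1 *: g), h, u, 1.
  by rewrite scale1r oner_eq0 scalerA divrr // scale1r -scalerAl -wE scalerA mulVr
     ?scale1r.
have pp : prime_elt p by apply: sp; rewrite mem_head.
have p0 : p != 0 by case: pp.
have {}IHs := IHs (fun q qs => sp q (@mem_behead _ (p :: s) q qs)).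
rewrite big_cons mulrCA -scalerA -[p *: _]mul_polyC => wE.
have [pP0 _ pM] := prime_elt_polyC pp.
have [|[g1 gE]|[h1 hE]] := pM g h.
- by exists ((u * \prod_(q <- s) q) *: w); rewrite -wE mulrC.
- have /IHs[g' [h' [a [b [-> g1E -> a0 b0]]]]] :
      (u * \prod_(q <- s) q) *: w = g1 * h.
    by apply: (mulfI pP0); rewrite wE gE; ring.
  exists g', h', (p * a), b; split=> //; last by rewrite mulf_neq0.
  by rewrite gE g1E mulrC mul_polyC scalerA.
have /IHs[g' [h' [a [b [-> -> h1E a0 b0]]]]] :
    (u * \prod_(q <- s) q) *: w = g * h1.
  by apply: (mulfI pP0); rewrite wE hE; ring.
exists g', h', a, (p * b); split=> //; last by rewrite mulf_neq0.
by rewrite hE h1E mulrC mul_polyC scalerA.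
Qed.

Definition primitive_elt h := forall p, prime_elt p -> ~ divides p%:P h.

Lemma primitive_const_unit h c : primitive_elt h -> c != 0 -> divides c%:P h ->
  c \is a GRing.unit.
Proof.
move=> hprim /fR[u [[|p s] [uU sp ->]]] ch; first by rewrite big_nil mulr1.
case: (hprim p); first by apply: sp; rewrite mem_head.
apply: divides_trans ch; rewrite big_cons mulrCA rmorphM /=.
exact/divides_mulr/divides_refl.
Qed.

Lemma cancel_primitive h c g (w : {poly R}) : primitive_elt h -> c != 0 ->
  c *: w = h * g -> divides h w.
Proof.
move=> hprim c0 /(cancel_const c0)[h' [g' [a [b [-> hE _ a0 b0]]]]].
have aU : a \is a GRing.unit.
  by apply: (primitive_const_unit hprim a0); exists h'; rewrite hE mulrC mul_polyC.
exists (a^-1 *: g'); rewrite hE -scalerAl -scalerAr scalerA mulVr // scale1r.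
exact: mulrC.
Qed.

(** A prime that divides [h] divides its leading coefficient, so the prime factors of the latter
    bound the number of primes that can be taken out. *)
Lemma primitive_part h : h != 0 -> exists s h0,
  [/\ forall p, p \in s -> prime_elt p, primitive_elt h0
    & h = (\prod_(p <- s) p) *: h0].
Proof.
have := fR; rewrite /factorial_ring => fR'.
move=> h0; have := h0; rewrite -lead_coef_eq0 => /fR'[u [s [uU sp lE]]].
have : divides (lead_coef h) (\prod_(p <- s) p).
  by exists u^-1; rewrite lE mulKr.
elim: {s}(size s) {-2}s (eqxx (size s)) sp {lE u uU} h h0 => [|n IHn] s szs sp h h0 hd;
  have [hprim|] := pselect (primitive_elt h);
  try by exists [::], h; rewrite big_nil scale1r.
- move=> /existsNP[p /not_implyP[pp /contrapT[g gE]]].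
  move: hd; rewrite (size0nil (eqP szs)) big_nil gE lead_coefM lead_coefC => hd.
  have : divides p 1 by apply: divides_trans hd; apply/divides_mull/divides_refl.
  by move/(prime_elt_ndivides_unit pp (unitr1 _)).
move=> /existsNP[p /not_implyP[pp /contrapT[g gE]]].
have g0 : g != 0 by apply: contraNneq h0 => g0; rewrite gE g0 mul0r.
move: hd; rewrite gE lead_coefM lead_coefC => hd.
have p0 : p != 0 by case: pp.
have [|q qs pq] := @prime_divides_prod _ p s pp.
  by apply: divides_trans hd; apply/divides_mull/divides_refl.
have [u uU qE] := prime_divides_prime pp (sp q qs) pq.
have [|||s' [h' [s'p h'prim gE']]] := IHn (rem q s) _ _ g g0.
- by rewrite size_rem // (eqP szs).
- by move=> r /mem_rem/sp.
- case: hd => z; rewrite (big_rem q) //= qE => hd; exists (u^-1 * z).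
  apply: (mulrI uU); rewrite -[u^-1 * z * _]mulrA mulVKr //; apply: (mulfI p0).
  by rewrite mulrA [p * u]mulrC hd; ring.
exists (p :: s'), h'; split=> //; last by rewrite gE' big_cons mulrC mul_polyC scalerA.
by move=> r; rewrite inE => /orP[/eqP->|/s'p].
Qed.

Lemma primitive_factor g h : primitive_elt (g * h) -> primitive_elt g.
Proof. by move=> ghp p pp pg; apply: (ghp p pp); apply: divides_mulr. Qed.

(** The gcd of [h] and [a] over the fraction field has size 1, the size of [h], or a size in
    between. The first case gives a Bezout relation, so that [h] divides a constant multiple of [b];
    in the second [h] divides a constant multiple of [a]; the last would decompose [h]. Primitivity
    removes the constants. *)
Lemma primitive_indecomposable_prime h : primitive_elt h -> (1 < size h)%N ->
  (forall a b, h = a * b -> (1 < size a)%N -> (1 < size b)%N -> False) ->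
  prime_elt h.
Proof.
move=> hprim szh hind.
have h0 : h != 0 by rewrite -size_poly_gt0 (ltn_trans _ szh).
split=> [||a b [q qE]] //; first by rewrite poly_unitE gtn_eqF.
set g := gcdp h a; have gh : g %| h by apply: dvdp_gcdl.
have g0 : g != 0 by rewrite gcdp_eq0 negb_and h0.
have [szg|szg] := leqP (size g) 1.
  right; have {}szg : size g == 1 by rewrite eqn_leq szg size_poly_gt0.
  have [[u v] /= /eqp_size/eqP] := Bezoutp h a.
  rewrite (eqP szg) => /size_poly1P[c c0 cE].
  apply: (@cancel_primitive _ c (u * b + v * q)) => //.
  by rewrite -mul_polyC -cE mulrDl -!mulrA qE; ring.
have [ltg|] := ltnP (size g) (size h).
  have /Pdiv.Idomain.dvdpP[[c w] /= c0 /(cancel_const c0)[w' [g' [x [y [hE _ gE x0 y0]]]]]] := gh.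
  have szg' : size g = size g' by rewrite gE size_scale.
  case: (hind w' g' hE); last by rewrite -szg'.
  move: ltg; rewrite hE size_mul; last 2 first.
  - by apply: contraNneq h0 => w'0; rewrite hE w'0 mul0r.
  - by apply: contraNneq h0 => w'0; rewrite hE w'0 mulr0.
  by rewrite szg' in szg *; lia.
move=> leg; left.
have : h %| a.
  have hg : h %= g.
    rewrite eqp_sym -(dvdp_size_eqp gh) eqn_leq leg andbT.
    by apply: dvdp_leq.
  by rewrite (eqp_dvdl _ hg) dvdp_gcdr.
case/Pdiv.Idomain.dvdpP=> [[c w] /= c0 cE]; apply: (cancel_primitive hprim c0).
by rewrite cE mulrC.
Qed.

Lemma primitive_prod_primes h : h != 0 -> primitive_elt h -> exists (u : {poly R}) (s : seq {poly
  R}),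
  [/\ u \is a GRing.unit, forall p : {poly R}, p \in s -> prime_elt p
    & h = u * \prod_(p <- s) p].
Proof.
elim/ltn_ind: {h}(size h) {-2}h (erefl (size h)) => n IHn h szh h0 hprim.
have [h1|h1] := leqP (size h) 1.
  exists h, [::]; rewrite big_nil mulr1; split=> //.
  have [c c0 cE] : exists2 c, c != 0 & h = c%:P.
    by apply/size_poly1P; rewrite eqn_leq h1 size_poly_gt0.
  rewrite cE; apply: rmorph_unit; apply: (primitive_const_unit hprim c0).
  by rewrite cE; apply: divides_refl.
have [[a [b [hE sza szb]]]|nab] := pselect
    (exists a b, [/\ h = a * b, (1 < size a)%N & (1 < size b)%N]); last first.
  exists 1, [:: h]; rewrite unitr1 big_seq1 mul1r; split=> // p.
  rewrite inE => /eqP->; apply: primitive_indecomposable_prime => // a b hE sza szb.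
  by apply: nab; exists a, b.
have a0 : a != 0 by apply: contraNneq h0 => a0; rewrite hE a0 mul0r.
have b0 : b != 0 by apply: contraNneq h0 => b0; rewrite hE b0 mulr0.
have szE : size h = (size a + size b).-1 by rewrite hE size_mul.
have [||u [s [uU sp aE]]] := IHn (size a) _ a erefl a0; first by lia.
  by apply: (@primitive_factor a b); rewrite -hE.
have [||v [t [vU tp bE]]] := IHn (size b) _ b erefl b0; first by lia.
  by apply: (@primitive_factor b a); rewrite mulrC -hE.
exists (u * v), (s ++ t); split; first by rewrite unitrM uU.
  by move=> p; rewrite mem_cat => /orP[/sp|/tp].
by rewrite hE {1}aE {1}bE big_cat /=; ring.
Qed.

Lemma factorial_poly : factorial_ring {poly R}.
Proof.
move=> h h0; have [s [g [sp gprim hE]]] := primitive_part h0.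
have [|u [t [uU tp gE]]] := primitive_prod_primes _ gprim.
  by apply: contraNneq h0 => g0; rewrite hE g0 scaler0.
exists u, (map polyC s ++ t); split=> //.
  by move=> p; rewrite mem_cat => /orP[/mapP[q /sp qp ->]|/tp//]; apply: prime_elt_polyC.
rewrite hE {1}gE big_cat /= big_map -rmorph_prod /= -mul_polyC; ring.
Qed.
End PolyFactorial.

Lemma prime_elt_iso (A B : idomainType) (phi : {rmorphism A -> B})
    (psi : {rmorphism B -> A}) p :
  cancel phi psi -> cancel psi phi -> prime_elt p -> prime_elt (phi p).
Proof.
move=> phiK psiK [p0 pU pM].
have div_psi x y : divides x y <-> divides (psi x) (psi y).
  split=> [[h ->]|[h hE]]; first by exists (psi h); rewrite rmorphM.
  by exists (phi h); rewrite -(psiK y) hE rmorphM psiK.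
split=> [||x y].
- by apply: contraNneq p0 => /(congr1 psi); rewrite phiK rmorph0 => ->.
- by apply: contraNN pU => /(rmorph_unit psi); rewrite phiK.
by move=> /div_psi; rewrite phiK rmorphM => /pM; rewrite -{1 2}(phiK p) -!div_psi.
Qed.

Lemma factorial_transfer (A B : idomainType) (phi : {rmorphism A -> B})
    (psi : {rmorphism B -> A}) :
  cancel phi psi -> cancel psi phi -> factorial_ring A -> factorial_ring B.
Proof.
move=> phiK psiK fA b b0; have [|u [s [uU sp bE]]] := fA (psi b).
  by apply: contraNneq b0 => /(congr1 phi); rewrite psiK rmorph0 => ->.
exists (phi u), (map phi s); split; first exact: rmorph_unit.
  by move=> q /mapP[p /sp pp ->]; apply: prime_elt_iso phiK psiK pp.
by rewrite -(psiK b) bE rmorphM rmorph_prod big_map.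
Qed.

(** * Polynomials in several variables *)

Lemma rmorph_mpolyE (n : nat) (R S : comNzRingType) (phi : {rmorphism {mpoly R[n]} -> S})
    (p : {mpoly R[n]}) :
  phi p = mmap (phi \o @mpolyC n R) (fun i => phi 'X_i) p.
Proof.
rewrite {1}[p]mpolyE rmorph_sum; apply: eq_bigr => m _.
rewrite -mul_mpolyC rmorphM /= mpolyXE_id rmorph_prod; congr (_ * _).
by apply: eq_bigr => i _; rewrite rmorphXn.
Qed.

Lemma eq_rmorph_mpoly (n : nat) (R S : comNzRingType)
    (phi psi : {rmorphism {mpoly R[n]} -> S}) :
  (forall c, phi c%:MP = psi c%:MP) -> (forall i, phi 'X_i = psi 'X_i) -> phi =1 psi.
Proof.
move=> eqC eqX p; rewrite (rmorph_mpolyE phi) (rmorph_mpolyE psi).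
apply: eq_bigr => m _ /=.
rewrite eqC; congr (_ * _); apply: eq_bigr => i _; by rewrite eqX.
Qed.

Section MpolyPolyIso.
Variables (n : nat) (R : comNzRingType).

(** One variable is made outermost, so that induction on the number of variables adjoins a single
    variable to a ring already treated. *)
Definition mpoly_topoly : {mpoly R[n.+1]} -> {poly {mpoly R[n]}} :=
  mmap (polyC \o @mpolyC n R)
    (fun i => if unlift ord0 i is Some j then ('X_j)%:P else 'X).

Definition poly_tompoly : {poly {mpoly R[n]}} -> {mpoly R[n.+1]} :=
  horner_eval 'X_ord0 \o
    map_poly (mmap (@mpolyC n.+1 R) (fun j => 'X_(lift ord0 j))).

HB.instance Definition _ := GRing.RMorphism.on mpoly_topoly.
HB.instance Definition _ := GRing.RMorphism.on poly_tompoly.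

Lemma poly_tompolyC p :
  poly_tompoly p%:P = mmap (@mpolyC n.+1 R) (fun j => 'X_(lift ord0 j)) p.
Proof. by rewrite /poly_tompoly /= map_polyC /horner_eval hornerC. Qed.

Lemma mpoly_topolyX i :
  mpoly_topoly 'X_i = if unlift ord0 i is Some j then ('X_j)%:P else 'X.
Proof. by rewrite /mpoly_topoly mmapX mmap1U. Qed.

Lemma mpoly_topolyK : cancel mpoly_topoly poly_tompoly.
Proof.
move=> p; rewrite -[RHS]/(idfun p).
apply: (@eq_rmorph_mpoly _ _ _ (poly_tompoly \o mpoly_topoly)) => [c|i] /=.
  by rewrite /mpoly_topoly mmapC /= poly_tompolyC mmapC.
rewrite mpoly_topolyX; case: unliftP => [j|] ->.
  by rewrite poly_tompolyC mmapX mmap1U.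
by rewrite /poly_tompoly /= map_polyX /horner_eval hornerX.
Qed.

Lemma poly_tompolyK : cancel poly_tompoly mpoly_topoly.
Proof.
elim/poly_ind => [|p c IHp]; first by rewrite !rmorph0.
rewrite !rmorphD !rmorphM /= IHp; congr (_ * _ + _).
  by rewrite /poly_tompoly /= map_polyX /horner_eval hornerX mpoly_topolyX unlift_none.
rewrite poly_tompolyC.
apply: (@eq_rmorph_mpoly _ _ _ (mpoly_topoly \o
   mmap (@mpolyC n.+1 R) (fun j => 'X_(lift ord0 j))) polyC) => [x|i] /=.
  by rewrite mmapC /mpoly_topoly mmapC.
by rewrite mmapX mmap1U mpoly_topolyX liftK.
Qed.
End MpolyPolyIso.

Lemma factorial_mpoly (K : fieldType) (n : nat) : factorial_ring {mpoly K[n]}.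
Proof.
elim: n => [|n IHn].
  move=> a a0; exists a, [::]; rewrite big_nil mulr1; split=> //.
  move: a0; rewrite [a]nvar0_mpolyC mpolyC_eq0 => a0.
  by apply: rmorph_unit; rewrite unitfE.
exact: (factorial_transfer (@poly_tompolyK n K) (@mpoly_topolyK n K) (factorial_poly IHn)).
Qed.

Lemma irreducible_prime (K : fieldType) (n : nat) (p : {mpoly K[n]}) :
  irreducible_elt p -> prime_elt p.
Proof. exact/factorial_irreducible_prime/factorial_mpoly. Qed.

Definition infinite_ring (R : nzRingType) := forall s : seq R, exists x, x \notin s.

Lemma pchar0_infinite (K : fieldType) : [pchar K] =i pred0 -> infinite_ring K.
Proof.
move=> /pcharf0P K0 s; apply: contrapT => /forallNP nx.
have natI : injective (fun i : nat => (i%:R : K)).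
  move=> i j /= ij; wlog lij : i j ij / (i <= j)%N.
    by move=> W; case/orP: (leq_total i j) => [/W->|/W->].
  have := K0 (j - i)%N; rewrite natrB // ij subrr eqxx => /esym.
  by rewrite subn_eq0 => ji; apply/eqP; rewrite eqn_leq lij.
have : (size (map (fun i => i%:R : K) (iota 0 (size s).+1)) <= size s)%N.
  apply: uniq_leq_size; first by rewrite map_inj_uniq ?iota_uniq.
  by move=> x _; apply: contrapT => /negP; apply: nx.
by rewrite size_map size_iota ltnn.
Qed.

Lemma mpoly_neq0_point (K : fieldType) (n : nat) (p : {mpoly K[n]}) :
  infinite_ring K -> p != 0 -> exists v : 'I_n -> K, p.@[v] != 0.
Proof.
move=> Kinf; elim: n p => [|n IHn] p p0.
  exists (fun=> 0); move: p0; rewrite [p]nvar0_mpolyC mpolyC_eq0 => p0.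
  by rewrite mevalC.
set q := mpoly_topoly p.
have q0 : q != 0.
  by apply: contraNneq p0 => /(congr1 (@poly_tompoly n K)); rewrite mpoly_topolyK rmorph0 => ->.
have [v vq] : exists v, (lead_coef q).@[v] != 0 by apply: IHn; rewrite lead_coef_eq0.
pose qv := map_poly (meval v) q.
have qv0 : qv != 0.
  apply: contraNneq vq => /(congr1 (fun r : {poly K} => r`_(size q).-1)).
  by rewrite coef_map coef0 /= => ->.
have [x xr] : exists x, ~~ root qv x.
  apply: contrapT => /forallNP nx.
  have big m : exists s : seq K, uniq s /\ size s = m.
    elim: m => [|m [s [us <-]]]; first by exists [::].
    by have [y ys] := Kinf s; exists (y :: s); rewrite /= ys us.
  have [s [us szs]] := big (size qv).
  suff: (size s < size qv)%N by rewrite szs ltnn.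
  apply: max_poly_roots => //.
  by apply/allP => y _; apply: contrapT => /negP/nx.
exists (fun i => if unlift ord0 i is Some j then v j else x).
suff -> : p.@[fun i => if unlift ord0 i is Some j then v j else x] = qv.[x] by [].
rewrite /qv /q.
pose ev := (horner_eval x \o (map_poly (meval v)) \o (@mpoly_topoly n K)).
rewrite -/(ev p); apply: (@eq_rmorph_mpoly _ _ _
  (meval (fun i => if unlift ord0 i is Some j then v j else x)) ev) => [c|i].
  by rewrite /ev /= mevalC /mpoly_topoly mmapC /= map_polyC /= mevalC /horner_eval hornerC.
rewrite /ev /= mevalXU mpoly_topolyX; case: unliftP => [j|] _.
  by rewrite map_polyC /= mevalXU /horner_eval hornerC.
by rewrite map_polyX /horner_eval hornerX.
Qed.

Lemma eq_mpoly_eval (K : fieldType) (n : nat) (p q : {mpoly K[n]}) :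
  infinite_ring K -> (forall v, p.@[v] = q.@[v]) -> p = q.
Proof.
move=> Kinf pq; apply/eqP; rewrite -subr_eq0; apply: contraT.
by move/(mpoly_neq0_point Kinf) => [v]; rewrite mevalB pq subrr eqxx.
Qed.

(** * Multiplicity along a prime *)

Section MultAlong.
Variables (K : fieldType).
Implicit Types (Q G H : {mpoly K[3]}).

Lemma prime_msize Q : prime_elt Q -> (1 < msize Q)%N.
Proof.
case=> Q0 QU _; rewrite ltnNge; apply: contraNN QU => /msize1_polyC QE.
by rewrite QE; apply: rmorph_unit; rewrite unitfE -(mpolyC_eq0 3) -QE.
Qed.

Lemma msize_exp Q e : Q != 0 -> (msize (Q ^+ e)).-1 = (e * (msize Q).-1)%N.
Proof.
move=> Q0; elim: e => [|e IHe]; first by rewrite expr0 msize1.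
have szQ := mpolySpred mdeg Q0.
have szQe := mpolySpred mdeg (expf_neq0 e Q0).
rewrite exprS msizeM ?expf_neq0 // mulSn -IHe.
by move: szQ szQe; move: (msize Q) (msize (Q ^+ e)) => a b; lia.
Qed.

(** A count of degrees, which shows that the bound [e < msize G] in [mult_along] excludes no
    exponent. *)
Lemma divides_exp_lt_msize Q G e : prime_elt Q -> G != 0 -> divides (Q ^+ e) G ->
  (e < msize G)%N.
Proof.
move=> Qp G0 [h hE]; have szQ := prime_msize Qp.
have Q0 : Q != 0 by case: Qp.
have h0 : h != 0 by apply: contraNneq G0 => h0; rewrite hE h0 mul0r.
have -> : msize G = (msize h + msize (Q ^+ e)).-1 by rewrite hE msizeM ?expf_neq0.
have := msize_exp e Q0; have := mpolySpred mdeg h0.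
have := mpolySpred mdeg (expf_neq0 e Q0); move: szQ.
by move: (msize Q) (msize h) (msize (Q ^+ e)) => a b c; nia.
Qed.

Lemma mult_alongP Q G e : prime_elt Q -> G != 0 ->
  (mult_along Q G = e <-> divides (Q ^+ e) G /\ ~ divides (Q ^+ e.+1) G).
Proof.
move=> Qp G0.
have lb j : divides (Q ^+ j) G -> (j <= mult_along Q G)%N.
  move=> jG; have ltj := divides_exp_lt_msize Qp G0 jG.
  rewrite /mult_along (bigD1 (Ordinal ltj)) /= ?leq_maxl //; exact/asboolP.
have att : divides (Q ^+ mult_along Q G) G.
  rewrite /mult_along; elim/big_rec: _ => [|i x].
    by rewrite expr0; exists G; rewrite mulr1.
  by move=> /asboolP iG xG; rewrite /maxn; case: ifP.
split=> [<-|[eG nG]]; first by split=> // /lb; rewrite ltnn.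
apply/eqP; rewrite eqn_leq lb // andbT leqNgt; apply/negP => lte; apply: nG.
exact: divides_trans (divides_exp _ lte) att.
Qed.

Lemma mult_along_split Q G : prime_elt Q -> G != 0 ->
  exists2 H, G = Q ^+ mult_along Q G * H & ~ divides Q H.
Proof.
move=> Qp G0; have /(mult_alongP _ Qp G0)[[H HE] nG] := erefl (mult_along Q G).
exists H; first by rewrite mulrC.
by case=> H' H'E; apply: nG; exists H'; rewrite exprS mulrA -H'E.
Qed.

Lemma mult_along_unique Q G e H : prime_elt Q -> G = Q ^+ e * H -> ~ divides Q H ->
  mult_along Q G = e.
Proof.
move=> Qp GE nH; have Q0 : Q != 0 by case: Qp.
have H0 : H != 0 by apply: contra_notN nH => /eqP->; apply: divides0.
have G0 : G != 0 by rewrite GE mulf_neq0 ?expf_neq0.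
apply/(mult_alongP _ Qp G0); split; first by exists H; rewrite mulrC.
case=> H' H'E; apply: nH; exists H'; apply: (mulfI (expf_neq0 e Q0)).
by rewrite -GE H'E exprSr !mulrA [H' * _]mulrC.
Qed.

Lemma mult_along_eq0 Q G : prime_elt Q -> ~ divides Q G -> mult_along Q G = 0%N.
Proof. by move=> Qp nG; apply: (mult_along_unique Qp _ nG); rewrite mul1r. Qed.

Lemma mult_alongM Q G H : prime_elt Q -> G != 0 -> H != 0 ->
  mult_along Q (G * H) = (mult_along Q G + mult_along Q H)%N.
Proof.
move=> Qp G0 H0; have [G' GE nG'] := mult_along_split Qp G0.
have [H' HE nH'] := mult_along_split Qp H0.
apply: (@mult_along_unique _ _ _ (G' * H') Qp).
  by rewrite {1}GE {1}HE exprD mulrACA.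
by case: (Qp) => _ _ QM /QM[].
Qed.

Lemma mult_along_unit Q u : prime_elt Q -> u \is a GRing.unit -> mult_along Q u = 0%N.
Proof. by move=> Qp /(prime_elt_ndivides_unit Qp)/(mult_along_eq0 Qp). Qed.

Lemma mult_along_prod Q (J : finType) (P : pred J) (E : J -> {mpoly K[3]}) :
  prime_elt Q -> (forall j, P j -> E j != 0) ->
  mult_along Q (\prod_(j | P j) E j) = (\sum_(j | P j) mult_along Q (E j))%N.
Proof.
move=> Qp E0.
suff [] : \prod_(j | P j) E j != 0 /\
  mult_along Q (\prod_(j | P j) E j) = (\sum_(j | P j) mult_along Q (E j))%N by [].
elim/big_rec2: _ => [|j y x Pj [x0 <-]].
  by rewrite oner_neq0 mult_along_unit ?unitr1.
by rewrite mulf_neq0 ?E0 // mult_alongM ?E0.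
Qed.

Lemma mult_alongX Q G e : prime_elt Q -> G != 0 ->
  mult_along Q (G ^+ e) = (e * mult_along Q G)%N.
Proof.
move=> Qp G0; elim: e => [|e IHe]; first by rewrite expr0 mult_along_unit ?unitr1.
by rewrite exprS mult_alongM ?expf_neq0 // IHe mulSn.
Qed.

End MultAlong.

Lemma prime_divisor_prime (K : fieldType) (Q : prime_divisor K) : prime_elt (Q : {mpoly K[3]}).
Proof. by case: Q => Q Qirr _ /=; apply: irreducible_prime. Qed.

(** * Resultants with formal degrees *)

Section PolyRows.
Variable R : comNzRingType.

Definition poly_rows n m (E : nat -> {poly R}) : 'M[R]_(n, m) :=
  \matrix_(i < n) poly_rV (E i).

Lemma poly_rowsE n m E i j : @poly_rows n m E i j = (E i)`_j.
Proof. by rewrite !mxE. Qed.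

Lemma mul_poly_rows n m l (A : 'M[R]_(l, n)) (E E' : nat -> {poly R}) :
  (forall i : 'I_l, \sum_(h < n) A i h *: E h = E' i) ->
  A *m @poly_rows n m E = @poly_rows l m E'.
Proof.
move=> AE; apply/matrixP=> i j; rewrite poly_rowsE -AE mxE coef_sum.
by apply: eq_bigr => h _; rewrite poly_rowsE coefZ.
Qed.

Lemma sum_coef_mul n (f g : {poly R}) : (size f <= n)%N ->
  \sum_(h < n) f`_h *: ('X^h * g) = f * g.
Proof.
move=> szf; have {2}-> : f = \poly_(i < n) f`_i.
  apply/polyP=> i; rewrite coef_poly; case: ltnP => // ni.
  by rewrite nth_default // (leq_trans szf).
by rewrite poly_def mulr_suml; apply: eq_bigr => h _; rewrite -scalerAl.
Qed.

Lemma sum_coef_Xn n (f : {poly R}) : (size f <= n)%N ->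
  \sum_(h < n) f`_h *: 'X^h = f.
Proof.
move=> szf; rewrite -[RHS]mulr1 -(sum_coef_mul 1 szf).
by apply: eq_bigr => h _; rewrite mulr1.
Qed.

(** The row order is that of [binary_disc]. The numbers [d1] and [d2] are the formal degrees of [p]
    and [q], so that [q] occupies [d1] rows. *)
Definition sylvester d1 d2 (p q : {poly R}) : 'M[R]_(d1 + d2) :=
  col_mx (@poly_rows d1 (d1 + d2) (fun i => 'X^i * q))
         (@poly_rows d2 (d1 + d2) (fun i => 'X^i * p)).

Definition res d1 d2 (p q : {poly R}) : R := \det (sylvester d1 d2 p q).

Lemma binary_discE d f : binary_disc d f = res d.-1 d.-1 (f *+ d - 'X * f^`()) f^`().
Proof. by []. Qed.

Lemma mul_poly_rows_shift n N (y : 'rV[R]_n) (g : {poly R}) :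
  (size g + n <= N.+1)%N ->
  rVpoly (y *m @poly_rows n N (fun i => 'X^i * g)) = rVpoly y * g.
Proof.
move=> szg; rewrite (@mul_poly_rows _ _ _ _ _ (fun=> rVpoly y * g)).
  rewrite (_ : poly_rows _ _ _ = poly_rV (rVpoly y * g)).
    have [->|y0] := eqVneq (rVpoly y) 0; first by rewrite mul0r !linear0.
    have [->|g0] := eqVneq g 0; first by rewrite mulr0 !linear0.
    rewrite poly_rV_K // (leq_trans (size_polyMleq _ _)) //.
    have : (size (rVpoly y) <= n)%N by apply: size_poly.
    by move: szg; move: (size _) (size _) => a b; lia.
  by apply/rowP=> j; rewrite !mxE.
move=> i; rewrite -(@sum_coef_mul n); last exact: size_poly.
by apply: eq_bigr => h _; rewrite coef_rVpoly_ord ord1.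
Qed.

(** Rows read as polynomials make the Sylvester matrix the map (a, b) |-> a q + b p with bounded
    sizes. Its kernel thus consists of relations between [p] and [q], and its image lies in the
    ideal that they generate. *)
Lemma mul_sylvester d1 d2 (p q : {poly R}) (z : 'rV[R]_(d1 + d2)) :
  (size p <= d1.+1)%N -> (size q <= d2.+1)%N ->
  rVpoly (z *m sylvester d1 d2 p q) = rVpoly (lsubmx z) * q + rVpoly (rsubmx z) * p.
Proof.
move=> szp szq; rewrite -{1}[z]hsubmxK mul_row_col raddfD /=.
by rewrite !mul_poly_rows_shift //; lia.
Qed.

(** Row 0 of the adjugate is sent to the determinant times the first basis vector, which as a
    polynomial is the constant 1. *)
Lemma res_ideal d1 d2 (p q : {poly R}) : (0 < d1 + d2)%N ->
  (size p <= d1.+1)%N -> (size q <= d2.+1)%N ->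
  exists u v : {poly R}, [/\ (size u <= d2)%N, (size v <= d1)%N
    & (res d1 d2 p q)%:P = u * p + v * q].
Proof.
move=> d_gt0 szp szq; pose i0 : 'I_(d1 + d2) := Ordinal d_gt0.
pose z := row i0 (\adj (sylvester d1 d2 p q)).
exists (rVpoly (rsubmx z)), (rVpoly (lsubmx z)); split; try exact: size_poly.
rewrite addrC -mul_sylvester // -row_mul mul_adj_mx -/(res d1 d2 p q).
apply/polyP=> j; rewrite coef_rVpoly coefC.
case: insubP => [i _ <-|]; first by rewrite !mxE -val_eqE /= eq_sym mulrb.
by rewrite -leqNgt => dj; case: eqP => // j0; rewrite j0 leqNgt d_gt0 in dj.
Qed.

Lemma det_castmx n n' (e : n = n') (A : 'M[R]_n) : \det (castmx (e, e) A) = \det A.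
Proof. by case: _ / e; rewrite castmx_id. Qed.

End PolyRows.

(** The two matrices differ by a permutation of rows that depends on the degrees only; hence one
    sign serves all rings. *)
Lemma res_swap d1 d2 : exists b : bool, forall (R : comNzRingType) (p q : {poly R}),
  res d1 d2 p q = (-1) ^+ b * res d2 d1 q p.
Proof.
pose f (i : 'I_(d1 + d2)) : 'I_(d1 + d2) :=
  cast_ord (addnC d2 d1) (match split i with inl j => rshift d2 j | inr j => lshift d1 j end).
have f_inj : injective f.
  move=> i j /cast_ord_inj; rewrite -{2}[i]splitK -{2}[j]splitK.
  case: (split i) => i'; case: (split j) => j' /=.
  - by move/rshift_inj->.
  - by move/eqP; rewrite eq_rlshift.
  - by move/eqP; rewrite eq_lrshift.
  by move/lshift_inj->.
exists (odd_perm (perm f_inj)) => R p q.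
rewrite /res -(det_castmx (addnC d2 d1)).
set C := castmx _ _.
have -> : sylvester d1 d2 p q = perm_mx (perm f_inj) *m C; last first.
  by rewrite det_mulmx det_perm.
rewrite -row_permE; apply/matrixP=> i j; rewrite /C [RHS]mxE castmxE permE /=.
rewrite /f cast_ordK -[in LHS](splitK i) /sylvester.
case: (split i) => i' /=.
  by rewrite col_mxEu col_mxEd !poly_rowsE.
by rewrite col_mxEu col_mxEd !poly_rowsE.
Qed.

Lemma map_sylvester (R S : comNzRingType) (phi : {rmorphism R -> S}) d1 d2
    (p q : {poly R}) :
  map_mx phi (sylvester d1 d2 p q) = sylvester d1 d2 (map_poly phi p) (map_poly phi q).
Proof.
rewrite /sylvester map_col_mx; congr col_mx; apply/matrixP=> i j;
  by rewrite mxE !poly_rowsE -(map_polyXn phi) -rmorphM coef_map.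
Qed.

Lemma map_res (R S : comNzRingType) (phi : {rmorphism R -> S}) d1 d2 (p q : {poly R}) :
  phi (res d1 d2 p q) = res d1 d2 (map_poly phi p) (map_poly phi q).
Proof. by rewrite /res -map_sylvester det_map_mx. Qed.

Lemma map_binary_disc (R S : comNzRingType) (phi : {rmorphism R -> S}) d (f : {poly R}) :
  phi (binary_disc d f) = binary_disc d (map_poly phi f).
Proof.
by rewrite !binary_discE map_res deriv_map rmorphB rmorphMn rmorphM /= map_polyX.
Qed.

(** * Poisson's formula *)

Section Poisson.
Variable F : fieldType.
Implicit Types p q : {poly F}.

(** Division of 'X^i q by [p] factors the matrix: quotients and remainders form a block triangular
    factor, and the monomials below degree [d1] together with the multiples of [p] form a triangular
    one whose diagonal carries [lead_coef p]. *)
Lemma res_modp d1 d2 p q : size p = d1.+1 -> (size q <= d2.+1)%N ->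
  res d1 d2 p q =
    lead_coef p ^+ d2 * \det (@poly_rows F d1 d1 (fun i => ('X^i * q) %% p)).
Proof.
move=> szp szq; have p0 : p != 0 by rewrite -size_poly_eq0 szp.
set N := poly_rows _ _ _; pose D := @poly_rows F d1 d2 (fun i => ('X^i * q) %/ p).
pose B := col_mx (@poly_rows F d1 (d1 + d2) (fun i => 'X^i))
                 (@poly_rows F d2 (d1 + d2) (fun i => 'X^i * p)).
have -> : res d1 d2 p q = \det (block_mx N D 0 1%:M *m B).
  congr (\det _); rewrite mul_block_col /sylvester; congr col_mx; last first.
    by rewrite mul0mx add0r mul1mx.
  apply/matrixP=> i j; rewrite mxE.
  rewrite (@mul_poly_rows _ _ _ _ _ _ (fun i => ('X^i * q) %% p)); last first.
    move=> i'; rewrite -[RHS](@sum_coef_Xn _ d1).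
      by apply: eq_bigr => h _; rewrite poly_rowsE.
    by rewrite -ltnS -szp ltn_modp.
  rewrite (@mul_poly_rows _ _ _ _ _ _ (fun i => ('X^i * q) %/ p * p)); last first.
    move=> i'; rewrite -[RHS](@sum_coef_mul _ d2).
      by apply: eq_bigr => h _; rewrite poly_rowsE.
    rewrite size_divp // szp; have [->|q0] := eqVneq q 0.
      by rewrite mulr0 size_poly0.
    rewrite leq_subLR (leq_trans (size_polyMleq _ _)) // size_polyXn.
    apply: (@leq_trans (i'.+1 + d2.+1).-1); first by rewrite -!subn1 leq_sub2r ?leq_add2l.
    by move: (ltn_ord i'); lia.
  by rewrite /poly_rows !mxE -coefD addrC -divp_eq.
rewrite det_mulmx det_ublock det1 mulr1 mulrC; congr (_ * _).
rewrite det_trig; last first.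
  apply/is_trig_mxP=> i j; rewrite -{1 2}(splitK i) /B.
  case: (split i) => i' /= ltij.
    by rewrite col_mxEu poly_rowsE coefXn gtn_eqF.
  rewrite col_mxEd poly_rowsE coefXnM; case: ltnP => // lej.
  by rewrite nth_default // szp; lia.
rewrite big_split_ord /= big1 => [|i _]; last first.
  by rewrite col_mxEu poly_rowsE coefXn eqxx.
rewrite mul1r (eq_bigr (fun=> lead_coef p)) ?prodr_const ?card_ord // => i _.
rewrite col_mxEd poly_rowsE coefXnM /= ltnNge leq_addl /= addnK.
by rewrite lead_coefE szp.
Qed.

(** The determinant is the norm of the multiplication by [q] on F[X]/(p); evaluation at the roots,
    that is the Vandermonde matrix, diagonalizes it. *)
Lemma det_mul_mod_split (s : seq F) p q :
  size p = (size s).+1 -> all (root p) s -> uniq s ->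
  \det (@poly_rows F (size s) (size s) (fun i => ('X^i * q) %% p)) = \prod_(x <- s) q.[x].
Proof.
move=> szp rs us; set N := poly_rows _ _ _; set d := size s in N *.
pose a : 'rV[F]_d := \row_j s`_j; pose V := Vandermonde d a.
have V0 : \det V != 0.
  rewrite det_Vandermonde; apply/prodf_neq0 => i _; apply/prodf_neq0 => j ltij.
  by rewrite !mxE subr_eq0 nth_uniq // gtn_eqF.
have NV : N *m V = V *m diag_mx (\row_j q.[s`_j]).
  rewrite mul_mx_diag; apply/matrixP=> i j; rewrite !mxE.
  have <- : (('X^i * q) %% p).[s`_j] = s`_j ^+ i * q.[s`_j].
    have /rootP pj : root p s`_j by apply: (allP rs); apply: mem_nth.
    have := congr1 (fun r => r.[s`_j]) (divp_eq ('X^i * q) p).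
    by rewrite !hornerE pj mulr0 add0r => ->.
  rewrite (@horner_coef_wide _ d); last by rewrite -ltnS -szp ltn_modp -size_poly_eq0 szp.
  by apply: eq_bigr => h _; rewrite poly_rowsE !mxE.
move/(congr1 determinant): NV; rewrite !det_mulmx mulrC => /(mulfI V0) ->.
rewrite det_diag (big_nth 0) big_mkord; apply: eq_bigr => i _; by rewrite mxE.
Qed.

Lemma res_roots (s : seq F) d2 p q :
  size p = (size s).+1 -> all (root p) s -> uniq s -> (size q <= d2.+1)%N ->
  res (size s) d2 p q = lead_coef p ^+ d2 * \prod_(x <- s) q.[x].
Proof. by move=> szp rs us szq; rewrite (res_modp szp szq) (@det_mul_mod_split s). Qed.

End Poisson.

(* The sign depends only on n; G *+ n is used because its leading coefficient
   n c is that of G^`(). *)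
Lemma binary_disc_roots n : exists b : bool, forall (F : fieldType) (s : seq F) (G : {poly F}),
  [pchar F] =i pred0 -> size s = n -> (0 < n)%N -> size G = n.+1 -> all (root G) s -> uniq s ->
  (lead_coef G *+ n) * binary_disc n G =
    (-1) ^+ b * ((lead_coef G *+ n) ^+ n.-1 * \prod_(x <- s) G^`().[x]).
Proof.
case: n => [|n]; first by exists false.
have [b1 sw1] := res_swap n n; have [b2 sw2] := res_swap n n.+1.
exists (b1 (+) b2) => F s G F0 szs _ szG rs us /=.
have nz : n.+1%:R != 0 :> F by move/pcharf0P: F0 => ->.
set c := lead_coef G *+ n.+1.
have cE : lead_coef (G *+ n.+1) = c.
  by rewrite /c -scaler_nat lead_coefZ mulr_natl.
have szGn : size (G *+ n.+1) = n.+2 by rewrite -scaler_nat size_scale.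
have G'n : G^`()`_n = c by rewrite coef_deriv /c lead_coefE szG.
have c0 : c != 0.
  by rewrite /c -mulr_natl mulf_neq0 // lead_coef_eq0 -size_poly_eq0 szG.
have szG' : size G^`() = n.+1.
  apply/eqP; rewrite eqn_leq; apply/andP; split; last first.
    by rewrite ltnNge; apply: contra c0 => /leq_sizeP h; rewrite -G'n h.
  by have := lt_size_deriv (p := G); rewrite -size_poly_eq0 szG => /(_ isT).
have lG' : lead_coef G^`() = c by rewrite lead_coefE szG' G'n.
set r := G *+ n.+1 - 'X * G^`().
have szr : (size r <= n.+1)%N.
  apply/leq_sizeP => j; rewrite leq_eqVlt => /orP[/eqP<-|ltj].
    rewrite coefB coefXM coefMn coef_deriv /= subrr //.
  rewrite coefB coefXM coefMn; case: j ltj => // j ltj.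
  by rewrite /= coef_deriv !nth_default ?szG // !mul0rn subrr.
have E1 : res n n G^`() r = c ^+ n * \det (@poly_rows F n n (fun i => ('X^i * r) %% G^`())).
  by rewrite res_modp // lG'.
(* [G *+ n.+1] and [r] agree modulo the derivative; raising the formal degree of the second argument
   from n to n + 1 costs one factor [c]. *)
have E2 : res n n.+1 G^`() (G *+ n.+1) =
    c ^+ n.+1 * \det (@poly_rows F n n (fun i => ('X^i * r) %% G^`())).
  rewrite res_modp ?szGn // lG'; congr (_ * \det _); apply/matrixP=> i j.
  rewrite !poly_rowsE /r mulrBr mulrCA modpD modpN.
  by rewrite !mulrA modp_mull oppr0 addr0.
rewrite binary_discE /= -/r (sw1 F) mulrCA.
have -> : c * res n n G^`() r = res n n.+1 G^`() (G *+ n.+1) by rewrite E1 E2 exprS mulrA.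
rewrite (sw2 F) mulrA -signr_addb; congr (_ * _).
rewrite -szs res_roots ?szs ?szG' ?cE //.
apply/allP => x /(allP rs); rewrite /root hornerMn => /eqP->; by rewrite mul0rn.
Qed.

(** * Substitutions in binary forms *)

Section Substitution.
Variables (R : comNzRingType) (a b c d : R).
Implicit Types f g p q : {poly R}.
Let A : {poly R} := a%:P * 'X + b%:P.
Let B : {poly R} := c%:P * 'X + d%:P.

(* sum_i f_i s^i r^(e-i) with (s, r) replaced by (a s + b r, c s + d r) *)
Definition bsubst e f : {poly R} := \sum_(i < e.+1) f`_i *: (A ^+ i * B ^+ (e - i)).

Lemma bsubst_is_linear e : linear (bsubst e).
Proof.
move=> x f g; rewrite /bsubst scaler_sumr -big_split /=; apply: eq_bigr => i _.
by rewrite coefD coefZ scalerDl scalerA.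
Qed.
HB.instance Definition _ e :=
  GRing.isLinear.Build R {poly R} {poly R} _ (bsubst e) (bsubst_is_linear e).

Lemma bsubstXn e i : (i <= e)%N -> bsubst e 'X^i = A ^+ i * B ^+ (e - i).
Proof.
move=> ie; rewrite /bsubst (bigD1 (Ordinal (ie : (i < e.+1)%N))) //= coefXn eqxx scale1r.
rewrite big1 ?addr0 // => j; rewrite -val_eqE /= coefXn => /negPf->.
by rewrite scale0r.
Qed.

Lemma size_affine_exp x y i : (size ((x%:P * 'X + y%:P : {poly R}) ^+ i)%R <= i.+1)%N.
Proof.
elim: i => [|i IHi]; first by rewrite expr0 size_poly1.
rewrite exprS (leq_trans (size_polyMleq _ _)) //.
have : (size (x%:P * 'X + y%:P : {poly R})%R <= 2)%N.
  rewrite size_MXaddC; case: ifP => // _; rewrite ltnS; exact: size_polyC_leq1.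
by move: IHi; move: (size _) (size _) => u v; lia.
Qed.

Lemma size_bsubst e f : (size (bsubst e f) <= e.+1)%N.
Proof.
rewrite /bsubst (leq_trans (size_sum _ _ _)) //; apply/bigmax_leqP => i _.
rewrite (leq_trans (size_scale_leq _ _)) // (leq_trans (size_polyMleq _ _)) //.
have := size_affine_exp a b i; have := size_affine_exp c d (e - i).
by rewrite -/A -/B; have := ltn_ord i; move: (size _) (size _) => u v; lia.
Qed.

Lemma bsubst_sum e f : (size f <= e.+1)%N ->
  bsubst e f = \sum_(i < e.+1) f`_i *: bsubst e 'X^i.
Proof. by move=> szf; rewrite -[in LHS](sum_coef_Xn szf) linear_sum; apply: eq_bigr => i _;
  rewrite linearZ. Qed.

Lemma bsubstM e e' f g : (size f <= e.+1)%N -> (size g <= e'.+1)%N ->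
  bsubst (e + e') (f * g) = bsubst e f * bsubst e' g.
Proof.
move=> szf szg; rewrite -[in LHS](sum_coef_Xn szf) -[in LHS](sum_coef_Xn szg).
rewrite (bsubst_sum szf) (bsubst_sum szg) !big_distrlr /= linear_sum.
apply: eq_bigr => i _; rewrite linear_sum; apply: eq_bigr => j _.
rewrite -!scalerAl -!scalerAr !linearZ /= -exprD.
have := ltn_ord i; have := ltn_ord j; rewrite !ltnS => je ie.
rewrite !scalerA [f`_i * _]mulrC !bsubstXn ?leq_add //; congr (_ *: _).
have -> : (e + e' - (i + j) = (e - i) + (e' - j))%N by lia.
by rewrite !exprD mulrACA.
Qed.

Lemma bsubstX_linear (x y : R) : bsubst 1 (x%:P * 'X + y%:P) = x%:P * A + y%:P * B.
Proof.
rewrite linearD /= !mul_polyC linearZ /= -[y%:P]alg_polyC linearZ /=.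
by rewrite -['X]expr1 -(expr0 'X) !bsubstXn // !expr1 !expr0 mul1r mulr1.
Qed.

Lemma bsubst_prod (I : Type) (s : seq I) (x y : I -> R) (m : I -> nat) :
  bsubst (\sum_(i <- s) m i) (\prod_(i <- s) ((x i)%:P * 'X + (y i)%:P) ^+ m i) =
  \prod_(i <- s) ((x i)%:P * A + (y i)%:P * B) ^+ m i.
Proof.
have szX i j : (size (((x i)%:P * 'X + (y i)%:P : {poly R}) ^+ j)%R <= j.+1)%N.
  exact: size_affine_exp.
have substX i j : bsubst j (((x i)%:P * 'X + (y i)%:P) ^+ j) =
    ((x i)%:P * A + (y i)%:P * B) ^+ j.
  elim: j => [|j IHj].
    by rewrite !expr0 -(expr0 'X) bsubstXn // !expr0 mulr1.
  rewrite !exprS -add1n bsubstM //; last exact: (szX i 1%N).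
  by rewrite bsubstX_linear IHj.
suff [] : (size (\prod_(i <- s) ((x i)%:P * 'X + (y i)%:P) ^+ m i)%R
              <= (\sum_(i <- s) m i).+1)%N /\
  bsubst (\sum_(i <- s) m i) (\prod_(i <- s) ((x i)%:P * 'X + (y i)%:P) ^+ m i) =
  \prod_(i <- s) ((x i)%:P * A + (y i)%:P * B) ^+ m i by [].
elim: s => [|i s [szs IHs]].
  by rewrite !big_nil size_poly1 -(expr0 'X) bsubstXn // !expr0 mulr1.
rewrite !big_cons; split; last by rewrite bsubstM ?substX ?IHs.
rewrite (leq_trans (size_polyMleq _ _)) //; have := szX i (m i); move: szs.
by move: (size _) (size _) => u v; lia.
Qed.

(* b = 0 and c = 0 are the cases in which the matrix of bsubst is triangular. *)
Hypothesis triang : (b == 0) || (c == 0).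

Let S n := @poly_rows R n n (fun i => A ^+ i * B ^+ (n.-1 - i)).

(** [S n] is the matrix of the substitution on binary forms of degree n - 1. It is triangular with
    diagonal entries a^i d^(n-1-i), and the exponents 0, ..., n - 1 add up to ['C(n, 2)]. *)
Lemma det_bsubst n : \det (S n) = (a * d) ^+ 'C(n, 2).
Proof.
have prodE : \prod_(i < n) (a ^+ i * d ^+ (n.-1 - i)) = (a * d) ^+ 'C(n, 2).
  rewrite big_split /= exprMn; congr (_ * _).
    by rewrite -bin2_sum big_mkord expr_sum.
  rewrite (reindex_inj rev_ord_inj) /= -bin2_sum big_mkord expr_sum.
  by apply: eq_bigr => i _; congr (_ ^+ _); have := ltn_ord i; lia.
rewrite -prodE; case/orP: triang => /eqP z0.
  have AE i : A ^+ i = (a ^+ i)%:P * 'X^i.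
    by rewrite /A z0 addr0 exprMn rmorphXn.
  rewrite -det_tr det_trig; last first.
    apply/is_trig_mxP => i j ltij; rewrite mxE poly_rowsE AE -mulrA coefCM.
    by rewrite coefXnM ltij mulr0.
  apply: eq_bigr => i _; rewrite mxE poly_rowsE AE -mulrA coefCM.
  rewrite coefXnM ltnn subnn -horner_coef0 horner_exp; congr (_ * _).
  by rewrite /B !hornerE.
have BE i : B ^+ i = (d ^+ i)%:P by rewrite /B z0 mul0r add0r rmorphXn.
rewrite det_trig; last first.
  apply/is_trig_mxP => i j ltij; rewrite poly_rowsE BE coefMC nth_default ?mul0r //.
  exact: leq_trans (size_affine_exp _ _ _) ltij.
apply: eq_bigr => i _; rewrite poly_rowsE BE coefMC; congr (_ * _).
elim: (i : nat) => [|j IHj]; first by rewrite !expr0 coef1.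
rewrite exprSr /A mulrDr mulrA coefD coefMX coefMC /= coefMC IHj exprSr.
by rewrite nth_default ?mul0r ?addr0 // size_affine_exp.
Qed.

(** Substitution is multiplicative, so it commutes with the map (a, b) |-> a q + b p. The matrices
    [S] give its action on the source pair, in degrees d1 - 1 and d2 - 1, and on the target, in
    degree d1 + d2 - 1. *)
Lemma sylvester_bsubst d1 d2 p q : (size p <= d1.+1)%N -> (size q <= d2.+1)%N ->
  sylvester d1 d2 p q *m S (d1 + d2) =
  block_mx (S d1) 0 0 (S d2) *m sylvester d1 d2 (bsubst d1 p) (bsubst d2 q).
Proof.
move=> szp szq; rewrite /sylvester mul_col_mx mul_block_col !mul0mx addr0 add0r.
have aux n e g : (size g <= e.+1)%N -> (n + e = d1 + d2)%N ->
    @poly_rows R n (d1 + d2) (fun i => 'X^i * g) *m S (d1 + d2) =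
    S n *m @poly_rows R n (d1 + d2) (fun i => 'X^i * bsubst e g).
  move=> szg; case: n => [|n] <-; first by rewrite (flatmx0 (_ *m _)) [RHS]flatmx0.
  have szXg (i : 'I_n.+1) : (size ('X^i * g)%R <= (n + e).+1)%N.
    have := size_polyMleq 'X^i g; rewrite size_polyXn; have := ltn_ord i.
    by move: szg; move: (size _) (size _) => u v; lia.
  rewrite [LHS](@mul_poly_rows _ _ _ _ _ (fun i => A ^+ i * B ^+ (n + e - i))
    (fun i => bsubst (n + e) ('X^i * g))); last first.
    move=> i; rewrite bsubst_sum //; apply: eq_bigr => h _.
    by rewrite poly_rowsE bsubstXn // -ltnS.
  rewrite (@mul_poly_rows _ _ _ _ _ _ (fun i => A ^+ i * B ^+ (n - i) * bsubst e g)).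
    apply/matrixP=> i j; rewrite !poly_rowsE bsubstM ?size_polyXn //.
    by rewrite bsubstXn // -ltnS.
  move=> i; rewrite -(@sum_coef_mul _ n.+1); last first.
    rewrite -bsubstXn ?size_bsubst // -ltnS //.
  by apply: eq_bigr => h _; rewrite poly_rowsE.
by congr col_mx; apply: aux => //; rewrite addnC.
Qed.

(** The exponent is what remains of ['C(d1 + d2, 2)] after ['C(d1, 2) + 'C(d2, 2)] is cancelled.
    Regularity of [a * d] stands in for invertibility, because the entries will be variables and
    polynomials. *)
Lemma res_bsubst d1 d2 p q : (size p <= d1.+1)%N -> (size q <= d2.+1)%N ->
  GRing.lreg (a * d) ->
  res d1 d2 (bsubst d1 p) (bsubst d2 q) = (a * d) ^+ (d1 * d2) * res d1 d2 p q.
Proof.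
move=> szp szq reg; apply: (@lregX _ _ ('C(d1, 2) + 'C(d2, 2)) reg).
have := congr1 determinant (sylvester_bsubst szp szq).
rewrite !det_mulmx det_ublock !det_bsubst -!/(res _ _ _ _) -exprD => <-.
rewrite mulrC mulrA -exprD; congr (_ ^+ _ * _).
clear; elim: d1 => [|n IHn]; first by rewrite bin0n mul0n addn0 add0n.
by rewrite addSn !binS IHn !bin1; lia.
Qed.

(** The chain rule for the two partial derivatives of a binary form, checked on monomials. *)
Lemma deriv_bsubst e f : (size f <= e.+2)%N ->
  (bsubst e.+1 f)^`() = a *: bsubst e f^`() + c *: bsubst e (f *+ e.+1 - 'X * f^`()) /\
  bsubst e.+1 f *+ e.+1 - 'X * (bsubst e.+1 f)^`() =
    b *: bsubst e f^`() + d *: bsubst e (f *+ e.+1 - 'X * f^`()).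
Proof.
move=> szf.
have A'E : A^`() = a%:P by rewrite /A derivD derivM derivX !derivC mul0r add0r mulr1 addr0.
have B'E : B^`() = c%:P by rewrite /B derivD derivM derivX !derivC mul0r add0r mulr1 addr0.
(* [D1 i] and [D2 i] are the partial derivatives of the monomial of index i after the substitution.
   Where a predecessor is truncated at 0, the multiplicity is 0 as well. *)
pose D1 i : {poly R} := A ^+ i.-1 * B ^+ (e.+1 - i) *+ i.
pose D2 i : {poly R} := A ^+ i * B ^+ (e.+1 - i).-1 *+ (e.+1 - i).
have s1 i : (i <= e.+1)%N -> bsubst e ('X^i)^`() = D1 i.
  move=> ie; rewrite derivXn linearMn /= /D1; case: i ie => // i ie.
  by rewrite bsubstXn // subSS.
have s2 i : (i <= e.+1)%N -> bsubst e ('X^i *+ e.+1 - 'X * ('X^i)^`()) = D2 i.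
  move=> ie; have -> : 'X * ('X^i)^`() = 'X^i *+ i :> {poly R}.
    by rewrite derivXn mulrnAr; case: i {ie} => [|i]; rewrite ?mulr0n // -exprS.
  rewrite -mulrnBr // linearMn /= /D2; case: (leqP i e) => [le_ie|lt_ei].
    by rewrite bsubstXn // (_ : (e.+1 - i).-1 = e - i)%N //; lia.
  by have -> : i = e.+1 by [lia]; rewrite subnn !mulr0n.
have d1 i : (i <= e.+1)%N -> (A ^+ i * B ^+ (e.+1 - i))^`() = a *: D1 i + c *: D2 i.
  move=> _; rewrite derivM !deriv_exp A'E B'E -!mul_polyC /D1 /D2.
  by rewrite !mulrnAl !mulrnAr [A ^+ i * (_ * _)]mulrCA !mulrA.
have d2 i : (i <= e.+1)%N ->
    (A ^+ i * B ^+ (e.+1 - i)) *+ e.+1 - 'X * (a *: D1 i + c *: D2 i) =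
    b *: D1 i + d *: D2 i.
  move=> ie.
  have -> : (A ^+ i * B ^+ (e.+1 - i)) *+ e.+1 = A * D1 i + B * D2 i.
    rewrite -{2}(subnKC ie) mulrnDr; congr (_ + _).
      by rewrite /D1 mulrnAr mulrA; case: i {ie} => [|i]; rewrite ?mulr0n // -exprS.
    rewrite /D2 mulrnAr mulrCA.
    by case: (e.+1 - i)%N => [|j]; rewrite ?mulr0n // -exprS.
  by rewrite /A /B -!mul_polyC; ring.
have E1 : bsubst e f^`() = \sum_(i < e.+2) f`_i *: D1 i.
  rewrite -[in LHS](sum_coef_Xn szf) 2!linear_sum /=; apply: eq_bigr => i _.
  by rewrite derivZ linearZ /= s1 // -ltnS.
have E2 : bsubst e (f *+ e.+1 - 'X * f^`()) = \sum_(i < e.+2) f`_i *: D2 i.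
  rewrite -[in LHS](sum_coef_Xn szf) linear_sum /= mulr_sumr -sumrMnl -sumrB linear_sum /=.
  apply: eq_bigr => i _; rewrite derivZ -scalerAr scalerMnr -scalerBr linearZ /=.
  by rewrite s2 // -ltnS.
have E3 : (bsubst e.+1 f)^`() = \sum_(i < e.+2) f`_i *: (a *: D1 i + c *: D2 i).
  by rewrite linear_sum /=; apply: eq_bigr => i _; rewrite derivZ d1 // -ltnS.
split.
  rewrite E3 E1 E2 !scaler_sumr -big_split /=; apply: eq_bigr => i _.
  by rewrite scalerDr !scalerA ![f`_i * _]mulrC.
rewrite E3 E1 E2 !scaler_sumr mulr_sumr -sumrMnl -sumrB -big_split /=.
apply: eq_bigr => i _; have di : (i <= e.+1)%N by rewrite -ltnS.
transitivity (f`_i *: (A ^+ i * B ^+ (e.+1 - i) *+ e.+1 - 'X * (a *: D1 i + c *: D2 i))).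
  move: (A ^+ i * _) (a *: _ + _) => U V.
  by rewrite scalerBr -scalerMnr scalerAr.
by rewrite (d2 _ di) scalerDr !scalerA ![f`_i * _]mulrC.
Qed.

(** For degree e + 1 the resultant of the partial derivatives contributes (a d)^(e^2). The chain
    rule also replaces the two derivatives by linear combinations; this is a block matrix of
    determinant (a d)^e. *)
Lemma binary_disc_bsubst e f : (size f <= e.+1)%N -> GRing.lreg (a * d) ->
  binary_disc e (bsubst e f) = (a * d) ^+ (e * e.-1) * binary_disc e f.
Proof.
case: e => [|e] szf reg; first by rewrite mul0n expr0 mul1r /binary_disc !det_mx00.
rewrite !binary_discE /=; have [-> ->] := deriv_bsubst szf.
set r := f *+ e.+1 - 'X * f^`(); set r' := bsubst e r; set f' := bsubst e f^`().
have szf' : (size f^`() <= e.+1)%N.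
  by rewrite (leq_trans (size_poly _ _)) //; case: (size f) szf.
have szr : (size r <= e.+1)%N.
  apply/leq_sizeP => j; rewrite leq_eqVlt => /orP[/eqP<-|ltj].
    by rewrite coefB coefXM coefMn coef_deriv /= subrr.
  rewrite coefB coefXM coefMn; case: j ltj => // j ltj.
  by rewrite /= coef_deriv !nth_default ?mul0rn ?subrr // (leq_trans szf).
rewrite mulSn exprD -mulrA -res_bsubst // -/r' -/f'.
have -> : res e e (b *: f' + d *: r') (a *: f' + c *: r') =
    \det (block_mx a%:M c%:M b%:M d%:M *m sylvester e e r' f').
  congr (\det _); rewrite mul_block_col !mul_scalar_mx /sylvester.
  by congr col_mx; apply/matrixP=> i j; rewrite /poly_rows !mxE mulrDr
    -!scalerAr coefD !coefZ.
rewrite det_mulmx; congr (_ * _).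
have -> : \det (block_mx (a%:M : 'M_e) c%:M b%:M d%:M) = a ^+ e * d ^+ e.
  by case/orP: triang => /eqP->; rewrite raddf0;
  rewrite ?det_ublock ?det_lblock !det_scalar.
by rewrite exprMn.
Qed.
End Substitution.

(** * Forms in the coordinates of a line *)

Lemma mmap_comp (n : nat) (R S T : comNzRingType) (phi : {rmorphism S -> T})
    (iota : {rmorphism R -> S}) (h : 'I_n -> S) (p : {mpoly R[n]}) :
  phi (mmap iota h p) = mmap (phi \o iota) (phi \o h) p.
Proof.
rewrite /mmap rmorph_sum; apply: eq_bigr => m _; rewrite rmorphM rmorph_prod.
by congr (_ * _); apply: eq_bigr => i _; rewrite rmorphXn.
Qed.

Lemma mmap_map_mpoly (n : nat) (R S T : comNzRingType) (phi : {rmorphism S -> T})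
    (iota : {rmorphism R -> S}) (h : 'I_n -> T) (p : {mpoly R[n]}) :
  mmap phi h (map_mpoly iota p) = mmap (phi \o iota) h p.
Proof.
have -> : map_mpoly iota p = mmap (@mpolyC n S \o iota) (fun i => 'X_i) p.
  by rewrite (rmorph_mpolyE (map_mpoly iota)); apply: eq_bigr => m _ /=;
    rewrite map_mpolyC; congr (_ * _); apply: eq_bigr => i _; rewrite map_mpolyX.
rewrite (mmap_comp (mmap phi h)); apply: eq_bigr => m _ /=.
by rewrite mmapC; congr (_ * _); apply: eq_bigr => i _ /=; rewrite mmapX mmap1U.
Qed.

Section RestrictLine.
Variable R : comNzRingType.
Implicit Types (G : {mpoly R[3]}) (p q : 'I_3 -> R).

Lemma restrict_lineM G H p q :
  restrict_line (G * H) p q = restrict_line G p q * restrict_line H p q.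
Proof. exact: rmorphM. Qed.

Lemma size_restrict_line e G p q : G \is e.-homog ->
  (size (restrict_line G p q) <= e.+1)%N.
Proof.
move=> Gh; rewrite /restrict_line /mmap big_seq (leq_trans (size_sum _ _ _)) //.
apply/bigmax_leqP_seq => m mG _; rewrite mul_polyC (leq_trans (size_scale_leq _ _)) //.
have <- : mdeg m = e := dhomog_mf Gh mG; rewrite /mmap1 mdegE.
elim/big_rec2: _ => [|i s u _ IH]; first by rewrite size_poly1.
rewrite (leq_trans (size_polyMleq _ _)) //; have := size_affine_exp (p i) (q i) (m i).
by move: (size _) (size _) IH => x y; lia.
Qed.

Lemma horner_restrict_line G p q x :
  (restrict_line G p q).[x] = G.@[fun i => p i * x + q i].
Proof.
rewrite /restrict_line -[LHS]/(horner_eval x _) (mmap_comp (horner_eval x)).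
rewrite /meval; congr (mmap _ _ _); apply/funext => y /=; rewrite /horner_eval hornerE //.
by rewrite !hornerE.
Qed.

(** Hence a restriction keeps its full degree exactly when [p] lies off the curve. *)
Lemma coef_restrict_line e G p q : G \is e.-homog ->
  (restrict_line G p q)`_e = G.@[p].
Proof.
move=> Gh; rewrite /restrict_line /mmap coef_sum mevalE big_seq [RHS]big_seq.
apply: eq_bigr => m mG; rewrite coefCM; congr (_ * _).
have <- : mdeg m = e := dhomog_mf Gh mG; rewrite /mmap1 mdegE.
pose P (u : {poly R}) (s : nat) (c : R) := (size u <= s.+1)%N /\ u`_s = c.
suff [] : P (\prod_(i < 3) ((p i)%:P * 'X + (q i)%:P) ^+ m i) (\sum_(i < 3) m i)%N
   (\prod_(i < 3) p i ^+ m i) by [].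
have PM u s c u' s' c' : P u s c -> P u' s' c' -> P (u * u') (s + s')%N (c * c').
  move=> [szu uE] [szu' uE']; split.
    by rewrite (leq_trans (size_polyMleq _ _)) //; move: (size u) (size u') szu szu'; lia.
  rewrite coefM (bigD1 (Ordinal (leq_addr s' s : s < (s + s').+1)%N)) //= addKn uE uE'.
  rewrite big1 ?addr0 // => l; rewrite -val_eqE /= neq_ltn => /orP[lt_ls|lt_sl].
    by rewrite [u'`_ _]nth_default ?mulr0 // (leq_trans szu') //; lia.
  by rewrite nth_default ?mul0r // (leq_trans szu).
elim/big_rec3: _ => [|i c s u _ IH]; first by split; rewrite ?size_poly1 ?coef1.
apply: (PM _ _ _ _ _ _ _ IH); elim: (m i) => [|j IHj]; first by split; rewrite ?expr0 ?size_poly1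
  ?coef1.
rewrite !exprS -add1n; apply: (PM _ _ _ _ _ _ _ IHj); split; first exact: (size_affine_exp _ _ 1).
by rewrite coefD coefMX coefC /= coefC addr0.
Qed.

Lemma restrict_line_bsubst e G p q a b c d : G \is e.-homog ->
  restrict_line G (fun i => a * p i + c * q i) (fun i => b * p i + d * q i) =
  bsubst a b c d e (restrict_line G p q).
Proof.
move=> Gh; rewrite /restrict_line /mmap linear_sum big_seq [RHS]big_seq.
apply: eq_bigr => m mG /=; rewrite !mul_polyC linearZ /=; congr (_ *: _).
have <- : mdeg m = e := dhomog_mf Gh mG; rewrite /mmap1 mdegE bsubst_prod; apply: eq_bigr => i _.
congr (_ ^+ _); rewrite !rmorphD !rmorphM /=.
by move: (p i)%:P (q i)%:P a%:P b%:P c%:P d%:P 'X => *; ring.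
Qed.

Lemma map_restrict_line (S : comNzRingType) (phi : {rmorphism R -> S}) G p q :
  map_poly phi (restrict_line G p q) =
  restrict_line (map_mpoly phi G) (phi \o p) (phi \o q).
Proof.
rewrite /restrict_line (mmap_comp (map_poly phi)) (mmap_map_mpoly polyC).
congr (mmap _ _ _); apply/funext => x /=; first by rewrite map_polyC.
by rewrite rmorphD rmorphM /= !map_polyC map_polyX.
Qed.

End RestrictLine.

(** * Linear forms, homogeneity and homogeneous factors *)

Lemma msize2_irreducible (K : fieldType) n (p : {mpoly K[n]}) : msize p = 2%N -> irreducible_elt p.
Proof.
move=> szp; have p0 : p != 0 by rewrite -msize_poly_eq0 szp.
have unit1 (a : {mpoly K[n]}) : a != 0 -> (msize a <= 1)%N -> a \is a GRing.unit.
  move=> a0 /msize1_polyC aE; rewrite aE; apply: rmorph_unit.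
  by rewrite unitfE -(mpolyC_eq0 n) -aE.
have a0b0 (a b : {mpoly K[n]}) : p = a * b -> (a != 0) /\ (b != 0).
  by move=> pE; move: p0; rewrite pE mulf_eq0 negb_or => /andP.
split=> // [|a b pE]; last first.
  move: a b pE; suff aux (a b : {mpoly K[n]}) : p = a * b ->
      (a \is a GRing.unit) || (b \is a GRing.unit) by exact: aux.
  move=> pE; have [a0 b0] := a0b0 a b pE; move: szp; rewrite pE msizeM // => sz.
  have := mpolySpred mdeg a0; have := mpolySpred mdeg b0 => sza szb.
  move: (unit1 a a0) (unit1 b b0) sz sza szb.
  move: (msize a) (msize b) => x y ua ub sz sza szb; apply/orP.
  by have [h|h] := leqP x 1; [left; apply: ua|right; apply: ub]; lia.
apply/negP => /unitrPr[q pq]; have : (msize (p * q) = 1)%N by rewrite pq msize1.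
have q0 : q != 0 by apply: contraTneq isT => q0; move/eqP: pq; rewrite q0 mulr0 eq_sym oner_eq0.
rewrite msizeM // szp; have := mpolySpred mdeg q0; lia.
Qed.

Lemma mpolyX_prime (K : fieldType) n (i : 'I_n) : prime_elt ('X_i : {mpoly K[n]}).
Proof. by apply/irreducible_prime/msize2_irreducible; rewrite msizeX mdeg1. Qed.

Lemma prime_exp_divides (R : idomainType) (p a b : R) i j : prime_elt p -> ~ divides p a ->
  divides (p ^+ i) (a ^+ j * b) -> divides (p ^+ i) b.
Proof.
move=> pp pa; elim: i b => [|i IHi] b; first by exists b; rewrite mulr1.
move=> pab; have p0 : p != 0 by case: pp.
have : divides p (a ^+ j * b).
  by apply: divides_trans pab; rewrite exprS; apply/divides_mulr/divides_refl.
case: (pp) => _ _ pM /pM[/(prime_divides_exp pp)//|[b' bE]].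
have /IHi[c b'E] : divides (p ^+ i) (a ^+ j * b').
  case: pab => c cE; exists c; apply: (mulIf p0).
  by rewrite -!mulrA -exprSr -bE.
by exists c; rewrite bE b'E exprSr mulrA.
Qed.

Section HomogScale.
Variables (n : nat) (R : comNzRingType).
Implicit Types p : {mpoly R[n]}.

(** The scaling x |-> T x by a new variable T. Homogeneity of degree d becomes the equation p(T x) =
    p(x) T^d, which is compatible with products. *)
Definition mscale : {rmorphism {mpoly R[n]} -> {poly {mpoly R[n]}}} :=
  mmap (polyC \o @mpolyC n R) (fun i => ('X_i)%:P * 'X).

Lemma mscale_monomial (m : 'X_{1..n}) :
  mmap1 (fun i => ('X_i)%:P * 'X : {poly {mpoly R[n]}}) m = 'X_[m]%:P * 'X^(mdeg m).
Proof.
rewrite /mmap1 (eq_bigr (fun i => ('X_i ^+ m i)%:P * 'X^(m i))); last first.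
  by move=> i _; rewrite exprMn rmorphXn.
rewrite big_split /= -rmorph_prod -mpolyXE_id; congr (_ * _).
by rewrite mdegE expr_sum.
Qed.

Lemma homog_scaleP d p : reflect (mscale p = p%:P * 'X^d) (p \is d.-homog).
Proof.
have scaleE : mscale p = \sum_(m <- msupp p) (p@_m *: 'X_[m])%:P * 'X^(mdeg m).
  by rewrite /mscale /=; apply: eq_bigr => m _;
    rewrite mscale_monomial mulrA -polyCM mul_mpolyC.
apply: (iffP idP) => [ph|].
  rewrite scaleE {3}[p]mpolyE rmorph_sum mulr_suml big_seq [RHS]big_seq.
  by apply: eq_bigr => m /(dhomog_mf ph) <-.
rewrite scaleE => pE; apply/dhomogP => m mp; apply/eqP; apply: contraT => md.
have := congr1 (fun r : {poly {mpoly R[n]}} => (r`_(mdeg m))@_m) pE.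
have md' : (mdeg m == d) = false by apply/negbTE.
rewrite coefCM coefXn md' mulr0 mcoeff0 coef_sum raddf_sum /=.
rewrite (bigD1_seq m) ?msupp_uniq //= coefCM coefXn eqxx mulr1 mcoeffZ mcoeffX eqxx mulr1.
rewrite big1 ?addr0 => [/eqP|m' m'm]; first by rewrite mcoeff_eq0 mp.
rewrite coefCM coefXn; case: eqP => _; last by rewrite mulr0 mcoeff0.
by rewrite mulr1 mcoeffZ mcoeffX (negPf m'm) mulr0.
Qed.
End HomogScale.

(** In a polynomial ring in T over a domain the factors of a monomial are monomials. This applies to
    p(T x), and T = 1 identifies its coefficient with [p]. *)
Lemma homog_factor n (R : idomainType) d (p q : {mpoly R[n]}) :
  p * q \is d.-homog -> p * q != 0 -> p \is homog mdeg.
Proof.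
move=> /homog_scaleP pqE pq0.
have monom (S : idomainType) e (u v : {poly S}) (x : S) : u * v = x%:P * 'X^e -> x != 0 ->
    exists i y, u = y%:P * 'X^i.
  elim: e u v => [|e IHe] u v uvE x0.
    exists 0%N, u`_0; rewrite mulr1; apply: size1_polyC.
    have uv0 : u * v != 0 by rewrite uvE mulr1 polyC_eq0.
    have := congr1 (fun h : {poly S} => size h) uvE; rewrite mulr1 size_polyC x0.
    move: uv0; rewrite mulf_eq0 negb_or => /andP[u0 v0]; rewrite size_mul //.
    by move: u0 v0; rewrite -!size_poly_gt0; move: (size u) (size v) => i j; lia.
  have : (u * v).[0] == 0 by rewrite uvE !hornerE exprS mul0r mulr0.
  rewrite hornerM mulf_eq0 => /orP[] /factor_theorem[w]; rewrite subr0 => wE.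
    have [|i [y wE']] := IHe w v _ x0.
      apply: (@mulIf _ 'X); first by rewrite polyX_eq0.
      by rewrite mulrAC -wE uvE exprSr mulrA.
    by exists i.+1, y; rewrite wE wE' exprSr mulrA.
  apply: (IHe u w) x0; apply: (@mulIf _ 'X); first by rewrite polyX_eq0.
  by rewrite -mulrA -wE uvE exprSr mulrA.
have [i [y pE]] : exists i y, mscale n R p = y%:P * 'X^i.
  by apply: (monom _ d _ (mscale n R q) (p * q)) => //; rewrite -rmorphM.
apply/homogP; exists i; apply/homog_scaleP; rewrite pE; congr (_%:P * _).
have mscale1 : (mscale n R p).[1] = p.
  apply: (eq_rmorph_mpoly (phi := horner_eval 1 \o mscale n R) (psi := idfun)) => [c|j] /=.
    by rewrite mmapC /horner_eval hornerC.
  by rewrite mmapX mmap1U /horner_eval !hornerE.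
by rewrite -[RHS]mscale1 pE hornerM hornerC hornerXn expr1n mulr1.
Qed.

(** * Functions of two points that are forms in the line through them *)

Section LineForm.
Variables (K : fieldType) (e : nat).
Variable T : forall R : comNzRingType, (K -> R) -> ('I_3 -> R) -> ('I_3 -> R) -> R.
Hypothesis T_natural : forall (R S : comNzRingType) (phi : {rmorphism R -> S})
    (iota : {rmorphism K -> R}) p q,
  phi (T iota p q) = T (phi \o iota) (phi \o p) (phi \o q).
Hypothesis T_covariant : forall (R : comNzRingType) (iota : {rmorphism K -> R}) p q
    (a b c d : R), (b == 0) || (c == 0) -> GRing.lreg (a * d) ->
  T iota (fun i => a * p i + c * q i) (fun i => b * p i + d * q i) =
    (a * d) ^+ e * T iota p q.

(** The line (u, v, w) passes through (w, 0, -u) and (0, w, -v), whose join is w (u, v, w). A form D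
    of degree e must therefore give w^e D at this pair, and D is found by division. Triangular
    changes of the pair, the only ones that the covariance covers, suffice to reach every other
    pair. *)
Lemma line_form_exists : exists2 D : {mpoly K[3]}, D \is e.-homog &
  forall (R : comNzRingType) (iota : {rmorphism K -> R}) p q,
    mmap iota (join_line p q) D = T iota p q.
Proof.
pose pt (R : comNzRingType) (x y z : R) : 'I_3 -> R := fun i => [tuple x; y; z]`_i.
pose p0 (R : comNzRingType) (u v w : R) := pt R w 0 (- u).
pose q0 (R : comNzRingType) (u v w : R) := pt R 0 w (- v).
have ptE (R S : comNzRingType) (phi : {rmorphism R -> S}) x y z :
    phi \o pt R x y z = pt S (phi x) (phi y) (phi z).
  by apply/funext => -[[|[|[|i]]] ?].
have cov (R : comNzRingType) (iota : {rmorphism K -> R}) p q p' q' a b c d :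
    (b == 0) || (c == 0) -> GRing.lreg (a * d) ->
    (forall i, p' i = a * p i + c * q i) -> (forall i, q' i = b * p i + d * q i) ->
    T iota p' q' = (a * d) ^+ e * T iota p q.
  by move=> bc ad p'E q'E; rewrite -(T_covariant iota p q bc ad); congr T; apply/funext.
pose C : {rmorphism K -> {mpoly K[3]}} := @mpolyC 3 K.
pose u : {mpoly K[3]} := 'X_(@Ordinal 3 0 isT).
pose v : {mpoly K[3]} := 'X_(@Ordinal 3 1 isT).
pose w : {mpoly K[3]} := 'X_(@Ordinal 3 2 isT).
have u0 : u != 0 by case: (mpolyX_prime K (@Ordinal 3 0 isT)).
have w0 : w != 0 by case: (mpolyX_prime K (@Ordinal 3 2 isT)).
pose N0 := T C (p0 _ u v w) (q0 _ u v w).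
have [D N0E] : divides (w ^+ e) N0.
  apply: (@prime_exp_divides _ w u N0 e e); first exact: mpolyX_prime.
    case=> h /(congr1 (meval (fun i : 'I_3 => (i == 0 :> nat)%:R))).
    by rewrite mevalM !mevalXU /= mulr0 => /eqP; rewrite oner_eq0.
  (* After multiplication by u^e the pair can be expressed through the points (-w, 0, u) and (-v, u,
     0) of the same line, with determinant -w. As u and w are distinct primes, w^e divides [N0]. *)
  have <- : T C (p0 _ u v w) (fun i => u * q0 _ u v w i) = u ^+ e * N0.
    rewrite (cov _ C (p0 _ u v w) (q0 _ u v w) _ _ 1 0 0 u) ?eqxx ?mul1r //; first exact/lregP.
      by move=> i; rewrite mul1r mul0r addr0.
    by move=> i; rewrite mul0r add0r.
  rewrite (cov _ C (pt _ (- w) 0 u) (pt _ (- v) u 0) _ _ (-1) (- v) 0 w) ?eqxx ?orbT //.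
  - by rewrite mulN1r exprNn mulrAC; apply/divides_mull/divides_refl.
  - by rewrite mulN1r; apply/lregP; rewrite oppr_eq0.
  - by move=> [[|[|[|i]]] ?] //=; rewrite /p0 /pt /=; ring.
  by move=> [[|[|[|i]]] ?] //=; rewrite /q0 /pt /=; ring.
have pt3 : pt _ u v w = (fun i => 'X_i).
  by apply/funext => -[[|[|[|i]]] ?] //=; congr 'X__; apply: val_inj.
have evN0 (R : comNzRingType) (iota : {rmorphism K -> R}) (x y z : R) :
    mmap iota (pt R x y z) N0 = T iota (p0 _ x y z) (q0 _ x y z).
  rewrite /N0 (T_natural (mmap iota (pt R x y z))) !ptE.
  rewrite !rmorphN !rmorph0 /= !mmapX !mmap1U; congr T.
  by apply/funext => c /=; rewrite mmapC.
have D_scale : mmap (polyC \o C) (fun i => ('X_i)%:P * 'X) D = D%:P * 'X^e.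
  pose i1 : {rmorphism K -> {poly {mpoly K[3]}}} := polyC \o C.
  pose h : 'I_3 -> {poly {mpoly K[3]}} := pt _ (u%:P * 'X) (v%:P * 'X) (w%:P * 'X).
  have hE : h = (fun i => ('X_i)%:P * 'X).
    rewrite (_ : (fun i => _) = (fun i => (pt _ u v w i)%:P * 'X)) ?pt3 //.
    by apply/funext => -[[|[|[|i]]] ?].
  have wX0 : w%:P * 'X != 0 :> {poly {mpoly K[3]}}.
    by rewrite mulf_neq0 ?polyC_eq0 ?polyX_eq0.
  apply: (mulIf (expf_neq0 e wX0)); rewrite -hE.
  have -> : mmap (polyC \o C) h D * (w%:P * 'X) ^+ e = mmap i1 h N0.
    rewrite N0E rmorphM rmorphXn /= mmapX mmap1U.
    by congr (_ * _ ^+ _); rewrite /h /pt.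
  rewrite evN0 (cov _ i1 (p0 _ u%:P v%:P w%:P) (q0 _ u%:P v%:P w%:P) _ _ 'X 0 0 'X) ?eqxx //.
  - have -> : T i1 (p0 _ u%:P v%:P w%:P) (q0 _ u%:P v%:P w%:P) = N0%:P.
      rewrite /N0 (T_natural polyC) !ptE !rmorphN !rmorph0; by congr T.
    by rewrite N0E rmorphM rmorphXn /= !exprMn mulrACA [_ * D%:P]mulrC [_ * w%:P ^+ e]mulrC.
  - by apply/lregP; rewrite mulf_neq0 ?polyX_eq0.
  - by move=> [[|[|[|i]]] ?] //=; rewrite /p0 /pt /= ?polyCN ?polyC0; ring.
  by move=> [[|[|[|i]]] ?] //=; rewrite /q0 /pt /= ?polyCN ?polyC0; ring.
exists D; first exact/homog_scaleP.
move=> R iota p q.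
pose C6 : {rmorphism K -> {mpoly K[3 + 3]}} := @mpolyC (3 + 3) K.
pose P : 'I_3 -> {mpoly K[3 + 3]} := fun i => 'X_(lshift 3 i).
pose Q : 'I_3 -> {mpoly K[3 + 3]} := fun i => 'X_(rshift 3 i).
pose h (i : 'I_(3 + 3)) : R := match split i with inl j => p j | inr j => q j end.
have hP : mmap iota h \o P = p.
  by apply/funext => i; rewrite /= /P mmapX mmap1U /h (unsplitK (inl i)).
have hQ : mmap iota h \o Q = q.
  by apply/funext => i; rewrite /= /Q mmapX mmap1U /h (unsplitK (inr i)).
have hC : mmap iota h \o C6 = iota by apply/funext => c /=; rewrite mmapC.
(* Two points with six independent coordinates specialize to any pair over any ring; over their
   polynomial ring, a domain, W and P0 can be cancelled. *)
suff gen : mmap C6 (join_line P Q) D = T C6 P Q.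
  have := congr1 (mmap iota h) gen.
  rewrite (T_natural (mmap iota h)) (mmap_comp (mmap iota h)) hP hQ hC => <-.
  congr (mmap _ _ _); apply/funext => i /=; rewrite /join_line rmorphB !rmorphM.
  by rewrite -hP -hQ.
set U := join_line P Q 0; set V := join_line P Q 1; set W := join_line P Q 2%:R.
have joinE : join_line P Q = pt _ U V W.
  by apply/funext => -[[|[|[|i]]] ?] //=; rewrite /U /V /W /pt /=; congr join_line; apply: val_inj.
pose P0 := P 0; pose P1 := P 1; pose P2 := P 2%:R.
pose Q0 := Q 0; pose Q1 := Q 1; pose Q2 := Q 2%:R.
have PE : P = pt _ P0 P1 P2.
  by apply/funext => -[[|[|[|i]]] ?] //=; rewrite /pt /=; congr 'X__; apply: val_inj.
have QE : Q = pt _ Q0 Q1 Q2.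
  by apply/funext => -[[|[|[|i]]] ?] //=; rewrite /pt /=; congr 'X__; apply: val_inj.
have UE : U = P1 * Q2 - P2 * Q1.
  by rewrite /U /join_line; congr (_ * _ - _ * _); congr 'X__; apply: val_inj.
have VE : V = P2 * Q0 - P0 * Q2.
  by rewrite /V /join_line; congr (_ * _ - _ * _); congr 'X__; apply: val_inj.
have WE : W = P0 * Q1 - P1 * Q0.
  by rewrite /W /join_line; congr (_ * _ - _ * _); congr 'X__; apply: val_inj.
have P0nz : P0 != 0 by case: (mpolyX_prime K (lshift 3 (0 : 'I_3))).
have W0 : W != 0.
  apply: contraTneq isT => /(congr1 (meval (fun i : 'I_(3 + 3) =>
     ((i == 0 :> nat) || (i == 4 :> nat))%:R : K))).
  rewrite WE mevalB !mevalM !mevalXU /= mulr1 mul0r subr0 meval0 => /eqP.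
  by rewrite oner_eq0.
apply: (mulfI (expf_neq0 e P0nz)); apply: (mulfI (expf_neq0 e W0)).
(* With p0 and q0 the standard points for (U, V, W), one has W P = P0 p0 + P1 q0 and P0 Q = Q0 P +
   q0. These triangular changes lead from the standard pair to (P, Q). *)
have e1 : T C6 (fun i => W * P i) (q0 _ U V W) = P0 ^+ e * (W ^+ e * mmap C6 (pt _ U V W) D).
  rewrite (cov _ C6 (p0 _ U V W) (q0 _ U V W) _ _ P0 0 P1 1) ?eqxx ?mulr1 //; first last.
  - by move=> i; rewrite mul0r mul1r add0r.
  - by move=> [[|[|[|i]]] ?] //=; rewrite PE /p0 /q0 /pt /= ?UE ?VE ?WE;
      generalize P0 P1 P2 Q0 Q1 Q2 => *; ring.
  - exact/lregP.
  by rewrite -evN0 N0E rmorphM rmorphXn /= mmapX mmap1U [_ * _ ^+ e]mulrC.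
have e2 : T C6 (fun i => W * P i) (q0 _ U V W) = W ^+ e * T C6 P (q0 _ U V W).
  rewrite (cov _ C6 P (q0 _ U V W) _ _ W 0 0 1) ?eqxx ?mulr1 //; first exact/lregP.
  - by move=> i; rewrite mul0r addr0.
  by move=> i; rewrite mul0r mul1r add0r.
have e3 : T C6 P (fun i => P0 * Q i) = T C6 P (q0 _ U V W).
  rewrite (cov _ C6 P (q0 _ U V W) _ _ 1 Q0 0 1) ?eqxx ?orbT ?mulr1 ?expr1n ?mul1r //.
  - exact: lreg1.
  - by move=> i; rewrite mul0r mul1r addr0.
  by move=> [[|[|[|i]]] ?] //=; rewrite QE PE /q0 /pt /= ?UE ?VE ?WE;
    generalize P0 P1 P2 Q0 Q1 Q2 => *; ring.
have e4 : T C6 P (fun i => P0 * Q i) = P0 ^+ e * T C6 P Q.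
  rewrite (cov _ C6 P Q _ _ 1 0 0 P0) ?eqxx ?mul1r //; first exact/lregP.
  - by move=> i; rewrite mul0r mul1r addr0.
  by move=> i; rewrite mul0r add0r.
by rewrite -e4 e3 -e2 e1 joinE mulrCA.
Qed.
End LineForm.

Lemma map_mpoly_trans (n : nat) (R S T : comNzRingType) (phi : {rmorphism S -> T})
    (iota : {rmorphism R -> S}) (p : {mpoly R[n]}) :
  map_mpoly phi (map_mpoly iota p) = map_mpoly (phi \o iota) p.
Proof.
by apply/mpolyP=> m; rewrite mcoeff_map_mpoly mcoeff_map_mpoly
  -[in RHS]/(phi \o iota : {rmorphism R -> T}) mcoeff_map_mpoly.
Qed.

Lemma map_mpoly_homog (n : nat) (R S : comNzRingType) (iota : {rmorphism R -> S}) d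
    (p : {mpoly R[n]}) : p \is d.-homog -> map_mpoly iota p \is d.-homog.
Proof.
move=> ph; apply/dhomogP => m; rewrite mcoeff_msupp mcoeff_map_mpoly => mp.
apply: (dhomog_mf ph); rewrite mcoeff_msupp.
by apply: contraNneq mp => ->; apply/eqP/(rmorph0 iota).
Qed.

Lemma homog_msize_pred n (R : nzRingType) d (p : {mpoly R[n]}) : p \is d.-homog -> p != 0 ->
  (msize p).-1 = d.
Proof. by move=> ph p0; apply: (dhomog_uniq p0 (dhomog_msize ph) ph). Qed.

Lemma eq_rmorph_poly (R S : comNzRingType) (phi psi : {rmorphism {poly R} -> S}) :
  (forall c, phi c%:P = psi c%:P) -> phi 'X = psi 'X -> phi =1 psi.
Proof.
move=> eqC eqX; elim/poly_ind => [|h c IHh]; first by rewrite (rmorph0 phi) (rmorph0 psi).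
by rewrite (rmorphD phi) (rmorphD psi) (rmorphM phi) (rmorphM psi) IHh eqX eqC.
Qed.

Lemma rmorph_poly_cancel (R : comNzRingType) (phi psi : {rmorphism {poly R} -> {poly R}}) :
  (forall c, psi (phi c%:P) = c%:P) -> psi (phi 'X) = 'X -> cancel phi psi.
Proof.
by move=> eqC eqX; apply: (@eq_rmorph_poly _ _ (psi \o phi) idfun).
Qed.

Lemma eq_rmorph_mpoly_comp (n : nat) (R S T : comNzRingType)
    (phi : {rmorphism {mpoly R[n]} -> S}) (psi : {rmorphism S -> T})
    (chi : {rmorphism {mpoly R[n]} -> T}) :
  (forall c, psi (phi c%:MP) = chi c%:MP) -> (forall i, psi (phi 'X_i) = chi 'X_i) ->
  forall p, psi (phi p) = chi p.
Proof. by move=> eqC eqX p; rewrite -(@eq_rmorph_mpoly _ _ _ (psi \o phi) chi). Qed.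

Lemma rmorph_affine (R S : comNzRingType) (phi : {rmorphism {poly R} -> S}) a b :
  phi (a%:P * 'X + b%:P) = phi a%:P * phi 'X + phi b%:P.
Proof. by rewrite rmorphD rmorphM. Qed.

Lemma map_resE (R S : comNzRingType) (phi : {rmorphism R -> S}) d1 d2 (p q : {poly R})
    (p' q' : {poly S}) : map_poly phi p = p' -> map_poly phi q = q' ->
  phi (res d1 d2 p q) = res d1 d2 p' q'.
Proof. by move=> <- <-; apply: map_res. Qed.

Lemma res_common_root (R : comNzRingType) d1 d2 (p q : {poly R}) x : (0 < d1 + d2)%N ->
  (size p <= d1.+1)%N -> (size q <= d2.+1)%N -> p.[x] = 0 -> q.[x] = 0 -> res d1 d2 p q = 0.
Proof.
move=> d_gt0 szp szq px qx; have [u [v [_ _ E]]] := res_ideal d_gt0 szp szq.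
by have := congr1 (horner^~ x) E; rewrite hornerC hornerD !hornerM px qx !mulr0 addr0.
Qed.

Section LineForms.
Variable K : fieldType.
Implicit Types f g : {mpoly K[3]}.

(** Values over all K-algebras are prescribed, because the local computation evaluates the form at a
    line over K[X]. *)
Definition is_line_res d1 d2 f g (D : {mpoly K[3]}) : Prop :=
  D \is (d1 * d2).-homog /\
  forall (R : comNzRingType) (iota : {rmorphism K -> R}) (p q : 'I_3 -> R),
    mmap iota (join_line p q) D =
    res d1 d2 (restrict_line (map_mpoly iota f) p q) (restrict_line (map_mpoly iota g) p q).

Lemma line_res_exists d1 d2 f g : f \is d1.-homog -> g \is d2.-homog ->
  exists D, is_line_res d1 d2 f g D.
Proof.
move=> fh gh.
have [|R iota p q a b c d bc ad|D Dh DE] := @line_form_exists K (d1 * d2)%N (fun R iota p q =>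
    res d1 d2 (restrict_line (map_mpoly iota f) p q) (restrict_line (map_mpoly iota g) p q)).
- move=> R S phi iota p q; rewrite map_res !map_restrict_line.
  by rewrite !map_mpoly_trans.
- have fh' := map_mpoly_homog iota fh; have gh' := map_mpoly_homog iota gh.
  rewrite (restrict_line_bsubst _ _ _ _ _ _ fh') (restrict_line_bsubst _ _ _ _ _ _ gh').
  by rewrite (res_bsubst bc) ?size_restrict_line.
by exists D; split=> // R iota p q; rewrite DE.
Qed.

Lemma line_disc_exists d f : f \is d.-homog -> exists2 D : {mpoly K[3]},
  D \is (d * d.-1).-homog &
  forall (R : comNzRingType) (iota : {rmorphism K -> R}) (p q : 'I_3 -> R),
    mmap iota (join_line p q) D = binary_disc d (restrict_line (map_mpoly iota f) p q).
Proof.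
move=> fh.
have [|R iota p q a b c e bc ad|D Dh DE] := @line_form_exists K (d * d.-1)%N
    (fun R iota p q => binary_disc d (restrict_line (map_mpoly iota f) p q)).
- by move=> R S phi iota p q; rewrite map_binary_disc map_restrict_line map_mpoly_trans.
- have fh' := map_mpoly_homog iota fh.
  by rewrite (restrict_line_bsubst _ _ _ _ _ _ fh') (binary_disc_bsubst bc) ?size_restrict_line.
by exists D => // R iota p q; rewrite DE.
Qed.

Lemma map_mpoly_id n (p : {mpoly K[n]}) : map_mpoly idfun p = p.
Proof. by apply/mpolyP=> m; rewrite mcoeff_map_mpoly. Qed.

Lemma dual_formP f : f \is homog mdeg -> is_line_disc f (dual_form f).
Proof.
rewrite homog_msize => /line_disc_exists[D Dh DE].
rewrite /dual_form; case: xgetP => [D' -> //|/(_ D)[]]; split=> // p q.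
by rewrite /meval (DE _ idfun) map_mpoly_id.
Qed.

(* The equation of the sum of the lines dual to the points of Z(f) . Z(g). *)
Definition line_res f g : {mpoly K[3]} :=
  xget 0 [set D | is_line_res (msize f).-1 (msize g).-1 f g D]%classic.

Lemma line_resP d1 d2 f g : f \is d1.-homog -> g \is d2.-homog -> f != 0 -> g != 0 ->
  is_line_res d1 d2 f g (line_res f g).
Proof.
move=> fh gh f0 g0; have [D DE] := line_res_exists fh gh.
rewrite /line_res (homog_msize_pred fh f0) (homog_msize_pred gh g0).
by case: xgetP => [D' -> //|/(_ D)[]].
Qed.

Lemma line_res_eval d1 d2 f g p q : f \is d1.-homog -> g \is d2.-homog -> f != 0 -> g != 0 ->
  (line_res f g).@[join_line p q] = res d1 d2 (restrict_line f p q) (restrict_line g p q).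
Proof.
move=> fh gh f0 g0; have [_ /(_ _ idfun p q)] := line_resP fh gh f0 g0.
by rewrite !map_mpoly_id.
Qed.

(** * Resultants and discriminants on a general line *)

Section Shift.
Variable q : 'I_3 -> K.
Local Notation R := {mpoly K[3]}.

(** The restriction to the line that joins [q] to the generic point x, that is T |-> f(x + T q). *)
Definition shift_mpoly : {rmorphism R -> {poly R}} :=
  mmap (polyC \o @mpolyC 3 K) (fun i => (q i)%:MP%:P * 'X + ('X_i)%:P).

Lemma shift_poly_exists : exists phi : {rmorphism {poly R} -> {poly R}},
  (forall c, phi c%:P = shift_mpoly c) /\ phi 'X = 'X.
Proof.
exists (horner_eval 'X \o map_poly shift_mpoly); split=> [c|] /=.
  by rewrite map_polyC /horner_eval hornerC.
by rewrite map_polyX /horner_eval hornerX.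
Qed.

Lemma shift_mpolyC c : shift_mpoly c%:MP = c%:MP%:P.
Proof. by rewrite /shift_mpoly /= mmapC. Qed.

Lemma shift_mpolyX i : shift_mpoly 'X_i = (q i)%:MP%:P * 'X + ('X_i)%:P.
Proof. by rewrite /shift_mpoly /= mmapX mmap1U. Qed.

Lemma shift_mpolyE f :
  shift_mpoly f = restrict_line (map_mpoly (@mpolyC 3 K) f) (fun i => (q i)%:MP) (fun i => 'X_i).
Proof. by rewrite /restrict_line mmap_map_mpoly. Qed.

Lemma shift_mpoly_at0 f : (shift_mpoly f).[0] = f.
Proof.
rewrite -[LHS]/((horner_eval 0 \o shift_mpoly) f) -[RHS]/(idfun f).
apply: eq_rmorph_mpoly => [c|i] /=; rewrite /horner_eval.
  by rewrite shift_mpolyC hornerC.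
by rewrite shift_mpolyX !hornerE.
Qed.
End Shift.

Lemma shift_polyK q (phi psi : {rmorphism {poly {mpoly K[3]}} -> {poly {mpoly K[3]}}}) :
  (forall c, phi c%:P = shift_mpoly q c) -> phi 'X = 'X ->
  (forall c, psi c%:P = shift_mpoly (fun i => - q i) c) -> psi 'X = 'X ->
  cancel phi psi.
Proof.
move=> phiC phiX psiC psiX; apply: rmorph_poly_cancel => [c|]; last by rewrite phiX psiX.
rewrite phiC.
apply: (eq_rmorph_mpoly_comp (phi := shift_mpoly q) (chi := polyC)) => [x|i].
  by rewrite shift_mpolyC psiC shift_mpolyC.
rewrite shift_mpolyX (rmorph_affine psi) !psiC psiX shift_mpolyC shift_mpolyX.
by rewrite mpolyCN polyCN mulNr addrA subrr add0r.
Qed.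

(** The shift extends to an automorphism of K[x][T] that fixes T, with the shift by - q as inverse,
    and a prime of K[x] stays prime in K[x][T]. *)
Lemma shift_mpoly_prime q f : prime_elt f -> prime_elt (shift_mpoly q f).
Proof.
move=> fp; have [phi [phiC phiX]] := shift_poly_exists q.
have [psi [psiC psiX]] := shift_poly_exists (fun i => - q i).
rewrite -phiC; apply: (prime_elt_iso (psi := psi) _ _ (prime_elt_polyC fp)).
  exact: (shift_polyK phiC phiX psiC psiX).
apply: (shift_polyK psiC psiX _ phiX) => c; rewrite phiC.
by congr (shift_mpoly _ c); apply/funext => i; rewrite opprK.
Qed.

Lemma size_shift_mpoly q d f : f \is d.-homog -> f.@[q] != 0 ->
  size (shift_mpoly q f) = d.+1.
Proof.
move=> fh fq; have fh' := map_mpoly_homog (@mpolyC 3 K) fh; rewrite shift_mpolyE.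
apply/eqP; rewrite eqn_leq size_restrict_line //=.
rewrite ltnNge; apply: contraNN fq => /leq_sizeP/(_ d (leqnn d)).
rewrite coef_restrict_line // /meval mmap_map_mpoly => fq.
rewrite -(mpolyC_eq0 3) -fq -[X in X == _]/(mpolyC 3 (mmap idfun q f)) (mmap_comp (@mpolyC 3 K)).
by apply/eqP.
Qed.

(** A kernel vector of the Sylvester matrix is a relation v g = - u f between the shifted forms,
    with [v] of smaller degree than [f]. The shifted [f] is prime and too large to divide [v], so it
    divides the shifted [g]; T = 0 gives back f and g. *)
Lemma res_shift_neq0 q d1 d2 f g : f \is d1.-homog -> g \is d2.-homog ->
  prime_elt f -> f.@[q] != 0 -> ~ divides f g ->
  res d1 d2 (shift_mpoly q f) (shift_mpoly q g) != 0.
Proof.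
move=> fh gh fp fq nfg; have f0 : f != 0 by case: fp.
have szf := size_shift_mpoly fh fq.
have szg : (size (shift_mpoly q g) <= d2.+1)%N.
  by rewrite shift_mpolyE size_restrict_line // map_mpoly_homog.
apply/negP => /det0P[z z0 zS].
have := mul_sylvester z (eq_leq szf) szg; rewrite {}zS (raddf0 (@rVpoly _ _)).
set v := rVpoly (lsubmx z); set u := rVpoly (rsubmx z) => /esym/eqP.
rewrite addr_eq0 => /eqP vg.
have fp' := shift_mpoly_prime q fp; have [f'0 _ f'M] := fp'.
have v0 : v != 0.
  apply: contraNneq z0 => v0; rewrite -[z]hsubmxK.
  move/eqP: vg; rewrite v0 mul0r eq_sym oppr_eq0 mulf_eq0 (negPf f'0) orbF => /eqP u0.
  rewrite -[lsubmx z]rVpolyK -[rsubmx z]rVpolyK -/u -/v u0 v0 !linear0.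
  by rewrite row_mx0.
have /f'M[[w wE]|[w wE]] : divides (shift_mpoly q f) (v * shift_mpoly q g).
- by exists (- u); rewrite vg mulNr.
- have : (size v <= d1)%N by apply: size_poly.
  have w0 : w != 0 by apply: contraNneq v0 => w0; rewrite wE w0 mul0r.
  rewrite wE size_mul // szf; have : (0 < size w)%N by rewrite size_poly_gt0.
  by move: (size w) => x; lia.
apply: nfg; exists w.[0].
by rewrite -(shift_mpoly_at0 q g) wE hornerM shift_mpoly_at0.
Qed.

Lemma exists_line_res_neq0 d1 d2 f g : infinite_ring K ->
  f \is d1.-homog -> g \is d2.-homog -> prime_elt f -> ~ divides f g ->
  exists p q, f.@[p] != 0 /\ res d1 d2 (restrict_line f p q) (restrict_line g p q) != 0.
Proof.
move=> Kinf fh gh fp nfg; have f0 : f != 0 by case: fp.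
have [q fq] := mpoly_neq0_point Kinf f0.
have [x rx] := mpoly_neq0_point Kinf (res_shift_neq0 fh gh fp fq nfg).
exists q, x; split=> //.
have mapE h : map_poly (meval x) (shift_mpoly q h) = restrict_line h q x.
  rewrite shift_mpolyE map_restrict_line map_mpoly_trans.
  rewrite (_ : meval x \o _ = idfun) ?map_mpoly_id; last first.
    by apply/funext => c /=; rewrite mevalC.
  by congr restrict_line; apply/funext => i /=; rewrite ?mevalC ?mevalXU.
by have := map_resE (phi := meval x) d1 d2 (mapE f) (mapE g) => <-.
Qed.

Lemma line_res_neq0 d1 d2 f g : infinite_ring K -> f \is d1.-homog -> g \is d2.-homog ->
  prime_elt f -> ~ divides f g -> line_res f g != 0.
Proof.
move=> Kinf fh gh fp nfg; have f0 : f != 0 by case: fp.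
have g0 : g != 0 by apply: contra_notN nfg => /eqP->; apply: divides0.
have [p [q [_ pq]]] := exists_line_res_neq0 Kinf fh gh fp nfg.
by apply: contraNneq pq => D0; rewrite -(line_res_eval _ _ fh gh) // D0 meval0.
Qed.

Definition mderiv_dir (q : 'I_3 -> K) g : {mpoly K[3]} := \sum_i q i *: mderiv i g.

Lemma mderiv_homog n (R : comNzRingType) d i (g : {mpoly R[n]}) :
  g \is d.+1.-homog -> mderiv i g \is d.-homog.
Proof.
move=> gh; apply/dhomogP => m; rewrite mcoeff_msupp mcoeff_mderiv => mg.
have : (m + U_(i))%MM \in msupp g.
  by rewrite mcoeff_msupp; apply: contraNneq mg => ->; rewrite mul0rn.
by move/(dhomog_mf gh); rewrite /= mdegD mdeg1 addn1 => -[].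
Qed.

Lemma mderiv_dir_homog q d g : g \is d.+1.-homog -> mderiv_dir q g \is d.-homog.
Proof. by move=> gh; apply: rpred_sum => i _; apply/rpredZ/mderiv_homog. Qed.

Lemma deriv_restrict_line q x g :
  (restrict_line g q x)^`() = restrict_line (mderiv_dir q g) q x.
Proof.
pose P h := (restrict_line h q x)^`() = restrict_line (mderiv_dir q h) q x.
have rlD h h' : restrict_line (h + h') q x = restrict_line h q x + restrict_line h' q x.
  exact: rmorphD.
have dirD h h' : mderiv_dir q (h + h') = mderiv_dir q h + mderiv_dir q h'.
  by rewrite /mderiv_dir -big_split; apply: eq_bigr => i _; rewrite mderivD scalerDr.
have dirM h h' : mderiv_dir q (h * h') = mderiv_dir q h * h' + h * mderiv_dir q h'.
  rewrite /mderiv_dir mulr_suml mulr_sumr -big_split; apply: eq_bigr => i _ /=.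
  by rewrite mderivM scalerDr scalerAl scalerAr.
have PD h h' : P h -> P h' -> P (h + h').
  by rewrite /P => Ph Ph'; rewrite dirD !rlD derivD Ph Ph'.
have PM h h' : P h -> P h' -> P (h * h').
  by rewrite /P => Ph Ph'; rewrite dirM !rlD !restrict_lineM derivM Ph Ph'.
have PC c : P c%:MP.
  rewrite /P /mderiv_dir big1 => [|i _]; last by rewrite mderivC scaler0.
  by rewrite /restrict_line mmapC derivC mmap0.
have PX i : P 'X_i.
  rewrite /P /mderiv_dir (bigD1 i) //= big1 ?addr0; last first.
    by move=> j ji; rewrite mderivX mnm1E eq_sym (negPf ji) scale0r scaler0.
  have -> : mderiv i 'X_i = 1 :> {mpoly K[3]}.
    rewrite mderivX mnm1E eqxx scale1r -mpolyX0; congr 'X_[_].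
    by apply/mnmP=> j; rewrite mnmBE subnn mnm0E.
  rewrite alg_mpolyC /restrict_line mmapX mmap1U mmapC.
  by rewrite derivD derivM !derivC derivX mul0r add0r mulr1 addr0.
have PXn m : P 'X_[m].
  rewrite mpolyXE_id; elim/big_rec: _ => [|i h _ Ph]; first exact: PC.
  apply: (PM _ _ _ Ph); elim: (m i) => [|j IHj]; first exact: PC.
  by rewrite exprS; apply: (PM).
rewrite -/(P g) [g]mpolyE; elim/big_rec: _ => [|m h _ Ph].
  by rewrite -[0]/(mpolyC 3 0); apply: PC.
by apply: (PD _ _ _ Ph); rewrite -mul_mpolyC; apply: (PM).
Qed.

(** The derivative has too small a degree to be a nonzero multiple of [f], so it would vanish. But
    along [q] its coefficient of degree d is (d + 1) f(q), which is nonzero in characteristic 0. *)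
Lemma prime_ndivides_dir q d f : [pchar K] =i pred0 -> f \is d.+1.-homog -> f != 0 ->
  f.@[q] != 0 -> ~ divides f (mderiv_dir q f).
Proof.
move=> /pcharf0P K0 fh f0 fq [h hE].
have dh := mderiv_dir_homog q fh.
have dir0 : mderiv_dir q f = 0.
  apply/eqP; apply: contraT => dir0; have h0 : h != 0.
    by apply: contraNneq dir0 => h0; rewrite hE h0 mul0r.
  have := homog_msize_pred dh dir0; have := homog_msize_pred fh f0.
  rewrite hE msizeM //; have := mpolySpred mdeg h0.
  by move: (msize h) (msize f) => a b; lia.
have := deriv_restrict_line q (fun=> 0) f; rewrite dir0 /restrict_line mmap0.
move=> /(congr1 (fun r : {poly K} => r`_d)); rewrite coef0 coef_deriv.
rewrite -/(restrict_line f q (fun=> 0)) coef_restrict_line // => /eqP.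
by rewrite -mulr_natr mulf_eq0 (negPf fq) K0.
Qed.
End LineForms.

Lemma split_separable (K : closedFieldType) d (F : {poly K}) : size F = d.+1 ->
  (forall x, F.[x] = 0 -> F^`().[x] != 0) ->
  exists s : seq K, [/\ uniq s, size s = d, all (root F) s
    & F = lead_coef F *: \prod_(x <- s) ('X - x%:P)].
Proof.
move=> szF sep; have [s FE] := closed_field_poly_normal F.
have F0 : lead_coef F != 0 by rewrite lead_coef_eq0 -size_poly_eq0 szF.
exists s; split=> //.
- rewrite -separable_prod_XsubC -(eqp_separable (eqp_scale _ F0)) -FE.
  rewrite unlock; apply/coprimepP => e eF eF'; rewrite -size_poly_eq1; apply: contraT => e1.
  have e0 : e != 0 by apply: contraTneq eF => ->; rewrite dvd0p -size_poly_eq0 szF.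
  have [x /rootP ex] := closed_rootP e e1.
  have /rootP Fx : root F x by rewrite -dvdp_XsubCl; apply: dvdp_trans eF; rewrite dvdp_XsubCl;
    apply/rootP.
  have := sep x Fx; have /rootP -> : root F^`() x 
    by rewrite -dvdp_XsubCl; apply: dvdp_trans eF'; rewrite dvdp_XsubCl; apply/rootP.
  by rewrite eqxx.
- by apply/eqP; rewrite -eqSS -szF FE size_scale // size_prod_XsubC.
by apply/allP => x xs; rewrite FE rootZ // root_prod_XsubC.
Qed.

Lemma binary_disc_common_root (R : comNzRingType) d (F : {poly R}) x :
  (1 < d)%N -> (size F <= d.+1)%N -> F.[x] = 0 -> F^`().[x] = 0 -> binary_disc d F = 0.
Proof.
case: d => [|[|d]] // _ szF Fx F'x; rewrite binary_discE.
have szF' : (size F^`() <= d.+2)%N.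
  by rewrite (leq_trans (size_poly _ _)) //; case: (size F) szF.
have szr : (size (F *+ d.+2 - 'X * F^`())%R <= d.+2)%N.
  apply/leq_sizeP => j; rewrite leq_eqVlt => /orP[/eqP<-|ltj].
    by rewrite coefB coefXM coefMn coef_deriv /= subrr.
  rewrite coefB coefXM coefMn; case: j ltj => // j ltj.
  by rewrite /= coef_deriv !nth_default ?mul0rn ?subrr // (leq_trans szF).
apply: res_common_root szr szF' _ (F'x) => //.
by rewrite hornerD hornerN hornerM hornerMn Fx F'x mul0rn mulr0 subrr.
Qed.

(** [f] does not divide its derivative in the direction of a point [q] off the curve, so on some
    line through [q] the two restrictions have no common root. There the roots of [f] are simple,
    and Poisson's formula gives a nonzero discriminant. *)
Lemma dual_form_neq0 (K : closedFieldType) d (f : {mpoly K[3]}) :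
  [pchar K] =i pred0 -> f \is d.-homog -> prime_elt f -> dual_form f != 0.
Proof.
move=> K0 fh fp; have f0 : f != 0 by case: fp.
have Kinf := pchar0_infinite K0; have [q fq] := mpoly_neq0_point Kinf f0.
have [_ DE] := dual_formP (homogE fh); rewrite (homog_msize_pred fh f0) in DE.
case: d fh DE => [|d] fh DE.
  apply: contraTneq isT => D0; have := DE q q; rewrite D0 meval0 /binary_disc det_mx00.
  by move/eqP; rewrite eq_sym oner_eq0.
have gh := mderiv_dir_homog q fh.
have ndiv := prime_ndivides_dir K0 fh f0 fq.
have [x rx] := mpoly_neq0_point Kinf (res_shift_neq0 fh gh fp fq ndiv).
pose F := restrict_line f q x.
have mapE g : map_poly (meval x) (shift_mpoly q g) = restrict_line g q x.
  rewrite shift_mpolyE map_restrict_line map_mpoly_trans.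
  rewrite (_ : meval x \o _ = idfun) ?map_mpoly_id; last first.
    by apply/funext => c /=; rewrite mevalC.
  by congr restrict_line; apply/funext => i /=; rewrite ?mevalC ?mevalXU.
have resE := map_resE (phi := meval x) d.+1 d (mapE f) (mapE (mderiv_dir q f)).
rewrite -deriv_restrict_line -/F in resE.
rewrite resE in rx.
have szF : size F = d.+2.
  apply/eqP; rewrite eqn_leq size_restrict_line //=.
  rewrite ltnNge; apply: contraNN fq => /leq_sizeP/(_ _ (leqnn d.+1)).
  by rewrite coef_restrict_line // => ->.
have szF' : (size F^`() <= d.+1)%N.
  by rewrite (leq_trans (size_poly _ _)) // szF.
have [y Fy|s [us szs rs FE]] := split_separable szF.
  apply: contraNneq rx => F'y; apply/eqP.
  by apply: res_common_root szF' Fy F'y; rewrite ?addSn ?szF.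
have [b /(_ K s F K0 szs isT szF rs us)] := binary_disc_roots d.+1.
move=> bdE; apply: contraTneq isT => D0.
have := DE q x; rewrite D0 meval0 -/F => bd0; move/eqP: bdE; rewrite -bd0 mulr0.
rewrite eq_sym !mulf_eq0 signr_eq0 /= expf_eq0 -mulr_natr mulf_eq0.
rewrite lead_coef_eq0 -size_poly_eq0 szF /= ((pcharf0P _).1 K0) andbF /=.
rewrite prodf_seq_eq0 => /hasP[y ys /= /eqP F'y].
have /rootP Fy := allP rs y ys.
by case/eqP: rx; apply: res_common_root szF' Fy F'y; rewrite ?addSn ?szF.
Qed.

(** * Cokernels over K[X] localized at 0 *)

Section Cokernel.
Variable K : fieldType.
Local Notation R := {poly K}.

(* The b_i form a K-basis of the cokernel of T over the local ring K[X]_(X);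
   s0 and s stand for denominators. *)
Definition coker_basis n e (T : 'M[R]_n) (b : 'I_e -> 'rV[R]_n) : Prop :=
  (forall w s0, s0.[0] != 0 -> exists (c : 'I_e -> K) s z, s.[0] != 0 /\
     s *: (w - s0 *: \sum_i (c i)%:P *: b i) = z *m T) /\
  (forall (c : 'I_e -> K) s z, s.[0] != 0 ->
     s *: (\sum_i (c i)%:P *: b i) = z *m T -> forall i, c i = 0).

Lemma horner0_eq0 (p : R) : p.[0] = 0 -> exists q, p = q * 'X.
Proof.
by move=> /rootP/factor_theorem[q]; rewrite subr0 => ->; exists q.
Qed.

Lemma mulmx_inj_det (S : idomainType) n (T : 'M[S]_n) (z : 'rV[S]_n) :
  \det T != 0 -> z *m T = 0 -> z = 0.
Proof.
move=> T0 /(congr1 (fun y => y *m \adj T)); rewrite -mulmxA mul_mx_adj mul0mx.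
rewrite mul_mx_scalar => /eqP; rewrite scalemx_eq0 (negPf T0) /= => /eqP //.
Qed.

(* By induction on e: a kernel vector v of T modulo 'X has an entry 1 and satisfies
   v T = 'X w0; replacing the row of this entry by w0 divides the determinant by
   'X and adds w0 to the basis of the cokernel. *)
Lemma coker_basis_exists n e (T : 'M[R]_n) u :
  \det T = 'X^e * u -> u.[0] != 0 -> exists b : 'I_e -> 'rV[R]_n, coker_basis T b.
Proof.
elim: e T u => [|e IHe] T u detT u0.
  exists (fun=> 0); split=> [w s0 _|c s z _ _ []//].
  exists (fun=> 0), u, (w *m \adj T); split=> //.
  by rewrite big_ord0 scaler0 subr0 -mulmxA mul_adj_mx detT mul_mx_scalar expr0 mul1r.
pose T0 := map_mx (horner_eval 0) T.
have /eqP/det0P[v0 v0nz v0T] : \det T0 = 0.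
  have -> : \det T0 = (\det T).[0] by rewrite /T0 det_map_mx.
  by rewrite detT exprS !hornerM hornerX !mul0r.
have [i0 vi0] : exists i0, v0 0 i0 != 0.
  apply: contrapT => /forallNP nv; case/eqP: v0nz; apply/rowP=> i; rewrite mxE.
  by apply/eqP/negPn/negP/nv.
pose v : 'rV[R]_n := map_mx polyC ((v0 0 i0)^-1 *: v0).
have vi0E : v 0 i0 = 1 by rewrite !mxE mulVf.
have [w0 w0E] : exists w0, v *m T = 'X *: w0.
  have vT j : ((v *m T) 0 j).[0] = 0.
    have -> : ((v *m T) 0 j).[0] = ((v0 0 i0)^-1 *: (v0 *m T0)) 0 j.
      rewrite !mxE -/(horner_eval 0 _) rmorph_sum mulr_sumr; apply: eq_bigr => l _ /=.
      by rewrite rmorphM /= !mxE /horner_eval hornerC mulrA.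
    by rewrite v0T scaler0 mxE.
  have [w wE] := choice (fun j => horner0_eq0 (vT j)).
  by exists (\row_j w j); apply/rowP=> j; rewrite !mxE mulrC -wE mxE.
clearbody v.
pose T' : 'M[R]_n := \matrix_(i, j) if i == i0 then w0 0 j else T i j.
have detT' : \det T' = 'X^e * u.
  apply: (@mulfI _ 'X); first by rewrite polyX_eq0.
  rewrite mulrA -exprS -detT (expand_det_row T' i0).
  have -> : 'X * \sum_j T' i0 j * cofactor T' i0 j = \sum_j (v *m T) 0 j * cofactor T i0 j.
    rewrite w0E mulr_sumr; apply: eq_bigr => j _; rewrite !mxE eqxx mulrA; congr (_ * _).
    rewrite /cofactor; congr (_ * \det _); apply/matrixP=> i l.
    by rewrite !mxE eq_sym (negPf (neq_lift _ _)).
  have -> : \sum_j (v *m T) 0 j * cofactor T i0 j = (v *m T *m \adj T) 0 i0.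
    by rewrite [RHS]mxE; apply: eq_bigr => j _; congr (_ * _); rewrite [RHS]mxE.
  by rewrite -mulmxA mul_mx_adj mul_mx_scalar mxE vi0E mulr1.
have [b' [ex' un']] := IHe T' u detT' u0.
have T'nz : \det T' != 0.
  rewrite detT' mulf_neq0 ?expf_neq0 ?polyX_eq0 //.
  by apply: contraNneq u0 => ->; rewrite horner0.
pose d : 'rV[R]_n := delta_mx 0 i0.
have dT' : d *m T' = w0 by rewrite -rowE; apply/rowP=> j; rewrite !mxE eqxx.
have zT' z : z *m T' = z 0 i0 *: w0 + (z - z 0 i0 *: d) *m T.
  rewrite !mulmx_sum_row (bigD1 i0) //= [in RHS](bigD1 i0) //= !mxE !eqxx mulr1 subrr.
  rewrite scale0r add0r; congr (_ *: _ + _); first by apply/rowP=> j; rewrite !mxE eqxx.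
  apply: eq_bigr => i ii0; rewrite !mxE (negPf ii0) andbF mulr0 subr0; congr (_ *: _).
  by apply/rowP=> j; rewrite !mxE (negPf ii0).
pose b (i : 'I_e.+1) := if unlift ord0 i is Some j then b' j else w0.
have sumb (c : 'I_e.+1 -> K) : \sum_i (c i)%:P *: b i =
    (c ord0)%:P *: w0 + \sum_i (c (lift ord0 i))%:P *: b' i.
  rewrite big_ord_recl /b unlift_none; congr (_ + _).
  by apply: eq_bigr => i _; rewrite liftK.
exists b; split=> [w s0 s00|c s z s00].
  have [c' [s [z [sz zE]]]] := ex' w s0 s00.
  (* This constant makes the coordinate of [z] at the replaced row, minus the part carried by w0,
     divisible by 'X; and 'X w0 lies in the image of T. *)
  pose c0 := (z 0 i0).[0] / (s.[0] * s0.[0]).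
  have [y yE] : exists y, z 0 i0 - s * s0 * c0%:P = y * 'X.
    apply: horner0_eq0; rewrite hornerD hornerN !hornerM hornerC /c0.
    by rewrite [_ * (_ / _)]mulrC divfK ?subrr // mulf_neq0.
  exists (fun i => if unlift ord0 i is Some j then c' j else c0), s.
  exists (y *: v + (z - z 0 i0 *: d)); split=> //.
  rewrite sumb unlift_none; under eq_bigr => i _ do rewrite liftK.
  move: (\sum_i _) zE => S zE.
  have -> : s *: (w - s0 *: (c0%:P *: w0 + S)) = s *: (w - s0 *: S) - (s * s0 * c0%:P) *: w0.
    by apply/rowP=> j; rewrite !mxE; ring.
  by rewrite zE zT' [in RHS]mulmxDl -(scalemxAl y) w0E scalerA -yE scalerBl addrAC.
rewrite sumb => cE.
(* [y0] writes the replaced row of T in terms of the rows of T', so that [z'] below is [z] converted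
   from T to T'. *)
pose y0 : 'rV[R]_n := 'X *: d - v + d.
have y0T' : y0 *m T' = row i0 T.
  have -> : row i0 T = d *m T by rewrite -rowE.
  have y0i : y0 0 i0 = 'X by rewrite /y0 !mxE !eqxx vi0E mulr1 subrK.
  rewrite zT' y0i.
  have -> : y0 - 'X *: d = d - v by rewrite /y0; apply/rowP=> j; rewrite !mxE; ring.
  by rewrite mulmxBl w0E; apply/rowP=> j; rewrite !mxE; ring.
pose z' := (z - z 0 i0 *: d) + z 0 i0 *: y0.
have z'T' : z' *m T' = z *m T.
  rewrite /z' mulmxDl -scalemxAl y0T' zT' !mxE !eqxx mulr1 subrr !scale0r subr0 add0r.
  by rewrite mulmxBl -scalemxAl -rowE subrK.
have c'0 : forall i, c (lift ord0 i) = 0.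
  apply: (un' (fun i => c (lift ord0 i)) s (z' - (s * (c ord0)%:P) *: d)) => //.
  by rewrite mulmxBl z'T' -cE -scalemxAl dT' scalerDr scalerA addrC addKr.
have z'E : z' = (s * (c ord0)%:P) *: d.
  apply/eqP; rewrite -subr_eq0; apply/eqP/(mulmx_inj_det T'nz).
  rewrite mulmxBl z'T' -cE -scalemxAl dT' scalerDr scalerA addrC.
  by rewrite big1 ?scaler0 ?addKr ?subrr // => i _; rewrite c'0 scale0r.
have c00 : c ord0 = 0.
  have z'i0 : z' 0 i0 = z 0 i0 * 'X.
    by rewrite /z' /y0 !mxE !eqxx vi0E !mulr1 subrr add0r subrK.
  have : z' 0 i0 = s * (c ord0)%:P by rewrite z'E !mxE !eqxx mulr1.
  rewrite z'i0.
  move/(congr1 (horner^~ 0)); rewrite !hornerM hornerX mulr0 hornerC => /esym/eqP.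
  by rewrite mulf_eq0 (negPf s00) => /eqP.
by move=> i; case: (unliftP ord0 i) => [j|] ->.
Qed.
End Cokernel.

(** * Affine charts *)

Lemma meval_scale n (R : comNzRingType) d (p : {mpoly R[n]}) (x : R) (v : 'I_n -> R) :
  p \is d.-homog -> p.@[fun i => x * v i] = x ^+ d * p.@[v].
Proof.
move=> ph; rewrite !mevalE mulr_sumr big_seq [RHS]big_seq; apply: eq_bigr => m mp.
rewrite mulrCA; congr (_ * _); have <- : mdeg m = d := dhomog_mf ph mp.
rewrite mdegE -prodrXr -big_split; apply: eq_bigr => i _; by rewrite exprMn.
Qed.

Section Chart.
Variable K : fieldType.
Hypothesis Kinf : infinite_ring K.
Variables P P' q : 'I_3 -> K.
Local Notation i0 := (0 : 'I_3).
Local Notation i1 := (1 : 'I_3).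
Local Notation i2 := (2%:R : 'I_3).

Definition dot3 (x y : 'I_3 -> K) : K := x i0 * y i0 + x i1 * y i1 + x i2 * y i2.

Lemma ord3P (i : 'I_3) : [\/ i = i0, i = i1 | i = i2].
Proof.
by case: i => -[|[|[|i]]] // ?; [constructor 1|constructor 2|constructor 3]; apply: val_inj.
Qed.

Lemma join_line0 (R : comNzRingType) (x y : 'I_3 -> R) :
  join_line x y i0 = x i1 * y i2 - x i2 * y i1.
Proof. by rewrite /join_line; congr (x _ * y _ - x _ * y _); apply: val_inj. Qed.

Lemma join_line1 (R : comNzRingType) (x y : 'I_3 -> R) :
  join_line x y i1 = x i2 * y i0 - x i0 * y i2.
Proof. by rewrite /join_line; congr (x _ * y _ - x _ * y _); apply: val_inj. Qed.

Lemma join_line2 (R : comNzRingType) (x y : 'I_3 -> R) :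
  join_line x y i2 = x i0 * y i1 - x i1 * y i0.
Proof. by rewrite /join_line; congr (x _ * y _ - x _ * y _); apply: val_inj. Qed.

Definition join_lineE R x y := (@join_line0 R x y, @join_line1 R x y, @join_line2 R x y).

Let det := dot3 P (join_line P' q).
Hypothesis det0 : det != 0.

Definition lform (v : 'I_3 -> K) : {mpoly K[3]} := \sum_i v i *: 'X_i.

Lemma lform_eval v x : (lform v).@[x] = dot3 v x.
Proof.
rewrite /lform !big_ord_recl big_ord0 addr0 !mevalD !mevalZ !mevalXU addrA.
by rewrite /dot3; congr (v _ * x _ + v _ * x _ + v _ * x _); apply: val_inj.
Qed.

Lemma lform_homog v : lform v \is 1.-homog.
Proof. by apply: rpred_sum => i _; apply: rpredZ; rewrite dhomogX; apply/eqP/mdeg1. Qed.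

(* The coordinates with respect to the basis P, P', q. *)
Definition coordL := lform (fun i => join_line P' q i / det).
Definition coord1 := lform (fun i => join_line q P i / det).
Definition coord2 := lform (fun i => join_line P P' i / det).

Lemma coordE x i :
  x i = coordL.@[x] * P i + coord1.@[x] * P' i + coord2.@[x] * q i.
Proof.
apply: (mulfI det0); rewrite /coordL /coord1 /coord2 !lform_eval /dot3.
transitivity (
  (join_line P' q i0 * x i0 + join_line P' q i1 * x i1 + join_line P' q i2 * x i2) * P i +
  (join_line q P i0 * x i0 + join_line q P i1 * x i1 + join_line q P i2 * x i2) * P' i +
  (join_line P P' i0 * x i0 + join_line P P' i1 * x i1 + join_line P P' i2 * x i2) * q i).
  by rewrite /det /dot3 !join_lineE; case: (ord3P i) => ->; ring.
by field.
Qed.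

(* The restriction of a form to the chart P + e P' + r q, with e = 'X%:P and r = 'X *)
Definition chart (a : {mpoly K[3]}) : {poly {poly K}} :=
  restrict_line (map_mpoly polyC a) (fun i => (q i)%:P) (fun i => (P i)%:P + (P' i)%:P * 'X).

Lemma chartM a b : chart (a * b) = chart a * chart b.
Proof. by rewrite /chart -restrict_lineM rmorphM. Qed.

Lemma chartD a b : chart (a + b) = chart a + chart b.
Proof. by rewrite /chart rmorphD /restrict_line mmapD. Qed.

Lemma chartB a b : chart (a - b) = chart a - chart b.
Proof. by rewrite /chart rmorphB /restrict_line mmapB. Qed.

Lemma chartC c : chart c%:MP = c%:P%:P.
Proof. by rewrite /chart map_mpolyC /restrict_line mmapC. Qed.

Lemma chartZ c a : chart (c *: a) = c%:P%:P * chart a.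
Proof. by rewrite -mul_mpolyC chartM chartC. Qed.

Lemma chartX i : chart 'X_i = ((P i)%:P + (P' i)%:P * 'X)%:P + (q i)%:P%:P * 'X.
Proof. by rewrite /chart map_mpolyX /restrict_line mmapX mmap1U addrC. Qed.

Lemma chartXn a e : chart (a ^+ e) = chart a ^+ e.
Proof.
by elim: e => [|e IHe]; [rewrite !expr0 -[1]/(1%:MP) chartC|rewrite !exprS chartM IHe].
Qed.

Lemma chart_lform v : chart (lform v) =
  (dot3 v P)%:P%:P + (dot3 v P')%:P%:P * 'X%:P + (dot3 v q)%:P%:P * 'X.
Proof.
rewrite /lform !big_ord_recl big_ord0 addr0 !chartD !chartZ !chartX /dot3.
set j1 := lift _ _; set j2 := lift _ _.
have -> : j1 = i1 by apply: val_inj.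
have -> : j2 = i2 by apply: val_inj.
have -> : ord0 = i0 :> 'I_3 by [].
by rewrite !rmorphD !rmorphM /=; ring.
Qed.

Lemma dot3Z w x c : dot3 (fun i => w i / c) x = dot3 w x / c.
Proof. by rewrite /dot3; ring. Qed.

Lemma chartL : chart coordL = 1.
Proof.
rewrite chart_lform !dot3Z.
have -> : dot3 (join_line P' q) P = det by rewrite /det /dot3; ring.
have -> : dot3 (join_line P' q) P' = 0 by rewrite /dot3 !join_lineE; ring.
have -> : dot3 (join_line P' q) q = 0 by rewrite /dot3 !join_lineE; ring.
have z : (0 / det)%:P%:P = 0 :> {poly {poly K}} by rewrite mul0r !polyC0.
have o : (det / det)%:P%:P = 1 :> {poly {poly K}} by rewrite divff.
by rewrite z o !mul0r !addr0.
Qed.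

Lemma chart1 : chart coord1 = 'X%:P.
Proof.
rewrite chart_lform !dot3Z.
have -> : dot3 (join_line q P) P = 0 by rewrite /dot3 !join_lineE; ring.
have -> : dot3 (join_line q P) P' = det by rewrite /det /dot3 !join_lineE; ring.
have -> : dot3 (join_line q P) q = 0 by rewrite /dot3 !join_lineE; ring.
have z : (0 / det)%:P%:P = 0 :> {poly {poly K}} by rewrite mul0r !polyC0.
have o : (det / det)%:P%:P = 1 :> {poly {poly K}} by rewrite divff.
by rewrite z o !mul0r mul1r add0r addr0.
Qed.

Lemma chart2 : chart coord2 = 'X.
Proof.
rewrite chart_lform !dot3Z.
have -> : dot3 (join_line P P') P = 0 by rewrite /dot3 !join_lineE; ring.
have -> : dot3 (join_line P P') P' = 0 by rewrite /dot3 !join_lineE; ring.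
have -> : dot3 (join_line P P') q = det by rewrite /det /dot3 !join_lineE; ring.
have z : (0 / det)%:P%:P = 0 :> {poly {poly K}} by rewrite mul0r !polyC0.
have o : (det / det)%:P%:P = 1 :> {poly {poly K}} by rewrite divff.
by rewrite z o !mul0r mul1r !add0r.
Qed.

Lemma chart_eval a e r : (chart a).[r%:P].[e] = a.@[fun i => P i + P' i * e + q i * r].
Proof.
rewrite /chart horner_restrict_line /meval mmap_map_mpoly -/(horner_eval e _).
rewrite (mmap_comp (horner_eval e)); congr (mmap _ _ _).
  by apply/funext => c /=; rewrite /horner_eval hornerC.
by apply/funext => i /=; rewrite /horner_eval !(hornerD, hornerM, hornerC, hornerX) addrC.
Qed.

Lemma coordL_base : coordL.@[P] = 1.
Proof.
have := chart_eval coordL 0 0; rewrite chartL !hornerE => ->.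
by apply: meval_eq => i; rewrite !mulr0 !addr0.
Qed.

(** Each point where [coordL] is nonzero is a multiple of a point of the chart. A form with zero
    restriction thus vanishes everywhere after multiplication by [coordL], and over an infinite
    field it is zero. *)
Lemma chart_homog_inj d a b : a \is d.-homog -> b \is d.-homog -> chart a = chart b -> a = b.
Proof.
move=> ah bh ab; apply/eqP; rewrite -subr_eq0; apply/eqP.
have ch : a - b \is d.-homog by apply: rpredB.
have : chart (a - b) = 0 by rewrite chartB ab subrr.
move: (a - b) ch => c ch c0.
have L0 : coordL != 0.
  by apply: contraTneq (oner_neq0 K) => L0; rewrite -coordL_base L0 meval0 eqxx.
suff : c * coordL = 0 by move/eqP; rewrite mulf_eq0 (negPf L0) orbF => /eqP.
apply: (eq_mpoly_eval Kinf) => x; rewrite mevalM meval0.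
have [->|Lx] := eqVneq coordL.@[x] 0; first by rewrite mulr0.
have -> : c.@[x] = c.@[fun i => coordL.@[x] *
    (P i + P' i * (coord1.@[x] / coordL.@[x]) + q i * (coord2.@[x] / coordL.@[x]))].
  by apply: meval_eq => i; rewrite [LHS]coordE; field.
by rewrite (meval_scale _ _ ch) -chart_eval c0 !horner0 mulr0 mul0r.
Qed.

(** [coordL] is the equation of the line at infinity of the chart; its powers raise degrees at no
    cost. *)
Lemma chart_pad a e : chart (a * coordL ^+ e) = chart a.
Proof. by rewrite (chartM a) (chartXn coordL) chartL expr1n mulr1. Qed.

Lemma homogenize h : exists N a, a \is N.-homog /\ chart a = h.
Proof.
have L1 := lform_homog (fun i => join_line P' q i / det).
have X1 := lform_homog (fun i => join_line q P i / det).
have X2 := lform_homog (fun i => join_line P P' i / det).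
rewrite -/coordL in L1; rewrite -/coord1 in X1; rewrite -/coord2 in X2.
pose Hg h := exists N a, a \is N.-homog /\ chart a = h.
have HgC c : Hg c%:P%:P.
  exists 0%N, c%:MP; rewrite chartC; split=> //.
  by rewrite -alg_mpolyC; apply/rpredZ/dhomog1.
have HgM u v : Hg u -> Hg v -> Hg (u * v).
  move=> [M [a [ah <-]]] [N [b [bh <-]]]; exists (M + N)%N, (a * b); rewrite chartM.
  by split=> //; apply: dhomogM.
have HgD u v : Hg u -> Hg v -> Hg (u + v).
  move=> [M [a [ah <-]]] [N [b [bh <-]]].
  exists (M + N)%N, (a * coordL ^+ N + b * coordL ^+ M).
  split; last by rewrite chartD !chart_pad.
  have LM := dhomogMn M L1; have LN := dhomogMn N L1; rewrite !mul1n in LM LN.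
  apply: rpredD; first exact: dhomogM.
  by rewrite addnC; apply: dhomogM.
have HgP (c : {poly K}) : Hg c%:P.
  elim/poly_ind: c => [|c x IHc]; first by rewrite -polyC0; apply: HgC.
  rewrite polyCD polyCM; apply: (HgD) => //; apply: (HgM) => //.
  by exists 1%N, coord1; rewrite chart1.
rewrite -/(Hg h); elim/poly_ind: h => [|h c IHh]; first exact: HgP.
by apply: (HgD) => //; apply: (HgM) => //; exists 1%N, coord2; rewrite chart2.
Qed.

Lemma homogenize_le h : exists N0, forall N, (N0 <= N)%N ->
  exists a, a \is N.-homog /\ chart a = h.
Proof.
have [N0 [a [ah aE]]] := homogenize h; exists N0 => N leN.
exists (a * coordL ^+ (N - N0)); rewrite chart_pad; split=> //.
have Lh := lform_homog (fun i => join_line P' q i / det).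
have := dhomogM ah (dhomogMn (N - N0) Lh); by rewrite mul1n subnKC.
Qed.

End Chart.

(** * Local intersection multiplicities *)

Section LocalAlgebra.
Variable K : closedFieldType.
Local Notation R := {poly K}.
Variables (d1 d2 e : nat) (F G : {poly R}) (c : K) (u : R).
Hypotheses (c0 : c != 0) (szF : size F = d1.+1) (lF : lead_coef F = c%:P).
Hypotheses (szG : (size G <= d2.+1)%N) (d_gt0 : (0 < d1 + d2)%N).
Hypotheses (resE : res d1 d2 F G = 'X^e * u) (u0 : u.[0] != 0).
Hypothesis zeros : forall r : K, F.[r%:P].[0] = 0 -> G.[r%:P].[0] = 0 -> r = 0.

Definition in_ideal (H : {poly R}) : Prop := exists V W, H = V * F + W * G.

Lemma in_idealD H H' : in_ideal H -> in_ideal H' -> in_ideal (H + H').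
Proof. by move=> [V [W ->]] [V' [W' ->]]; exists (V + V'), (W + W'); ring. Qed.

Lemma in_idealM H H' : in_ideal H -> in_ideal (H' * H).
Proof. by move=> [V [W ->]]; exists (H' * V), (H' * W); ring. Qed.

Lemma bezout3 (a b s : R) : a != 0 ->
  (forall r, a.[r] = 0 -> b.[r] = 0 -> s.[r] != 0) ->
  exists x y z, x * a + y * b + z * s = 1.
Proof.
move=> a0 nz; have cop : coprimep (gcdp a b) s.
  rewrite coprimep_def; apply/negPn/negP => sz1.
  have [r] := closed_rootP _ sz1; rewrite !root_gcd => /andP[/andP[/rootP ar /rootP br]].
  by move=> /rootP sr; move: (nz r ar br); rewrite sr eqxx.
have [[x y]] := Bezoutp a b; case/Bezout_coprimepP: cop => [[v w]] /= vwE xyE.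
have [g [h gh1]] : exists g h, g * gcdp a b + h * s = 1.
  move: vwE; rewrite -size_poly_eq1 => /size_poly1P[k k0 kE].
  exists (k^-1 *: v), (k^-1 *: w).
  by rewrite -!scalerAl -scalerDr kE -mul_polyC -polyCM mulVf.
case/eqpP: xyE => -[k l] /= /andP[k0 l0] klE; exists (g * (l^-1 * k)%:P * x), (g * (l^-1 * k)%:P
  * y), h.
rewrite -gh1; congr (_ + _); rewrite -!mulrA -mulrDr; congr (_ * _).
by rewrite -mulrDr mul_polyC -scalerA klE scalerA mulVf // scale1r.
Qed.

(* Modulo 'X%:P, the polynomials F, G and S have no common zero, so that S is
   invertible modulo (F, G, 'X%:P); now u times a power of 'X%:P lies in (F, G). *)
Lemma ideal_inverse (S : {poly R}) : S.[0].[0] != 0 ->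
  exists U, in_ideal (u%:P - S * U).
Proof.
move=> S0; pose ev : {rmorphism {poly R} -> R} := map_poly (horner_eval 0).
have evE (H : {poly R}) r : (ev H).[r] = H.[r%:P].[0].
  by rewrite -[r in LHS](hornerC r 0) -[r%:P.[0]]/(horner_eval 0 r%:P) horner_map.
have evC (a : R) : ev (map_poly polyC a) = a.
  by rewrite /ev /= -map_poly_comp map_poly_id // => x _; rewrite /= /horner_eval hornerC.
have evF0 : ev F != 0.
  apply: contraNneq c0 => /(congr1 (fun p : R => p`_d1)).
  rewrite coef_map /= coef0 /horner_eval.
  by have -> : F`_d1 = c%:P by [rewrite -lF lead_coefE szF]; rewrite hornerC => ->.
have [|x [y [z xyz]]] := @bezout3 (ev F) (ev G) (ev S) evF0.
  by move=> r; rewrite !evE => Fr Gr; rewrite (zeros Fr Gr) polyC0.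
pose x' := map_poly polyC x; pose y' := map_poly polyC y; pose z' := map_poly polyC z.
have [Y YE] : exists Y, x' * F + y' * G + z' * S = 1 + 'X%:P * Y.
  have ev1 : ev (x' * F + y' * G + z' * S - 1) = 0.
    by rewrite (rmorphB ev) !(rmorphD ev) !(rmorphM ev) (rmorph1 ev) !evC xyz subrr.
  move: (_ - 1) ev1 (subrK 1 (x' * F + y' * G + z' * S)) => H H0 <-.
  exists (map_poly (fun a : R => a %/ 'X) H); rewrite addrC; congr (_ + _).
  apply/polyP=> i; rewrite coefCM coef_map_id0 ?div0p //.
  have := congr1 (fun p : R => p`_i) H0; rewrite coef_map coef0 /= => /horner0_eq0[q ->].
  by rewrite mulpK ?polyX_eq0 // mulrC.
have iR : in_ideal ('X^e * u)%:P.
  have szF' : (size F <= d1.+1)%N by rewrite szF.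
  by have [V [W [_ _ VW]]] := res_ideal d_gt0 szF' szG; exists V, W; rewrite -resE.
(* A truncated geometric series, which inverts 1 + 'X%:P Y up to the power e of 'X%:P. That power
   times [u] is the resultant, which lies in the ideal. *)
pose T := \sum_(j < e) (- ('X%:P * Y)) ^+ j.
have TE : (1 + 'X%:P * Y) * T = 1 - (- ('X%:P * Y)) ^+ e.
  by rewrite /T -[1 in RHS](expr1n _ e) subrXX; congr (_ * _);
    [rewrite opprK|apply: eq_bigr => j _; rewrite expr1n mul1r].
exists (z' * u%:P * T).
have -> : u%:P - S * (z' * u%:P * T) =
   (u%:P * T) * (x' * F + y' * G) + (- Y) ^+ e * ('X^e * u)%:P.
  have -> : (- Y) ^+ e * ('X^e * u)%:P = u%:P * (- ('X%:P * Y)) ^+ e.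
    by rewrite -mulrN exprMn polyCM polyC_exp; ring.
  have -> : x' * F + y' * G = (1 + 'X%:P * Y) - z' * S by rewrite -YE addrK.
  rewrite mulrBr -[u%:P * T * (1 + _)]mulrA [T * _]mulrC TE; ring.
by apply: in_idealD; [exists (u%:P * T * x'), (u%:P * T * y'); ring|apply: in_idealM].
Qed.

Lemma mod_F (H : {poly R}) : exists Q W, H = Q * F + W /\ (size W <= d1)%N.
Proof.
have cU : lead_coef F \is a GRing.unit.
  by rewrite lF poly_unitE size_polyC c0 /= coefC eqxx unitfE.
exists (H %/ F), (H %% F); split; first exact: Pdiv.IdomainUnit.divp_eq cU H.
by rewrite -ltnS -szF ltn_modp -size_poly_gt0 szF.
Qed.

Variable b : 'I_e -> 'rV[R]_(d1 + d2).
Hypothesis bP : coker_basis (sylvester d1 d2 F G) b.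

Let szF' : (size F <= d1.+1)%N. Proof. by rewrite szF. Qed.

Lemma rVpoly_sum (s : R) (a : 'I_e -> K) :
  rVpoly (s *: \sum_i (a i)%:P *: b i) = s%:P * \sum_i (a i)%:P%:P * rVpoly (b i).
Proof.
rewrite linearZ linear_sum /= -mul_polyC; congr (_ * _).
by apply: eq_bigr => i _; rewrite linearZ /= mul_polyC.
Qed.

(** Modulo the ideal 1 / S equals U / u, so that denominators reduce to polynomials in the inner
    variable alone. Division by [F], whose leading coefficient is a constant, then turns the
    numerator into a row vector, to which [bP] applies. *)
Lemma local_basis_span (H S : {poly R}) : S.[0].[0] != 0 ->
  exists (a : 'I_e -> K) (s : R), s.[0] != 0 /\
    in_ideal (s%:P * (H - S * \sum_i (a i)%:P%:P * rVpoly (b i))).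
Proof.
move=> S0; have [U [V1 [V2 UE]]] := ideal_inverse S0.
have [Q [W [QW szW]]] := mod_F (H * U).
have [a [s [z [s0 zE]]]] := bP.1 (poly_rV W) u u0.
exists a, (s * u); split; first by rewrite hornerM mulf_neq0.
have := mul_sylvester z szF' szG; rewrite -zE scalerBr linearB /=.
rewrite scalerA rVpoly_sum linearZ /= poly_rV_K ?(leq_trans szW) ?leq_addr // -mul_polyC.
move: (\sum_i _) (rVpoly (lsubmx z)) (rVpoly (rsubmx z)) => Z v1 v2 ZE.
have HU : H * u%:P = S * (H * U) + H * V1 * F + H * V2 * G.
  by have -> : u%:P = S * U + (V1 * F + V2 * G) by [rewrite -UE; ring]; ring.
exists (s%:P * S * Q + s%:P * H * V1 + S * v2), (s%:P * H * V2 + S * v1).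
rewrite polyCM.
have -> : s%:P * u%:P * (H - S * Z) = s%:P * (H * u%:P) - S * (s%:P * u%:P * Z) by ring.
rewrite HU QW; have -> : s%:P * u%:P * Z = s%:P * W - (v1 * G + v2 * F).
  by rewrite -ZE polyCM; ring.
by ring.
Qed.

(** Once the cofactor of [G] is reduced modulo [F], degrees in the outer variable bound the cofactor
    of [F] too. The relation then lies in the image of the Sylvester matrix. *)
Lemma local_basis_free (S : {poly R}) (a : 'I_e -> K) : S.[0].[0] != 0 ->
  in_ideal (S * \sum_i (a i)%:P%:P * rVpoly (b i)) -> forall i, a i = 0.
Proof.
move=> S0 iS; have [U iU] := ideal_inverse S0.
have [V [W VW]] : in_ideal (u%:P * \sum_i (a i)%:P%:P * rVpoly (b i)).
  rewrite -[u%:P](subrK (S * U)) mulrDl; apply: in_idealD.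
    by rewrite mulrC; apply: in_idealM.
  by rewrite -mulrA mulrCA; apply: in_idealM.
have [Q [W' [WE szW']]] := mod_F W.
pose V' := V + Q * G.
have VW' : u%:P * \sum_i (a i)%:P%:P * rVpoly (b i) = V' * F + W' * G.
  by rewrite VW WE /V'; ring.
have szV' : (size V' <= d2)%N.
  have szL : (size (V' * F)%R <= d1 + d2)%N.
    have -> : V' * F = rVpoly (u *: \sum_i (a i)%:P *: b i) - W' * G.
      by rewrite rVpoly_sum VW' addrK.
    rewrite (leq_trans (size_polyD _ _)) // geq_max size_poly size_polyN.
    rewrite (leq_trans (size_polyMleq _ _)) //.
    by move: (size W') (size G) szW' szG => x y; lia.
  have [->|V0] := eqVneq V' 0; first by rewrite size_poly0.
  have F0 : F != 0 by rewrite -size_poly_gt0 szF.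
  move: szL; rewrite size_mul // szF; move: (size V') => x; lia.
apply: (bP.2 a u (row_mx (poly_rV W') (poly_rV V'))) => //.
apply: (can_inj (@rVpolyK _ _)).
by rewrite mul_sylvester // row_mxKl row_mxKr !poly_rV_K // rVpoly_sum VW' addrC.
Qed.
End LocalAlgebra.

Section BasisCard.
Variables (K E : fieldType) (kappa : {rmorphism K -> E}) (Loc J : E -> Prop).
Hypotheses (J0 : J 0) (JD : forall x y, J x -> J y -> J (x + y)).
Hypothesis JZ : forall c x, J x -> J (kappa c * x).

Definition quotient_basis r (b : 'I_r -> E) : Prop :=
  (forall i, Loc (b i)) /\ (forall h, Loc h ->
    exists! c : {ffun 'I_r -> K}, J (h - \sum_i kappa (c i) * b i)).

(** If r > r', the coordinates of the [b i] with respect to b' satisfy a linear relation, and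
    subtracting it gives some [b j] a second representation. *)
Lemma quotient_basis_leq r r' (b : 'I_r -> E) (b' : 'I_r' -> E) :
  quotient_basis b -> quotient_basis b' -> (r <= r')%N.
Proof.
move=> [Lb bU] [Lb' b'U]; rewrite leqNgt; apply/negP => ltr.
have [c cP] := choice (fun i => b'U (b i) (Lb i)).
pose M : 'M[K]_(r, r') := \matrix_(i, j) c i j.
have kM : kermx M != 0.
  by rewrite -mxrank_eq0 mxrank_ker subn_eq0 -ltnNge (leq_ltn_trans (rank_leq_col M)).
have [i0 vi0] : exists i, row i (kermx M) != 0.
  apply: contrapT => /forallNP nv; case/eqP: kM; apply/row_matrixP => i.
  by rewrite row0; apply/eqP/negPn/negP/nv.
set v := row i0 _ in vi0; have vM : v *m M = 0 by apply/sub_kermxP/row_sub.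
have Jv : J (\sum_i kappa (v 0 i) * b i).
  have -> : \sum_i kappa (v 0 i) * b i =
      \sum_i kappa (v 0 i) * (b i - \sum_j kappa (c i j) * b' j).
    apply/esym; under eq_bigr => i _ do rewrite mulrBr.
    rewrite sumrB [X in _ - X](_ : _ = 0) ?subr0 //.
    under eq_bigr => i _ do rewrite mulr_sumr.
    rewrite exchange_big big1 //= => j _.
    have : kappa ((v *m M) 0 j) * b' j = 0 by rewrite vM mxE rmorph0 mul0r.
    move=> E0; rewrite -[RHS]E0 mxE rmorph_sum mulr_suml; apply: eq_bigr => i _.
    by rewrite [M _ _]mxE rmorphM mulrA.
  by elim/big_ind: _ => // i _; apply: JZ; case: (cP i).
have [j vj] : exists j, v 0 j != 0.
  by apply/rV0Pn.
have [d [_ dU]] := bU (b j) (Lb j).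
pose d1 : {ffun 'I_r -> K} := [ffun i => (i == j)%:R].
pose d2 : {ffun 'I_r -> K} := [ffun i => (i == j)%:R - v 0 i].
have sd1 : \sum_i kappa (d1 i) * b i = b j.
  rewrite (bigD1 j) //= ffunE eqxx rmorph1 mul1r big1 ?addr0 // => i ij.
  by rewrite ffunE (negPf ij) rmorph0 mul0r.
have d1E : d = d1 by apply: dU; rewrite sd1 subrr.
have d2E : d = d2.
  apply: dU; have -> : \sum_i kappa (d2 i) * b i = b j - \sum_i kappa (v 0 i) * b i.
    rewrite -sd1 -sumrB; apply: eq_bigr => i _; by rewrite !ffunE rmorphB mulrBl.
  by rewrite opprB addrC subrK.
have := congr1 (fun x : {ffun 'I_r -> K} => x j) (etrans (esym d1E) d2E).
rewrite !ffunE eqxx => /esym/eqP; rewrite subr_eq addrC -subr_eq subrr eq_sym.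
by rewrite (negPf vj).
Qed.
End BasisCard.

Section LocalIdeal.
Variables (K : fieldType) (P : proj_point K).
Local Notation tof := (@FracField.tofrac {mpoly K[3]}).

Lemma tofrac_neq0 (s : {mpoly K[3]}) : s != 0 -> tof s != 0.
Proof. by rewrite tofrac_eq0. Qed.

Lemma eval_neq0 (s : {mpoly K[3]}) x : s.@[x] != 0 -> s != 0.
Proof. by apply: contraNneq => ->; rewrite meval0. Qed.

Lemma local_idealD f h h' : local_ideal P f h -> local_ideal P f h' ->
  local_ideal P f (h + h').
Proof.
move=> [a [s [d [ah sh sP ->]]]] [a' [s' [d' [ah' sh' sP' ->]]]].
exists (a * s' + a' * s), (s * s'), (d + d')%N; split.
- by rewrite mulrDr !mulrA; apply: rpredD; [|rewrite addnC]; apply: dhomogM.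
- exact: dhomogM.
- by rewrite mevalM mulf_neq0.
have s0 := tofrac_neq0 (eval_neq0 sP); have s'0 := tofrac_neq0 (eval_neq0 sP').
rewrite /frac_form mulrDr !mulrA (tofracD (f * a * s')) (tofracM (f * a)) (tofracM (f * a')).
by rewrite (tofracM s) (addf_div _ _ s0 s'0).
Qed.

Lemma local_idealZ f c h : local_ideal P f h -> local_ideal P f (tof c%:MP * h).
Proof.
move=> [a [s [d [ah sh sP ->]]]]; exists (c%:MP * a), s, d; split=> //.
  by rewrite mulrCA mul_mpolyC; apply: rpredZ.
by rewrite /frac_form mulrA -tofracM mulrCA.
Qed.

Lemma local_idealB f h h' : local_ideal P f h -> local_ideal P f h' ->
  local_ideal P f (h - h').
Proof.
move=> H /(local_idealZ (-1)); rewrite mpolyCN tofracN mpolyC1 tofrac1 mulN1r.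
exact: local_idealD.
Qed.

Lemma local_ideal0 f : local_ideal P f 0.
Proof.
exists 0, 1, 0%N; split; rewrite ?mulr0 ?meval1 ?oner_eq0 ?dhomog0 ?dhomog1 //.
by rewrite /frac_form tofrac0 mul0r.
Qed.

Definition sum_ideal f g h : Prop := exists h1 h2,
  [/\ local_ideal P f h1, local_ideal P g h2 & h = h1 + h2].

Definition tofracC : {rmorphism K -> {fraction {mpoly K[3]}}} := tof \o @mpolyC 3 K.

Lemma local_quotient_dimE f g r : local_quotient_dim P f g r <->
  exists b : 'I_r -> _, quotient_basis tofracC (local_ring P) (sum_ideal f g) b.
Proof.
have eqv r' (b : 'I_r' -> _) (c : {ffun 'I_r' -> K}) h :
   (exists h1 h2, [/\ local_ideal P f h1, local_ideal P g h2 &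
            h = \sum_i tof (c i)%:MP * b i + (h1 + h2)]) <->
   sum_ideal f g (h - \sum_i tofracC (c i) * b i).
  split=> -[h1 [h2 [H1 H2 E]]]; exists h1, h2; split=> //.
    by rewrite E addrAC subrr add0r.
  by rewrite -E addrC subrK.
split=> -[b [Lb bU]]; exists b; split=> // h Lh.
  by have [c [cP cU]] := bU h Lh; exists c; split=> [|c' c'P]; [exact/eqv|exact/cU/eqv].
by have [c [cP cU]] := bU h Lh; exists c; split=> [|c' c'P]; [exact/eqv|exact/cU/eqv].
Qed.

Lemma local_quotient_dim_uniq f g r r' :
  local_quotient_dim P f g r -> local_quotient_dim P f g r' -> r = r'.
Proof.
move=> /local_quotient_dimE[b bP] /local_quotient_dimE[b' bP'].
have J0 : sum_ideal f g 0.
  by exists 0, 0; split; [exact: local_ideal0|exact: local_ideal0|rewrite addr0].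
have JD x y : sum_ideal f g x -> sum_ideal f g y -> sum_ideal f g (x + y).
  move=> [h1 [h2 [H1 H2 ->]]] [h1' [h2' [H1' H2' ->]]]; exists (h1 + h1'), (h2 + h2').
  by split; [exact: local_idealD|exact: local_idealD|rewrite addrACA].
have JZ c x : sum_ideal f g x -> sum_ideal f g (tofracC c * x).
  move=> [h1 [h2 [H1 H2 ->]]]; exists (tofracC c * h1), (tofracC c * h2).
  by split; [exact: local_idealZ|exact: local_idealZ|rewrite mulrDr].
have le r1 r2 b1 b2 := @quotient_basis_leq _ _ _ (local_ring P) _ J0 JD JZ r1 r2 b1 b2.
by apply/eqP; rewrite eqn_leq (le _ _ _ _ bP bP') (le _ _ _ _ bP' bP).
Qed.

Lemma intersection_multE f g r : local_quotient_dim P f g r -> intersection_mult f g P = r.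
Proof.
move=> fr; rewrite /intersection_mult; case: xgetP => [r' _ fr'|/(_ r)//].
exact: local_quotient_dim_uniq fr' fr.
Qed.

Lemma local_quotient_dimC f g r : local_quotient_dim P f g r -> local_quotient_dim P g f r.
Proof.
have eqv r' (b : 'I_r' -> _) (c : {ffun 'I_r' -> K}) h f' g' :
   (exists h1 h2, [/\ local_ideal P f' h1, local_ideal P g' h2 &
            h = \sum_i tof (c i)%:MP * b i + (h1 + h2)]) ->
   (exists h1 h2, [/\ local_ideal P g' h1, local_ideal P f' h2 &
            h = \sum_i tof (c i)%:MP * b i + (h1 + h2)]).
  by move=> [h1 [h2 [H1 H2 ->]]]; exists h2, h1; split=> //; rewrite (addrC h1).
move=> [b [Lb bU]]; exists b; split=> // h Lh.
by have [c [cP cU]] := bU h Lh; exists c; split=> [|c' c'P]; [exact/eqv|exact/cU/eqv].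
Qed.

Lemma intersection_multC f g : intersection_mult f g P = intersection_mult g f P.
Proof.
rewrite /intersection_mult; congr (xget _ _); apply/funext => r /=; apply/propext.
by split; apply: local_quotient_dimC.
Qed.
End LocalIdeal.

Section LinearForms.
Variable K : fieldType.
Implicit Types v x y : 'I_3 -> K.

Lemma lform_neq0 v i : v i != 0 -> lform v != 0.
Proof.
move=> vi; apply: (@eval_neq0 _ _ (fun j => (j == i)%:R)); rewrite lform_eval /dot3.
by move: vi; case: (ord3P i) => ->; rewrite /= ?mulr0 ?mulr1 ?addr0 ?add0r.
Qed.

Lemma lform_prime v i : v i != 0 -> prime_elt (lform v).
Proof.
move=> /lform_neq0 v0; apply/irreducible_prime/msize2_irreducible.
have := homog_msize_pred (lform_homog v) v0; have : msize (lform v) != 0%N by rewrite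
  msize_poly_eq0.
by case: (msize _) => // n _ /= ->.
Qed.

Lemma dot3_join x y : dot3 y (join_line x y) = 0.
Proof. by rewrite /dot3 !join_lineE; ring. Qed.

Definition vec3 (a b c : K) : 'I_3 -> K := fun i => [:: a; b; c]`_i.

Lemma join_line_onto v i y : v i != 0 -> dot3 v y = 0 -> exists x, y = join_line x v.
Proof.
have eq3 (x z : 'I_3 -> K) : x 0 = z 0 -> x 1 = z 1 -> x 2%:R = z 2%:R -> x = z.
  by move=> ? ? ?; apply/funext=> j; case: (ord3P j) => ->.
have solve (a z w : K) : a != 0 -> a * z + w = 0 -> z = - w / a.
  by move=> a0 /eqP; rewrite addr_eq0 => /eqP <-; rewrite mulrC mulKf.
rewrite /dot3 => vi vy.
case: (ord3P i) vi => -> v0.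
- rewrite -addrA in vy.
  exists (vec3 0 (- y 2%:R / v 0) (y 1 / v 0)); apply: eq3; rewrite join_lineE /vec3 /=.
  + by rewrite (solve _ _ _ v0 vy); field.
  + by field.
  + by field.
- rewrite -addrA addrCA in vy.
  exists (vec3 (y 2%:R / v 1) 0 (- y 0 / v 1)); apply: eq3; rewrite join_lineE /vec3 /=.
  + by field.
  + by rewrite (solve _ _ _ v0 vy); field.
  + by field.
- rewrite addrC in vy.
  exists (vec3 (- y 1 / v 2%:R) (y 0 / v 2%:R) 0); apply: eq3; rewrite join_lineE /vec3 /=.
  + by field.
  + by field.
  + by rewrite (solve _ _ _ v0 vy); field.
Qed.
Lemma orthogonal_exists (l : 'I_3 -> K) : exists v i, v i != 0 /\ dot3 v l = 0.
Proof.
have [l0|l0] := eqVneq (l 0) 0.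
  exists (vec3 1 0 0), 0; rewrite /vec3 /= oner_eq0 /dot3 /=; split=> //.
  by rewrite l0; ring.
exists (vec3 (l 1) (- l 0) 0), 1; rewrite /vec3 /= oppr_eq0 /dot3 /=; split=> //.
by ring.
Qed.
End LinearForms.

(** On a line where the resultant of [Q] and [S] is nonzero and [Q] keeps its degree, [Q] has a
    root, and [S] cannot vanish there. *)
Lemma homog_zero_point (K : closedFieldType) (Q S : {mpoly K[3]}) d1 d2 : infinite_ring K ->
  prime_elt Q -> Q \is d1.-homog -> S \is d2.-homog -> ~ divides Q S ->
  exists x, Q.@[x] = 0 /\ S.@[x] != 0.
Proof.
move=> Kinf Qp Qh Sh nQS; have [p [q [Qpn r0]]] := exists_line_res_neq0 Kinf Qh Sh Qp nQS.
have Q0 : Q != 0 by case: Qp.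
have d1_gt0 : (0 < d1)%N.
  by have := prime_msize Qp; rewrite -(homog_msize_pred Qh Q0); case: (msize Q) => [|[|s]].
have szQ : size (restrict_line Q p q) = d1.+1.
  apply/eqP; rewrite eqn_leq size_restrict_line //= ltnNge; apply: contraNN Qpn => sz.
  by rewrite -(coef_restrict_line p q Qh) nth_default.
have /closed_rootP[x /rootP xr] : size (restrict_line Q p q) != 1%N.
  by rewrite szQ eqSS -lt0n.
exists (fun i => p i * x + q i); split; first by rewrite -horner_restrict_line.
rewrite -horner_restrict_line; apply: contraNneq r0 => Sx.
by rewrite (res_common_root _ _ _ xr Sx) ?size_restrict_line // addn_gt0 d1_gt0.
Qed.

Lemma pt_coord_neq0 (K : fieldType) (P : proj_point K) : exists i, pt_coord P i = 1.
Proof.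
by case: P => v vn; have /existsP[i /andP[/eqP vi _]] := vn; exists i.
Qed.

Lemma frac_split (E : fieldType) (x y z t w : E) : y != 0 -> t != 0 -> z != 0 ->
  x / y = w / t + z * (x * t - y * w) / (z * (y * t)).
Proof. by move=> y0 t0 z0; field; rewrite y0 t0 z0. Qed.

Section LocalBasis.
Variables (K : closedFieldType) (Kinf : infinite_ring K) (P : proj_point K).
Variables (P' q : 'I_3 -> K) (d1 d2 e : nat) (f g : {mpoly K[3]}).
Local Notation P_ := (pt_coord P).
Hypothesis det0 : dot3 P_ (join_line P' q) != 0.
Hypotheses (fh : f \is d1.-homog) (gh : g \is d2.-homog).
Local Notation ch := (chart P_ P' q).
Local Notation L := (coordL P_ P' q).
Local Notation tof := (@FracField.tofrac {mpoly K[3]}).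
Variable b : 'I_e -> {poly {poly K}}.
Hypothesis b_span : forall H S : {poly {poly K}}, S.[0].[0] != 0 ->
  exists (a : 'I_e -> K) (s : {poly K}), s.[0] != 0 /\
    in_ideal (ch f) (ch g) (s%:P * (H - S * \sum_i (a i)%:P%:P * b i)).
Hypothesis b_free : forall (S : {poly {poly K}}) (a : 'I_e -> K), S.[0].[0] != 0 ->
  in_ideal (ch f) (ch g) (S * \sum_i (a i)%:P%:P * b i) -> forall i, a i = 0.

Lemma chart_base a : (ch a).[0].[0] = a.@[P_].
Proof.
rewrite -[0 in X in X.[_]]polyC0 chart_eval.
by apply: meval_eq => i; rewrite !mulr0 !addr0.
Qed.

Lemma chart_sum (x : 'I_e -> K) (a : 'I_e -> {mpoly K[3]}) :
  ch (\sum_i x i *: a i) = \sum_i (x i)%:P%:P * ch (a i).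
Proof.
rewrite (big_morph ch (@chartD _ P_ P' q) (_ : _ = 0)).
  by apply: eq_bigr => i _; rewrite chartZ.
by rewrite -mpolyC0 chartC !polyC0.
Qed.

Lemma chart_comb x y : ch (f * x + g * y) = ch x * ch f + ch y * ch g.
Proof.
rewrite (chartD _ _ _ (f * x)).
by congr (_ + _); rewrite (chartM _ _ _ _ _); exact: mulrC.
Qed.

Lemma common_homogenize : exists N (a : 'I_e -> {mpoly K[3]}),
  forall i, a i \is N.-homog /\ ch (a i) = b i.
Proof.
have [N NP] := choice (fun i => homogenize_le det0 (b i)).
have [a aP] := choice (fun i => NP i _ (leq_bigmax i)).
by exists (\max_i N i), a.
Qed.

Lemma tofrac_sum (x : 'I_e -> K) (a : 'I_e -> {mpoly K[3]}) y :
  \sum_i tof (x i)%:MP * (tof (a i) / y) = tof (\sum_i x i *: a i) / y.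
Proof.
rewrite (big_morph tof (@tofracD _) (@tofrac0 _)) mulr_suml; apply: eq_bigr => i _.
by rewrite -mul_mpolyC (tofracM (x i)%:MP) mulrA.
Qed.

(** Fractions of forms of equal degree correspond to fractions in the chart. The basis elements get
    the common denominator L^N, and identities in the chart become identities of forms once all
    terms are padded to one degree. *)
Lemma local_basis_dim : local_quotient_dim P f g e.
Proof.
have [N [a aP]] := common_homogenize.
have ah i := (aP i).1; have ab i := (aP i).2.
have Lh k : L ^+ k \is k.-homog.
  by rewrite -[k in k.-homog]mul1n; apply/dhomogMn/lform_homog.
have LP k : (L ^+ k).@[P_] = 1 by rewrite rmorphXn /= (coordL_base det0) expr1n.
have LPn k : (L ^+ k).@[P_] != 0 by rewrite LP oner_eq0.
have sumh (x : 'I_e -> K) : \sum_i x i *: a i \is N.-homog.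
  by apply: rpred_sum => i _; apply: rpredZ.
have chs x : ch (\sum_i x i *: a i) = \sum_i (x i)%:P%:P * b i.
  by rewrite chart_sum; apply: eq_bigr => i _; rewrite ab.
exists (fun i => frac_form (a i) (L ^+ N)); split=> [i|h [s1 [s2 [d [s1h s2h s2P hE]]]]].
  by exists (a i), (L ^+ N), N.
have s20 := tofrac_neq0 (eval_neq0 s2P); have LN0 := tofrac_neq0 (eval_neq0 (LPn N)).
have [|c [s [s0 [V [W VW]]]]] := b_span (ch s1) (S := ch s2); first by rewrite chart_base.
pose c1 := [ffun i => c i].
suff [h1 [h2 [H1 H2 E]]] : exists h1 h2, [/\ local_ideal P f h1, local_ideal P g h2 &
    h = \sum_i tof (c1 i)%:MP * frac_form (a i) (L ^+ N) + (h1 + h2)].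
  exists c1; split; first by exists h1, h2.
  move=> c' [h1' [h2' [H1' H2' E']]]; pose dl i := c1 i - c' i.
  have sumd : tof (\sum_i dl i *: a i) / tof (L ^+ N) = (h1' - h1) + (h2' - h2).
    rewrite -tofrac_sum -addrACA -opprD -[h1' + h2'](addKr (\sum_i tof (c' i)%:MP * frac_form (a
      i) (L ^+ N))).
    rewrite -E' E addrA addrK addrC -sumrB; apply: eq_bigr => i _.
    by rewrite -mulrBl /dl mpolyCB tofracB.
  have [x [s' [dx [xh s'h s'P xE]]]] := local_idealB H1' H1.
  have [y [t' [dy [yh t'h t'P yE]]]] := local_idealB H2' H2.
  have s'0 := tofrac_neq0 (eval_neq0 s'P); have t'0 := tofrac_neq0 (eval_neq0 t'P).
  have st0 : tof (s' * t') != 0.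
    by apply/tofrac_neq0/mulf_neq0; [apply: eval_neq0 s'P|apply: eval_neq0 t'P].
  have Ed : (s' * t') * \sum_i dl i *: a i = (f * x * t' + g * y * s') * L ^+ N.
    apply/eqP; rewrite -tofrac_eq; apply/eqP; move: sumd.
    rewrite xE yE /frac_form (addf_div _ _ s'0 t'0) -!tofracM -tofracD => /eqP.
    rewrite (eqr_div _ _ LN0 st0) -!tofracM => /eqP E0.
    by rewrite [s' * t' * _]mulrC E0.
  have dl0 : forall i, dl i = 0.
    apply: (b_free (S := ch (s' * t'))).
      by rewrite chart_base mevalM mulf_neq0.
    exists (ch (x * t')), (ch (y * s')).
    rewrite -(chs dl) -chart_comb -[RHS](chart_pad det0 _ N) !mulrA -Ed.
    by rewrite (chartM _ _ _ (s' * t')).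
  by apply/ffunP=> i; apply/eqP; rewrite -subr_eq0; apply/eqP/dl0.
have [Ns sP] := homogenize_le det0 s%:P.
have [NV VP] := homogenize_le det0 V; have [NW WP] := homogenize_le det0 W.
(* [T] is the common degree of the terms below; [M] is large enough for [s], [V] and [W] to be
   homogenized in degrees M, T - d1 and T - d2. *)
pose M := (Ns + NV + NW + d1 + d2)%N; pose T := (M + (d + N))%N.
have [M1 M2 M3 M4 M5] : [/\ Ns <= M, NV <= T - d1, NW <= T - d2,
    T = d1 + (T - d1) & T = d2 + (T - d2)]%N by rewrite /T /M; clear; split; lia.
have [sg [sgh sgE]] := sP M M1; have [vg [vgh vgE]] := VP _ M2.
have [wg [wgh wgE]] := WP _ M3.
have fvh : f * vg \is T.-homog by rewrite M4; apply: dhomogM.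
have gwh : g * wg \is T.-homog by rewrite M5; apply: dhomogM.
have E : sg * (s1 * L ^+ N - s2 * \sum_i c i *: a i) = f * vg + g * wg.
  apply: (chart_homog_inj Kinf det0 (d := T)); last first.
  - rewrite (chartM _ _ _ sg) chartB (chart_pad det0) (chartM _ _ _ s2) chs sgE VW.
    by rewrite chart_comb vgE wgE.
  - by apply: rpredD.
  - by apply: dhomogM => //; apply: rpredB; apply: dhomogM.
have sgP : sg.@[P_] != 0 by rewrite -chart_base sgE hornerC.
have sg0 := tofrac_neq0 (eval_neq0 sgP).
pose den := sg * (s2 * L ^+ N).
have denh : den \is T.-homog by apply: dhomogM => //; apply: dhomogM.
have denP : den.@[P_] != 0 by rewrite !mevalM LP mulr1 mulf_neq0.
exists (frac_form (f * vg) den), (frac_form (g * wg) den); split.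
- by exists vg, den, T.
- by exists wg, den, T.
under eq_bigr => i _ do rewrite ffunE.
rewrite /frac_form tofrac_sum -mulrDl -tofracD -E hE /frac_form /den.
rewrite (tofracM sg) (tofracM sg) (tofracM s2) tofracB (tofracM s1) (tofracM s2).
by rewrite -(frac_split (tof s1) (tof (\sum_i c i *: a i)) s20 LN0 sg0).
Qed.
End LocalBasis.

Section LineResultant.
Variables (K : closedFieldType) (Kinf : infinite_ring K) (P : proj_point K).
Variables (d1 d2 : nat) (f g : {mpoly K[3]}).
Hypotheses (fh : f \is d1.-homog) (gh : g \is d2.-homog).
Hypotheses (f0 : f != 0) (g0 : g != 0) (D0 : line_res f g != 0).

Lemma mmap_lform (R : comNzRingType) (iota : {rmorphism K -> R}) (v : 'I_3 -> K) (l : 'I_3 -> R) :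
  mmap iota l (lform v) = iota (v 0) * l 0 + iota (v 1) * l 1 + iota (v 2%:R) * l 2%:R.
Proof.
rewrite /lform !big_ord_recl big_ord0 addr0 !mmapD !mmapZ !mmapX !mmap1U addrA.
by congr (iota (v _) * l _ + iota (v _) * l _ + iota (v _) * l _); apply: val_inj.
Qed.

(** Otherwise some line through [v] would not be a zero of the resultant, although both restrictions
    vanish at the point [v] of that line. *)
Lemma lform_divides_line_res (v : 'I_3 -> K) i : v i != 0 -> (0 < d1 + d2)%N ->
  f.@[v] = 0 -> g.@[v] = 0 -> divides (lform v) (line_res f g).
Proof.
move=> vi d_gt0 fv gv; apply: contrapT => nd.
have [Dh _] := line_resP fh gh f0 g0.
have [x [Lx Dx]] := homog_zero_point Kinf (lform_prime vi) (lform_homog v) Dh nd.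
have [y xE] := join_line_onto vi (etrans (esym (lform_eval v x)) Lx).
case/eqP: Dx; rewrite xE (line_res_eval _ _ fh gh f0 g0).
have ev h : (restrict_line h y v).[0] = h.@[v].
  by rewrite horner_restrict_line; apply: meval_eq => j; rewrite mulr0 add0r.
by apply: (@res_common_root _ _ _ _ _ 0); rewrite ?size_restrict_line // ev.
Qed.

Lemma intersection_mult_line_res : f.@[pt_coord P] = 0 -> g.@[pt_coord P] = 0 ->
  intersection_mult f g P = mult_along (lform (pt_coord P)) (line_res f g).
Proof.
move=> fP gP; have [i1 vi1] := pt_coord_neq0 P; set v := pt_coord P in vi1 *.
have vi0 : v i1 != 0 by rewrite vi1 oner_eq0.
have Lp := lform_prime vi0; have [Dh DE] := line_resP fh gh f0 g0.
have [D' DD' nD'] := mult_along_split Lp D0; set e := mult_along _ _ in DD' *.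
have D'h : D' \is homog mdeg.
  by apply: (@homog_factor _ _ (d1 * d2)%N _ (lform v ^+ e)); rewrite mulrC -DD'.
have [l0 [Ll0 D'l0]] := homog_zero_point Kinf Lp (lform_homog v) D'h nD'.
have [y0 l0E] := join_line_onto vi0 (etrans (esym (lform_eval v l0)) Ll0).
(* The value of D' at the line through y and P, as a polynomial in y. It is nonzero, so a general
   [q] spans with P a line that is not a zero of D'. *)
pose E : {mpoly K[3]} := mmap (@mpolyC 3 K) (join_line (fun i => 'X_i) (fun i => (v i)%:MP)) D'.
have EE y : E.@[y] = D'.@[join_line y v].
  rewrite /E -[LHS]/(meval y _) (mmap_comp (meval y)); congr (mmap _ _ _).
    by apply/funext => c /=; rewrite mevalC.
  by apply/funext => i /=; rewrite /join_line mevalB !mevalM !mevalC !mevalXU.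
have E0 : E != 0 by apply: (@eval_neq0 _ _ y0); rewrite EE -l0E.
have fgE0 : f * g * E != 0 by rewrite !mulf_neq0.
have [q] := mpoly_neq0_point Kinf fgE0.
rewrite !mevalM !mulf_eq0 !negb_or EE => /andP[/andP[fq gq] D'q].
have d1_gt0 : (0 < d1)%N.
  rewrite lt0n; apply: contraNneq fq => d10; have := fh; rewrite d10 => fh0.
  have fz z : f.@[z] = f.@[fun i => 0 * z i] by rewrite (meval_scale _ _ fh0) mul1r.
  rewrite -fP (fz q) (fz v); apply/eqP/meval_eq => i; by rewrite !mul0r.
have [i2 qv] : exists i, join_line q v i != 0.
  apply: contrapT => /forallNP nq; case/eqP: fq.
  have {}nq i : join_line q v i = 0 by apply/eqP/negPn/negP/nq.
  have sw a c : q a * v c = q c * v a.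
    have nq0 := nq 0; have nq1 := nq 1; have nq2 := nq 2%:R.
    move: nq0 nq1 nq2; rewrite !join_lineE => /eqP + /eqP + /eqP.
    rewrite !subr_eq0 => /eqP nq0 /eqP nq1 /eqP nq2.
    by case: (ord3P a) => ->; case: (ord3P c) => ->; rewrite ?nq0 ?nq1 ?nq2.
  have qE i : q i = q i1 * v i by rewrite sw vi1 mulr1.
  by rewrite (meval_eq _ qE) (meval_scale _ _ fh) fP mulr0.
pose P' : 'I_3 -> K := fun i => (i == i2)%:R.
have det0 : dot3 v (join_line P' q) != 0.
  have -> : dot3 v (join_line P' q) = dot3 P' (join_line q v).
    by rewrite /dot3 !join_lineE; ring.
  rewrite /dot3 /P'; move: qv; case: (ord3P i2) => ->; rewrite /= ?mul0r ?mul1r ?addr0 ?add0r //.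
pose det := dot3 v (join_line P' q); rewrite -/det in det0.
apply: intersection_multE.
pose F := chart v P' q f; pose G := chart v P' q g.
have mh d h : h \is d.-homog -> map_mpoly (@polyC K) h \is d.-homog by apply: map_mpoly_homog.
have Fd1 : F`_d1 = (f.@[q])%:P.
  rewrite coef_restrict_line; last exact: mh.
  by rewrite [LHS]mmap_map_mpoly [in RHS]/meval [RHS]mmap_comp.
have szF : size F = d1.+1.
  apply/eqP; rewrite eqn_leq size_restrict_line; last exact: mh.
  rewrite ltnNge; apply: contraNN fq => sz.
  by rewrite -polyC_eq0 -Fd1 nth_default.
have lF : lead_coef F = (f.@[q])%:P by rewrite lead_coefE szF.
have szG : (size G <= d2.+1)%N by apply: size_restrict_line; apply: mh.
(* The line r |-> P + e P' + r q over K[e]. The equation of the dual line of P takes the value - det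
   e at it, which produces the power of 'X. *)
pose l := join_line (fun i => (q i)%:P) (fun i => (v i)%:P + (P' i)%:P * 'X) : 'I_3 -> {poly K}.
pose u := ((- det) ^+ e)%:P * mmap (@polyC K) l D'.
have lM a b : mmap (@polyC K) l (a * b) = mmap (@polyC K) l a * mmap (@polyC K) l b.
  by rewrite rmorphM.
have resE : res d1 d2 F G = 'X^e * u.
  rewrite /F /G /chart -DE -/l DD' lM.
  have Le k : mmap (@polyC K) l (lform v ^+ k) = (mmap (@polyC K) l (lform v)) ^+ k.
    elim: k => [|k IHk]; first by rewrite !expr0 rmorph1.
    by rewrite !exprS lM IHk.
  have Ll : mmap (@polyC K) l (lform v) = (- det)%:P * 'X.
    rewrite mmap_lform /l /det /dot3 !join_lineE !(polyCN, polyCB, polyCD, polyCM); ring.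
  by rewrite Le Ll exprMn /u polyC_exp mulrCA mulrA.
have u0 : u.[0] != 0.
  rewrite /u hornerM hornerC mulf_neq0 ?expf_neq0 ?oppr_eq0 //.
  rewrite -/(horner_eval 0 _) (mmap_comp (horner_eval 0)).
  have -> : mmap (horner_eval 0 \o @polyC K) (horner_eval 0 \o l) D' = D'.@[join_line q v].
    congr (mmap _ _ _); first by apply/funext => c /=; rewrite /horner_eval hornerC.
    by apply/funext => i /=; rewrite /horner_eval /l /join_line !(hornerN, hornerD, hornerM,
      hornerC, hornerX) !mulr0 !addr0.
  by [].
(* Another common zero w on the line through P and q would make [lform w] a prime factor of
   [line_res f g]. It does not divide [lform v], so it would divide D', which does not vanish at
   this line. *)
have zeros r : F.[r%:P].[0] = 0 -> G.[r%:P].[0] = 0 -> r = 0.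
  pose w i := v i + q i * r.
  have ex h : (chart v P' q h).[r%:P].[0] = h.@[w].
    by rewrite chart_eval; apply: meval_eq => i; rewrite mulr0 addr0.
  move=> /(etrans (esym (ex f))) fw /(etrans (esym (ex g))) gw.
  apply/eqP; apply: contraT => r0.
  have wdet : dot3 w (join_line P' q) = det by rewrite /det /dot3 /w !join_lineE; ring.
  have [j wj] : exists j, w j != 0.
    apply: contrapT => /forallNP nw; case/eqP: det0; rewrite -wdet /dot3.
    by have {}nw i : w i = 0 by [apply/eqP/negPn/negP/nw]; rewrite !nw !mul0r !addr0.
  have wp := lform_prime wj.
  have d_gt0 : (0 < d1 + d2)%N by rewrite addn_gt0 d1_gt0.
  have := lform_divides_line_res wj d_gt0 fw gw; rewrite DD'.
  case: (wp) => _ _ wM /wM[/(prime_divides_exp wp)|] [h hE].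
    have := congr1 (meval (join_line P' w)) hE; rewrite /= mevalM !lform_eval dot3_join mulr0.
    have -> : dot3 v (join_line P' w) = r * det by rewrite /det /dot3 /w !join_lineE; ring.
    by move/eqP; rewrite mulf_eq0 (negPf r0) (negPf det0).
  by move: D'q; rewrite hE mevalM lform_eval; have -> : dot3 w (join_line q v) = 0
    by [rewrite /dot3 /w !join_lineE; ring]; rewrite mulr0 eqxx.
have d_gt0 : (0 < d1 + d2)%N by rewrite addn_gt0 d1_gt0.
have [b bP] := coker_basis_exists (e := e) resE u0.
apply: (local_basis_dim Kinf det0 fh gh (b := fun i => rVpoly (b i))) => [H S S0|S a S0].
  exact: (local_basis_span fq szF lF szG d_gt0 resE u0 zeros bP).
exact: (local_basis_free fq szF lF szG d_gt0 resE u0 zeros bP).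
Qed.
End LineResultant.

(** * The multiplicities of a line resultant *)

Lemma res0_common_root (K : closedFieldType) d1 d2 (p q : {poly K}) :
  size p = d1.+1 -> (size q <= d2.+1)%N -> res d1 d2 p q = 0 ->
  exists x, p.[x] = 0 /\ q.[x] = 0.
Proof.
move=> szp szq /eqP/det0P[z z0 zS]; have szp' : (size p <= d1.+1)%N by rewrite szp.
have p0 : p != 0 by rewrite -size_poly_gt0 szp.
have := mul_sylvester z szp' szq; rewrite zS linear0 => E.
have [cop|ncop] := boolP (coprimep p q); last first.
  move: ncop; rewrite coprimep_def => /closed_rootP[x].
  by rewrite root_gcd => /andP[/rootP px /rootP qx]; exists x.
have pa : p %| rVpoly (lsubmx z) * q.
  have -> : rVpoly (lsubmx z) * q = - (rVpoly (rsubmx z) * p).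
    by apply/eqP; rewrite -addr_eq0 -E.
  by rewrite dvdpNr dvdp_mull.
rewrite Gauss_dvdpl // in pa.
have a0 : rVpoly (lsubmx z) = 0.
  by apply: contraTeq pa => a0; rewrite gtNdvdp // szp ltnS size_poly.
have b0 : rVpoly (rsubmx z) = 0.
  by move/esym/eqP: E; rewrite a0 mul0r add0r mulf_eq0 (negPf p0) orbF => /eqP.
case/eqP: z0; rewrite -[z]hsubmxK -[lsubmx z]rVpolyK a0 -[rsubmx z]rVpolyK b0.
by rewrite !linear0 row_mx0.
Qed.

Section ProjPoints.
Variable K : fieldType.
Implicit Type v : 'I_3 -> K.

Lemma proj_point_exists v i : v i != 0 ->
  exists (P : proj_point K) c, c != 0 /\ forall j, v j = c * pt_coord P j.
Proof.
move=> vi; have ex : exists n : nat, [exists j : 'I_3, (j == n :> nat) && (v j != 0)].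
  by exists i; apply/existsP; exists i; rewrite eqxx.
case: (ex_minnP ex) => n /existsP[j /andP[/eqP jn vj]] nmin.
pose w : 'rV[K]_3 := \row_l (v l / v j).
have wn : normalized w.
  apply/existsP; exists j; rewrite mxE divff // eqxx /=; apply/forallP => l; apply/implyP => lj.
  rewrite mxE mulf_eq0 invr_eq0 (negPf vj) orbF; apply: contraTT lj => vl.
  by rewrite -leqNgt jn nmin //; apply/existsP; exists l; rewrite eqxx.
by exists (exist _ w wn), (v j); split=> // l; rewrite /pt_coord /= mxE mulrC divfK.
Qed.

Lemma proj_point_eq (P Q : proj_point K) :
  (forall i j, pt_coord P i * pt_coord Q j = pt_coord P j * pt_coord Q i) -> P = Q.
Proof.
move=> PQ; have lead (P' : proj_point K) : exists i, pt_coord P' i = 1 /\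
    forall j : 'I_3, (j < i)%N -> pt_coord P' j = 0.
  case: P' => v vn; have /existsP[i /andP[/eqP vi vj]] := vn; exists i; split=> // j ji.
  by apply/eqP; apply: (implyP (forallP vj j)).
have [i [Pi Pl]] := lead P; have [j [Qj Ql]] := lead Q.
have ij : i = j.
  case: (ltngtP i j) => [lt|lt|]; last exact: ord_inj.
    by move: (PQ i j); rewrite Pi Qj (Ql _ lt) mulr0 mulr1 => /eqP; rewrite oner_eq0.
  by move: (PQ i j); rewrite Pi Qj (Pl _ lt) mul0r mulr1 => /eqP; rewrite oner_eq0.
apply: val_inj; apply/rowP=> l; move: (PQ i l); rewrite Pi ij Qj mul1r mulr1.
by move=> E; exact: esym E.
Qed.

Lemma dual_lineE (P : proj_point K) Q : dual_line P Q = mult_along Q (lform (pt_coord P)).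
Proof. by []. Qed.

Lemma lform_divides_inj (Q : {mpoly K[3]}) (P P' : proj_point K) : prime_elt Q ->
  divides Q (lform (pt_coord P)) -> divides Q (lform (pt_coord P')) -> P = P'.
Proof.
have prP (P0 : proj_point K) : prime_elt (lform (pt_coord P0)).
  by have [i vi] := pt_coord_neq0 P0; apply: (@lform_prime _ _ i); rewrite vi oner_eq0.
move=> Qp QP QP'; have [u uU uE] := prime_divides_prime Qp (prP P) QP.
have [u' u'U u'E] := prime_divides_prime Qp (prP P') QP'.
have [h hE] : divides (lform (pt_coord P)) (lform (pt_coord P')).
  by exists (u' / u); rewrite uE u'E mulrA divrK.
apply: proj_point_eq => i j; apply/eqP; rewrite -subr_eq0.
move: (pt_coord P) (pt_coord P') hE => v w hE.
have z y : dot3 w (join_line y v) = 0 by rewrite -lform_eval hE mevalM lform_eval dot3_join mulr0.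
have jz a : join_line v w a = 0.
  have := z (fun b => (b == a)%:R); rewrite /dot3 !join_lineE.
  by case: (ord3P a) => -> /=; rewrite !join_lineE => <-; ring.
have jz0 := jz 0; have jz1 := jz 1; have jz2 := jz 2%:R.
move: jz0 jz1 jz2; rewrite !join_lineE => jz0 jz1 jz2.
case: (ord3P i) => ->; case: (ord3P j) => ->; rewrite ?subrr ?jz0 ?jz1 ?jz2 //.
- by rewrite -oppr_eq0 opprB jz1.
- by rewrite -oppr_eq0 opprB jz2.
- by rewrite -oppr_eq0 opprB jz0.
Qed.
End ProjPoints.

Lemma prime_divisor_homog (K : fieldType) (Q : prime_divisor K) :
  exists d, (Q : {mpoly K[3]}) \is d.-homog.
Proof. by case: Q => Q Qi Qh /=; exists (msize Q).-1. Qed.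

Section GlobalMultiplicity.
Variables (K : closedFieldType) (Kinf : infinite_ring K) (d1 d2 : nat) (f g : {mpoly K[3]}).
Hypotheses (fh : f \is d1.-homog) (gh : g \is d2.-homog).
Hypotheses (fp : prime_elt f) (nfg : ~ divides f g).
Local Notation D := (line_res f g).

Let f0 : f != 0. Proof. by case: fp. Qed.
Let g0 : g != 0. Proof. by apply: contra_notN nfg => /eqP->; apply: divides0. Qed.
Let D0 : D != 0. Proof. exact: line_res_neq0 fh gh fp nfg. Qed.

Let d1_gt0 : (0 < d1)%N.
Proof. by have := prime_msize fp; rewrite -(homog_msize_pred fh f0); case: (msize f) => [|[|s]].
  Qed.

Definition common_zero (P : proj_point K) := f.@[pt_coord P] = 0 /\ g.@[pt_coord P] = 0.

Lemma common_zero_exists (w : 'I_3 -> K) i l : w i != 0 -> dot3 w l = 0 ->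
  f.@[w] = 0 -> g.@[w] = 0 -> exists P, common_zero P /\ (lform (pt_coord P)).@[l] = 0.
Proof.
move=> wi wl fw gw; have [P [c [c0 wE]]] := proj_point_exists wi; exists P.
have van d h : h \is d.-homog -> h.@[w] = 0 -> h.@[pt_coord P] = 0.
  move=> hh; rewrite (meval_eq _ wE) (meval_scale _ _ hh) => /eqP.
  by rewrite mulf_eq0 expf_eq0 (negPf c0) andbF => /eqP.
split; first by split; [apply: van fh fw|apply: van gh gw].
rewrite lform_eval; apply: (mulfI c0); rewrite mulr0 -wl /dot3 !wE; ring.
Qed.

(** A vanishing resultant with formal degrees means a common root, or that both restrictions lose
    degree. In the latter case the point [x], the root at infinity, is a common zero. *)
Lemma line_res_common_zero l i : l i != 0 -> D.@[l] = 0 ->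
  exists P, common_zero P /\ (lform (pt_coord P)).@[l] = 0.
Proof.
move=> li Dl; have [v [j [vj vl]]] := orthogonal_exists l.
have [x lE] := join_line_onto vj vl; subst l.
have nz w : join_line w v = join_line x v -> exists k, w k != 0.
  move=> wx; apply: contrapT => /forallNP nw; case/eqP: li; rewrite -wx /join_line.
  have {}nw k : w k = 0 by apply/eqP/negPn/negP/nw.
  by rewrite !nw !mul0r subr0.
have [k xk] := nz x erefl.
have nz' r : exists k, (fun a => x a * r + v a) k != 0.
  apply: contrapT => /forallNP nw; case/eqP: li.
  have {}nw a : x a * r + v a = 0 by apply/eqP/negPn/negP/nw.
  have vE a : v a = - (x a * r) by apply/eqP; rewrite -addr_eq0 addrC nw.
  by rewrite /join_line !vE; ring.
have dw r : dot3 (fun a => x a * r + v a) (join_line x v) = 0.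
  by rewrite /dot3 !join_lineE; ring.
have root r : (restrict_line f x v).[r] = 0 -> (restrict_line g x v).[r] = 0 ->
    exists P, common_zero P /\ (lform (pt_coord P)).@[join_line x v] = 0.
  rewrite !horner_restrict_line => fr gr; have [a wa] := nz' r.
  exact: (common_zero_exists wa (dw r) fr gr).
have full d h : h \is d.-homog -> h.@[x] != 0 -> size (restrict_line h x v) = d.+1.
  move=> hh hx; apply/eqP; rewrite eqn_leq size_restrict_line //= ltnNge.
  by apply: contraNN hx => sz; rewrite -(coef_restrict_line x v hh) nth_default.
rewrite (line_res_eval _ _ fh gh f0 g0) in Dl.
have [fx|fx] := eqVneq f.@[x] 0; last first.
  have [r [fr gr]] := res0_common_root (full _ _ fh fx) (size_restrict_line x v gh) Dl.
  exact: root fr gr.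
have [gx|gx] := eqVneq g.@[x] 0.
  by apply: (common_zero_exists xk) => //; rewrite /dot3 !join_lineE; ring.
have [b sw] := res_swap d1 d2; rewrite sw in Dl.
move/eqP: Dl; rewrite mulf_eq0 signr_eq0 /= => /eqP Dl.
have [r [gr fr]] := res0_common_root (full _ _ gh gx) (size_restrict_line x v fh) Dl.
exact: root fr gr.
Qed.

(** The degree of [R] bounds the number of linear factors taken out, and so the length of the list
    [s]. *)
Lemma common_zero_factors (R : {mpoly K[3]}) : R != 0 -> exists (s : seq (proj_point K)) R',
  [/\ R = (\prod_(P <- s) lform (pt_coord P)) * R', forall P, P \in s -> common_zero P &
      forall P, common_zero P -> ~ divides (lform (pt_coord P)) R'].
Proof.
have [n] := ubnP (msize R); elim: n R => // n IHn R szR R0.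
have [[P [Pc [R1 R1E]]]|nP] := pselect (exists P, common_zero P /\
    divides (lform (pt_coord P)) R); last first.
  exists [::], R; split=> [||P Pc PR]; rewrite ?big_nil ?mul1r //.
  by apply: nP; exists P.
have [i vi] := pt_coord_neq0 P; have Lp : prime_elt (lform (pt_coord P)).
  by apply: (@lform_prime _ _ i); rewrite vi oner_eq0.
have R10 : R1 != 0 by apply: contraNneq R0 => R10; rewrite R1E R10 mul0r.
have szR1 : (msize R1 < n)%N.
  move: szR; have := prime_msize Lp; rewrite R1E msizeM //; last by case: Lp.
  by move: (msize R1) (msize (lform _)) => a b; clear; lia.
have [s [R' [R'E sc nR']]] := IHn R1 szR1 R10; exists (P :: s), R'; split=> // [|P'].
  by rewrite big_cons {1}R1E R'E mulrC mulrA.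
by rewrite inE => /predU1P[->|/sc].
Qed.

(* Every line at which line_res vanishes meets Z(f) . Z(g), hence is a zero of the
   product S of the lines dual to the common zeros. *)
Lemma line_res_prime_divisor Q d : prime_elt Q -> Q \is d.-homog -> divides Q D ->
  exists P, common_zero P /\ divides Q (lform (pt_coord P)).
Proof.
move=> Qp Qh QD; have [s [D' [DE sc nD']]] := common_zero_factors D0.
set S := \prod_(P <- s) _ in DE.
have Sdiv P : common_zero P -> divides (lform (pt_coord P)) S.
  move=> Pc; have [i vi] := pt_coord_neq0 P.
  have vi0 : pt_coord P i != 0 by rewrite vi oner_eq0.
  have := lform_divides_line_res Kinf fh gh f0 g0 vi0.
  rewrite addn_gt0 d1_gt0 => /(_ isT Pc.1 Pc.2); rewrite DE.
  by case: (lform_prime vi0) => _ _ LM /LM[//|/(nD' P Pc)].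
have [QS|nQS] := pselect (divides Q S).
  have [L /mapP[P Ps ->] QL] : exists2 L, L \in [seq lform (pt_coord P) | P <- s] & divides Q L.
    by apply: (prime_divides_prod Qp); rewrite big_map.
  by exists P; split=> //; apply: sc.
have Sh : exists e, S \is e.-homog.
  rewrite /S; elim: s {DE sc Sdiv nQS S} => [|P s [e IHs]].
    by exists 0%N; rewrite big_nil dhomog1.
  by exists (1 + e)%N; rewrite big_cons; apply: dhomogM => //; apply: lform_homog.
have [e {}Sh] := Sh.
(* A coordinate function not divisible by [Q]: it keeps the zero of [Q] chosen below away from the
   zero vector, which is not a line. *)
have [T [i [nQT Th Ti]]] : exists T i, [/\ ~ divides Q T, T \is 1.-homog &
    forall l : 'I_3 -> K, T.@[l] = l i].
  have Xh j : ('X_j : {mpoly K[3]}) \is 1.-homog by rewrite dhomogX; apply/eqP/mdeg1.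
  have [Q0|nQ0] := pselect (divides Q 'X_0); last first.
    by exists 'X_0, 0; split=> // l; rewrite mevalXU.
  exists 'X_1, 1; split=> // [|l]; last by rewrite mevalXU.
  move=> Q1; have [u0 u0U E0] := prime_divides_prime Qp (mpolyX_prime K _) Q0.
  have [u1 u1U E1] := prime_divides_prime Qp (mpolyX_prime K _) Q1.
  have X01 : ('X_1 : {mpoly K[3]}) = u1 / u0 * 'X_0 by rewrite E0 E1 mulrA divrK.
  have := congr1 (meval (fun i : 'I_3 => (i == 1)%:R)) X01.
  rewrite /= mevalM !mevalXU eqxx /= mulr0 => /eqP; by rewrite oner_eq0.
have nQST : ~ divides Q (S * T) by case: (Qp) => _ _ QM /QM[].
have [l [Ql STl]] := homog_zero_point Kinf Qp Qh (dhomogM Sh Th) nQST.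
rewrite mevalM mulf_eq0 negb_or Ti in STl; have [Sl li] := andP STl.
have Dl : D.@[l] = 0 by have [h ->] := QD; rewrite mevalM Ql mulr0.
have [P [Pc Pl]] := line_res_common_zero li Dl.
have [h hE] := Sdiv P Pc; by move: Sl; rewrite hE mevalM Pl mulr0 eqxx.
Qed.

Lemma mult_along_assoc (Q Q' G : {mpoly K[3]}) : prime_elt Q -> prime_elt Q' -> divides Q Q' ->
  G != 0 -> mult_along Q G = mult_along Q' G.
Proof.
move=> Qp Q'p QQ' G0; have [u uU uE] := prime_divides_prime Qp Q'p QQ'.
have [H GE nH] := mult_along_split Q'p G0.
apply: (mult_along_unique Qp (H := u ^+ mult_along Q' G * H)).
  by rewrite {1}GE uE exprMn mulrCA mulrA.
case: (Qp) => _ _ QM /QM[/(prime_divides_exp Qp)/(prime_elt_ndivides_unit Qp uU)//|QH].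
by apply: nH; case: QH => h ->; exists (h / u); rewrite uE mulrA divrK.
Qed.

(** [Q] divides the equation of the dual line of at most one common zero, so at most one term is
    nonzero, and the local result evaluates it. If there is none, [Q] does not divide the
    resultant. *)
Theorem dual_cycle_line_res (Q : prime_divisor K) :
  dual_cycle f g Q = (mult_along Q D)%:Z.
Proof.
have Qp := prime_divisor_prime Q.
have [d Qh] := prime_divisor_homog Q.
have Lp (P : proj_point K) : prime_elt (lform (pt_coord P)).
  by have [i vi] := pt_coord_neq0 P; apply: (@lform_prime _ _ i); rewrite vi oner_eq0.
have z0 (P : proj_point K) : ~ divides (Q : {mpoly K[3]}) (lform (pt_coord P)) ->
    (intersection_mult f g P)%:Z * dual_line P Q = 0.
  by move=> nP; rewrite dual_lineE (mult_along_eq0 Qp nP) mulr0.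
have val P : common_zero P -> divides (Q : {mpoly K[3]}) (lform (pt_coord P)) ->
    (intersection_mult f g P)%:Z * dual_line P Q = (mult_along Q D)%:Z.
  move=> Pc QP; rewrite dual_lineE.
  have -> : mult_along Q (lform (pt_coord P)) = 1%N.
    have [u uU uE] := prime_divides_prime Qp (Lp P) QP.
    rewrite uE; apply: (mult_along_unique Qp (H := u)); first by rewrite mulrC.
    exact: prime_elt_ndivides_unit.
  rewrite mulr1 (intersection_mult_line_res Kinf fh gh f0 g0 D0 Pc.1 Pc.2).
  by rewrite (mult_along_assoc Qp (Lp P) QP).
rewrite /dual_cycle.
have [[P [Pc QP]]|nP] := pselect (exists P, common_zero P /\ divides (Q : {mpoly K[3]}) (lform
  (pt_coord P))).
  rewrite -(fsbig_widen [set P]%classic); last 2 first.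
  - by move=> _ ->.
  - move=> P' [P'c P'P]; apply: z0 => QP'; apply: P'P.
    exact: lform_divides_inj Qp QP' QP.
  by rewrite fsbig_set1 val.
rewrite fsbig1 => [|P Pc]; last by apply: z0 => QP; apply: nP; exists P.
rewrite (mult_along_eq0 Qp) // => QD; apply: nP.
exact: line_res_prime_divisor Qp Qh QD.
Qed.
End GlobalMultiplicity.

Lemma dual_cycleC (K : fieldType) (f g : {mpoly K[3]}) Q : dual_cycle f g Q = dual_cycle g f Q.
Proof.
rewrite /dual_cycle.
have -> : [set P : proj_point K | f.@[pt_coord P] = 0 /\ g.@[pt_coord P] = 0]%classic =
          [set P : proj_point K | g.@[pt_coord P] = 0 /\ f.@[pt_coord P] = 0]%classic.
  by apply/seteqP; split=> P /= [].
by apply: eq_fsbigr => P _; rewrite intersection_multC.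
Qed.

(** * Formal power series *)

Lemma poly_sub_divides (S : comNzRingType) (p : {poly S}) a b :
  exists h, p.[a] - p.[b] = (a - b) * h.
Proof.
have [q E] : exists q, p - p.[b]%:P = q * ('X - b%:P).
  by apply/factor_theorem/rootP; rewrite hornerD hornerN hornerC subrr.
exists q.[a]; have := congr1 (horner^~ a) E.
by rewrite hornerD hornerN hornerC hornerM hornerXsubC => ->; rewrite mulrC.
Qed.

Lemma taylor2 (S : comNzRingType) (p : {poly S}) a h :
  exists r, p.[a + h] = p.[a] + h * p^`().[a] + h ^+ 2 * r.
Proof.
elim/poly_ind: p => [|p c [r rE]]; first by exists 0; rewrite deriv0 !horner0 !mulr0 !addr0.
exists (p^`().[a] + r * (a + h)).
rewrite derivD derivM derivX derivC !hornerE rE; ring.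
Qed.

Section FpsTheory.
Variable k : fieldType.
Local Notation R := (fps k).
Implicit Types a b : R.

Definition ccoef a : k := fps_coef a 0.
Arguments ccoef : simpl never.

Lemma ccoef_is_zmod_morphism : zmod_morphism ccoef.
Proof. by []. Qed.
HB.instance Definition _ := GRing.isZmodMorphism.Build R k ccoef ccoef_is_zmod_morphism.

Lemma ccoef_is_monoid_morphism : monoid_morphism ccoef.
Proof. by split=> // a b; rewrite /ccoef /= big_ord1. Qed.
HB.instance Definition _ := GRing.isMonoidMorphism.Build R k ccoef ccoef_is_monoid_morphism.

Lemma fps_coefD a b i : fps_coef (a + b) i = fps_coef a i + fps_coef b i.
Proof. by []. Qed.

Lemma fps_coefM a b i : fps_coef (a * b) i = \sum_(j < i.+1) fps_coef a j * fps_coef b (i - j).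
Proof. by []. Qed.

Definition fps_const (c : k) : R := Fps (fun i => if i is 0%N then c else 0).

Lemma fps_const_is_zmod_morphism : zmod_morphism fps_const.
Proof. by move=> c d; apply: fpsP => -[|i] //=; rewrite subrr. Qed.
HB.instance Definition _ := GRing.isZmodMorphism.Build k R fps_const fps_const_is_zmod_morphism.

Lemma fps_const_is_monoid_morphism : monoid_morphism fps_const.
Proof.
split=> [|c d]; first by apply: fpsP => -[|i].
apply: fpsP => i; rewrite fps_coefM big_ord_recl big1 ?addr0 /= => [|j _]; last by rewrite mul0r.
by case: i => [|i] //=; rewrite mulr0.
Qed.
HB.instance Definition _ := GRing.isMonoidMorphism.Build k R fps_const
  fps_const_is_monoid_morphism.

Lemma ccoef_const c : ccoef (fps_const c) = c.
Proof. by []. Qed.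

Definition fps_shift a : R := Fps (fun i => fps_coef a i.+1).
Definition tau : R := Fps (fun i => (i == 1%N)%:R).

Lemma coef_tauM a i : fps_coef (tau * a) i = if i is j.+1 then fps_coef a j else 0.
Proof.
rewrite fps_coefM big_ord_recl /= mul0r add0r; case: i => [|i]; first by rewrite big_ord0.
rewrite big_ord_recl /= mul1r subSS subn0 big1 ?addr0 // => j _.
by rewrite mul0r.
Qed.

Lemma ccoef_tau : ccoef tau = 0. Proof. by []. Qed.

Lemma ccoef_eq0 a : ccoef a = 0 -> a = tau * fps_shift a.
Proof. by move=> a0; apply: fpsP => -[|i]; rewrite coef_tauM. Qed.

Lemma coef_tauXM n a i : fps_coef (tau ^+ n * a) i = if (i < n)%N then 0 else fps_coef a (i - n).
Proof.
elim: n i => [|n IHn] i; first by rewrite mul1r subn0.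
by rewrite exprS -mulrA coef_tauM; case: i => // i; rewrite IHn ltnS subSS.
Qed.

Lemma tau_divides n a : (forall i, (i < n)%N -> fps_coef a i = 0) -> exists b, a = tau ^+ n * b.
Proof.
elim: n a => [|n IHn] a an; first by exists a; rewrite mul1r.
have aE := ccoef_eq0 (an 0%N isT).
have [i ltin|b bE] := IHn (fps_shift a); first exact: an i.+1 ltin.
by exists b; rewrite aE bE exprS mulrA.
Qed.

Lemma tau_neq0 : tau != 0.
Proof. by apply/eqP => /(congr1 (fun a => fps_coef a 1)) /= /eqP; rewrite oner_eq0. Qed.

Lemma fps_order a : a != 0 -> exists s u, a = tau ^+ s * u /\ ccoef u != 0.
Proof.
move=> a0; have ex : exists i, fps_coef a i != 0.
  apply: contrapT => /forallNP h; case/eqP: a0; apply: fpsP => i.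
  by apply/eqP/negPn/negP/h.
case: (ex_minnP ex) => s as0 smin; have [u aE] : exists u, a = tau ^+ s * u.
  apply: tau_divides => i; apply: contraTeq => /smin; by rewrite -leqNgt.
by exists s, u; split=> //; move: as0; rewrite aE coef_tauXM ltnn subnn.
Qed.

Lemma tau_order_unique s s' u u' : ccoef u != 0 -> ccoef u' != 0 ->
  tau ^+ s * u = tau ^+ s' * u' -> ccoef u = ccoef u'.
Proof.
wlog le : s s' u u' / (s <= s')%N => [H|].
  case: (leqP s s') => [|/ltnW] le u0 u'0 E; first exact: H le u0 u'0 E.
  by apply/esym/(H _ _ _ _ le u'0 u0); rewrite E.
move=> u0 u'0; rewrite -(subnKC le) exprD -mulrA => /mulfI.
rewrite expf_neq0 ?tau_neq0 // => /(_ isT) E; move: u0; rewrite E.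
case: (s' - s)%N => [|n]; first by rewrite mul1r.
by rewrite rmorphM rmorphXn /= ccoef_tau expr0n mul0r eqxx.
Qed.

(* The substitution t = tau ^+ M.+1 *)
Definition expand M a : R := Fps (fun i => if (M.+1 %| i)%N then fps_coef a (i %/ M.+1) else 0).

Lemma expand_is_zmod_morphism M : zmod_morphism (expand M).
Proof. by move=> a b; apply: fpsP => i /=; case: ifP => // _; rewrite subrr. Qed.

Lemma expand_is_monoid_morphism M : monoid_morphism (expand M).
Proof.
split=> [|a b]; apply: fpsP => i.
  case: i => [|i] /=; first by [].
  case: ifP => // /dvdnP[j jE]; rewrite jE mulnK //.
  by case: j jE => [|j].
(* Up to index i a series may be replaced by its truncation, for which the substitution is
   composition with a power of 'X. *)
pose tr c : {poly k} := \poly_(j < i.+1) fps_coef c j.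
have trE c j : (j <= i)%N -> (tr c \Po 'X^(M.+1))`_j = fps_coef (expand M c) j.
  move=> ji; rewrite coef_comp_poly_Xn //=; case: ifP => // _.
  by rewrite coef_poly ltnS (leq_trans (leq_div _ _) ji).
have -> : fps_coef (expand M a * expand M b) i = ((tr a * tr b) \Po 'X^(M.+1))`_i.
  rewrite comp_polyM coefM fps_coefM; apply: eq_bigr => j _.
  by rewrite !trE ?leq_subr // -ltnS.
rewrite coef_comp_poly_Xn //=; case: ifP => // _.
have il := leq_div i M.+1; rewrite coefM; apply: eq_bigr => j _.
have jl : (j <= i)%N by rewrite (leq_trans _ il) // -ltnS.
by rewrite !coef_poly !ltnS jl (leq_trans (leq_subr _ _) il).
Qed.

Lemma ccoef_expand M a : ccoef (expand M a) = ccoef a.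
Proof. by []. Qed.

Lemma expand_tau M : expand M tau = tau ^+ M.+1.
Proof.
apply: fpsP => i; rewrite -[tau ^+ _]mulr1 coef_tauXM /=.
case: (ltnP i M.+1) => [ltiM|leMi].
  by case: ifP => // _; rewrite divn_small.
case: ifPn => [/dvdnP[j jE]|ndvd].
  rewrite jE in leMi *; rewrite mulnK // -{2}[M.+1]mul1n -mulnBl; move: leMi.
  by case: j {jE} => [|[|j]] //; rewrite subSS subn0 mulSn.
have : (i - M.+1)%N != 0%N; last by case: (i - M.+1)%N.
by apply: contraNneq ndvd => E; rewrite -(subnK leMi) E.
Qed.

Lemma expand_const M c : expand M (fps_const c) = fps_const c.
Proof.
apply: fpsP => -[|i] /=; first by [].
by case: ifP => // /dvdnP[[|j] jE] //; rewrite jE mulnK.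
Qed.

(** Newton's method, one coefficient at a time: a term y tau^n changes the coefficient of index n of
    p(A) by p'(x) y, and [y] is chosen to cancel it. *)
Lemma hensel (p : {poly R}) (x : k) : (map_poly ccoef p).[x] = 0 ->
  (map_poly ccoef p)^`().[x] != 0 -> exists a, ccoef a = x /\ p.[a] = 0.
Proof.
move=> px p'x; pose c := (map_poly ccoef p)^`().[x].
pose y a n := - fps_coef p.[a] n / c.
pose A := fix A n := if n is m.+1 then A m + tau ^+ n * fps_const (y (A m) n) else fps_const x.
have A0E : A 0%N = fps_const x by [].
have AS n : A n.+1 = A n + tau ^+ n.+1 * fps_const (y (A n) n.+1) by [].
clearbody A.
have ev (q : {poly R}) a : ccoef q.[a] = (map_poly ccoef q).[ccoef a] by rewrite horner_map.
have A0 n : ccoef (A n) = x.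
  elim: n => [|n IHn]; first by rewrite A0E.
  by rewrite AS rmorphD rmorphM rmorphXn /= IHn ccoef_tau expr0n mul0r addr0.
have Ap n : exists r, p.[A n] = tau ^+ n.+1 * r.
  elim: n => [|n [r rE]].
    by apply: tau_divides => -[|i] // _; rewrite -[LHS]/(ccoef _) ev A0.
  have [r' r'E] := taylor2 p (A n) (tau ^+ n.+1 * fps_const (y (A n) n.+1)).
  have /ccoef_eq0 : ccoef (r + fps_const (y (A n) n.+1) * p^`().[A n] +
      tau ^+ n.+1 * (fps_const (y (A n) n.+1) ^+ 2 * r')) = 0.
    rewrite !rmorphD !rmorphM rmorphXn /= ccoef_tau expr0n mul0r addr0.
    rewrite ccoef_const ev A0 -deriv_map -/c /y rE coef_tauXM ltnn subnn.
    by rewrite -/(ccoef r) ?ccoef_const divfK ?addrN.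
  set s := fps_shift _ => sE; exists s; rewrite AS r'E rE [tau ^+ n.+2]exprSr -mulrA -sE.
  by ring.
have AA n i : (i <= n)%N -> fps_coef (A n) i = fps_coef (A i) i.
  elim: n => [|n IHn]; first by rewrite leqn0 => /eqP ->.
  rewrite leq_eqVlt => /predU1P[-> //|lt]; rewrite -IHn // AS fps_coefD coef_tauXM lt addr0 //.
(* The coefficient of index i is final from step i on, so the diagonal series is the limit of the
   approximations. *)
pose a := Fps (fun i => fps_coef (A i) i); exists a; split; first exact: (A0 0%N).
apply: fpsP => n; have [h hE] := poly_sub_divides p a (A n).
have [b bE] : exists b, a - A n = tau ^+ n.+1 * b.
  by apply: tau_divides => i lt; rewrite /= AA ?subrr.
have [r rE] := Ap n.
have -> : p.[a] = tau ^+ n.+1 * (b * h + r) by rewrite -[p.[a]](subrK p.[A n]) hE rE bE; ring.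
by rewrite coef_tauXM ltnSn.
Qed.

Lemma fps_inverse a : ccoef a != 0 -> exists b, b * a = 1.
Proof.
move=> a0; pose p : {poly R} := a%:P * 'X - 1.
have pE : map_poly ccoef p = (ccoef a)%:P * 'X - 1.
  by rewrite /p rmorphB rmorphM /= map_polyC map_polyX rmorph1.
have [||b [_ pb]] := @hensel p (ccoef a)^-1; rewrite ?pE.
- by rewrite !hornerE divff ?subrr.
- by rewrite derivB derivM derivX !derivC mul0r add0r mulr1 subr0 hornerC.
exists b; apply/eqP; rewrite -subr_eq0 -pb /p !hornerE mulrC; exact/eqP.
Qed.

End FpsTheory.

HB.instance Definition _ (k : fieldType) (M : nat) := GRing.isZmodMorphism.Build (fps k) (fps k)
  (expand M) (@expand_is_zmod_morphism k M).
HB.instance Definition _ (k : fieldType) (M : nat) := GRing.isMonoidMorphism.Build (fps k) (fps k)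
  (expand M) (@expand_is_monoid_morphism k M).
Arguments fps_const {k} c : simpl never.
Arguments expand {k} M a : simpl never.
Arguments tau {k} : simpl never.
Arguments ccoef {k} a : simpl never.

(** * Roots above a root of the reduction, and their share of the discriminant *)

Section Cluster.
Variable k : closedFieldType.
Hypothesis char_k : [pchar k] =i pred0.
Local Notation R := (fps k).
Local Notation red := (map_poly ccoef).
Local Notation cst := (map_poly (@fps_const k)).

Lemma ccoef_horner (q : {poly R}) a : ccoef q.[a] = (red q).[ccoef a].
Proof. by rewrite horner_map. Qed.

(* The list s of roots of G reduces to x; its contribution to the discriminant
   of G has the leading coefficient w. *)
Definition cluster (G : {poly R}) (x : k) (m : nat) (P : k -> Prop) : Prop :=
  exists s : seq R, [/\ size s = m, uniq s, forall r, r \in s -> ccoef r = x /\ G.[r] = 0 &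
    exists E w, \prod_(r <- s) G^`().[r] = tau ^+ E * w /\ P (ccoef w)].

Lemma simple_cluster (G : {poly R}) (f g : {poly k}) x :
  red G = f * g -> f.[x] = 0 -> f^`().[x] != 0 -> g.[x] != 0 ->
  cluster G x 1 (fun w => w = f^`().[x] * g.[x]).
Proof.
move=> GE fx f'x gx; have G'x : (red G)^`().[x] = f^`().[x] * g.[x].
  by rewrite GE derivM hornerD !hornerM fx mul0r addr0.
have [||r [rx Gr]] := @hensel _ G x; first by rewrite GE hornerM fx mul0r.
  by rewrite G'x mulf_neq0.
exists [:: r]; split=> // [r'|]; first by rewrite inE => /eqP->.
exists 0%N, G^`().[r]; rewrite big_seq1 mul1r; split=> //.
by rewrite ccoef_horner rx -deriv_map G'x.
Qed.

Lemma kummer_roots m (c d : k) : (0 < m)%N -> c != 0 -> d != 0 ->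
  exists s : seq k, [/\ uniq s, size s = m, forall y, y \in s -> c * y ^+ m + d = 0 /\ y != 0 &
    \prod_(y <- s) y = (-1) ^+ m * (d / c)].
Proof.
move=> m_gt0 c0 d0; have /pcharf0P K0 := char_k; pose F := c *: 'X^m + d%:P.
have szX : size (c *: 'X^m : {poly k}) = m.+1 by rewrite size_scale // size_polyXn.
have szF : size F = m.+1.
  by rewrite size_polyDl szX // size_polyC d0 ltnS.
have Fx x : F.[x] = c * x ^+ m + d by rewrite !hornerE.
have lF : lead_coef F = c.
  by rewrite lead_coefDl ?lead_coefZ ?lead_coefXn ?mulr1 // szX size_polyC d0.
have rt x : F.[x] = 0 -> x != 0.
  apply: contra_eqN => /eqP->; by rewrite Fx expr0n gtn_eqF // mulr0 add0r.
have [x Fx0|s [us szs rs FE]] := split_separable szF.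
  rewrite /F derivD derivC addr0 derivZ derivXn hornerZ hornerMn hornerXn.
  have mk : m%:R != 0 :> k by rewrite K0 -lt0n.
  by rewrite mulf_neq0 // -mulr_natl mulf_neq0 // expf_neq0 // rt.
exists s; split=> // [y /(allP rs)/rootP Fy|]; first by split; [rewrite -Fx|apply: rt].
have := congr1 (horner^~ 0) FE; rewrite Fx expr0n gtn_eqF // mulr0 add0r lF hornerZ.
rewrite horner_prod => ->; rewrite [c * _]mulrC mulfK //.
rewrite [X in _ = _ * X](eq_bigr (fun y => -1 * y)) => [|y _]; last by rewrite !hornerE mulN1r.
rewrite big_split /= big_const_seq count_predT szs iter_mulr_1 mulrA -expr2.
by rewrite sqrr_sign mul1r.
Qed.

(* Let xi be the root of Phi above x. After the substitution 'X = xi + tau ^+ e * Y,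
   the polynomial A G becomes tau ^+ (e * m) q(Y), where q is congruent to
   (c Y) ^+ m + Dl(x) modulo tau with c = Phi'(x), so that q has m simple roots. *)
Lemma ramified_cluster (G : {poly R}) (Phi Er : {poly R}) (f g b A Dl : {poly k}) m e x :
  (0 < m)%N -> (0 < e)%N ->
  cst A * G = Phi ^+ m + (tau ^+ (e * m))%:P * (cst Dl + tau%:P * Er) ->
  red G = f ^+ m * g -> red Phi = f * b ->
  f.[x] = 0 -> f^`().[x] != 0 -> g.[x] != 0 -> A.[x] != 0 -> Dl.[x] != 0 ->
  cluster G x m (fun w => w * A.[x] ^+ m.-1 =
    m%:R ^+ m * (f^`().[x] ^+ m * g.[x] * Dl.[x] ^+ m.-1)).
Proof.
move=> m_gt0 e_gt0 AG redG redPhi fx f'x gx Ax Dx.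
have redC (p : {poly k}) : red (cst p) = p.
  by rewrite -map_poly_comp map_poly_id // => y _; rewrite /= ccoef_const.
have red_tau n (p p' : {poly R}) : (0 < n)%N -> red (p + (tau ^+ n)%:P * p') = red p.
  move=> n_gt0; rewrite rmorphD rmorphM /= map_polyC /= rmorphXn /= ccoef_tau expr0n gtn_eqF //.
  by rewrite mul0r addr0.
have f0 : f != 0 by apply: contraNneq f'x => ->; rewrite deriv0 horner0.
(* Cancelling [f ^+ m] modulo tau expresses b^m by A and g; this is how the other components enter
   the leading coefficient. *)
have bA : b ^+ m = A * g.
  have := congr1 red AG; rewrite rmorphM red_tau ?muln_gt0 ?e_gt0 // rmorphXn /= redC redG redPhi.
  rewrite exprMn mulrCA => E.
  by apply: (mulfI (expf_neq0 m f0)); rewrite -E.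
have bx : b.[x] != 0.
  have : (b ^+ m).[x] != 0 by rewrite bA hornerM mulf_neq0.
  by rewrite horner_exp; apply: contraNneq => ->; rewrite expr0n gtn_eqF.
have Phi'x : (red Phi)^`().[x] = f^`().[x] * b.[x].
  by rewrite redPhi derivM hornerD !hornerM fx mul0r addr0.
pose c := f^`().[x] * b.[x]; have c0 : c != 0 by rewrite mulf_neq0.
have [||xi [xi0 Pxi]] := @hensel _ Phi x; first by rewrite redPhi hornerM fx mul0r.
  by rewrite Phi'x.
pose sb := xi%:P + (tau ^+ e)%:P * 'X : {poly R}.
have red_comp (p : {poly R}) : red (p \Po sb) = (red p).[x]%:P.
  by rewrite map_comp_poly red_tau // map_polyC /= xi0 comp_polyCr.
(* Taylor expansion at the root [xi]: the constant term vanishes, and the linear coefficient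
   Phi'(xi) reduces to [c]. *)
have [psi [psiE psi0]] : exists psi, Phi \Po sb = (tau ^+ e)%:P * ('X * psi) /\
    red psi = c%:P.
  have [r rE] := taylor2 (map_poly polyC Phi) xi%:P ((tau ^+ e)%:P * 'X).
  exists (Phi^`().[xi]%:P + (tau ^+ e)%:P * ('X * r)); split.
    rewrite /comp_poly /sb rE deriv_map !horner_map /= Pxi; ring.
  by rewrite red_tau // map_polyC /= ccoef_horner xi0 -deriv_map Phi'x.
pose q := 'X^m * psi ^+ m + (cst Dl \Po sb) + tau%:P * (Er \Po sb).
have HE : (cst A * G) \Po sb = (tau ^+ (e * m))%:P * q.
  rewrite AG comp_polyD comp_polyM comp_polyC comp_polyD comp_polyM comp_polyC.
  rewrite (rmorphXn (comp_poly sb)) /= psiE !exprMn -polyC_exp -exprM /q; ring.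
have redq : red q = c ^+ m *: 'X^m + (Dl.[x])%:P.
  rewrite /q !rmorphD !rmorphM /= !rmorphXn /= map_polyX psi0 red_comp redC map_polyC /= ccoef_tau.
  by rewrite mul0r addr0 mulrC -polyC_exp mul_polyC.
have [t [ut szt tP prt]] := kummer_roots m_gt0 (expf_neq0 m c0) Dx.
have qroot y : y \in t -> exists a, ccoef a = y /\ q.[a] = 0.
  move=> /tP[yE y0]; apply: hensel; rewrite redq.
    by rewrite !hornerE.
  rewrite derivD derivC addr0 derivZ derivXn hornerZ hornerMn hornerXn.
  have mk : m%:R != 0 :> k by rewrite ((pcharf0P _).1 char_k) -lt0n.
  by rewrite mulf_neq0 ?expf_neq0 // -mulr_natl mulf_neq0 // expf_neq0.
have [Y YP] : exists Y : k -> R, forall y, y \in t -> ccoef (Y y) = y /\ q.[Y y] = 0.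
  have ex y : exists a, y \in t -> ccoef a = y /\ q.[a] = 0.
    have [yt|_] := boolP (y \in t); last by exists 0.
    by have [a aP] := qroot y yt; exists a.
  by have [Y YP] := choice ex; exists Y.
pose rho y := xi + tau ^+ e * Y y.
have sbE y : sb.[Y y] = rho y by rewrite !hornerE.
have rho0 y : ccoef (rho y) = x.
  by rewrite rmorphD rmorphM rmorphXn /= ccoef_tau expr0n gtn_eqF // mul0r addr0.
have te : tau ^+ e != 0 :> R by rewrite expf_neq0 ?tau_neq0.
have Arho y : ccoef (cst A).[rho y] = A.[x] by rewrite ccoef_horner rho0 redC.
have Arho0 y : (cst A).[rho y] != 0.
  by apply: contraNneq Ax => E; rewrite -(Arho y) E rmorph0.
have Grho y : y \in t -> G.[rho y] = 0.
  move=> /YP[_ qy]; have := congr1 (horner^~ (Y y)) HE.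
  rewrite /= horner_comp sbE !hornerM qy mulr0 => /eqP.
  by rewrite mulf_eq0 (negPf (Arho0 y)) => /eqP.
have q' y : y \in t -> ccoef q^`().[Y y] = (c ^+ m * m%:R) * y ^+ m.-1.
  move=> /YP[Yy _]; rewrite ccoef_horner -deriv_map redq Yy.
  rewrite derivD derivC addr0 derivZ derivXn hornerZ hornerMn hornerXn.
  by rewrite -mulr_natl mulrA.
(* [HE] is differentiated in Y. On the left the inner derivative is tau^e and the derivative of A
   meets G(rho) = 0, so that the exponent drops from e m to e (m - 1). *)
have G'rho y : y \in t -> (cst A).[rho y] * G^`().[rho y] = tau ^+ (e * m.-1) * q^`().[Y y].
  move=> yt; have := congr1 (fun p => p^`().[Y y]) HE.
  rewrite /= deriv_comp derivM hornerM horner_comp sbE hornerD !hornerM Grho // mulr0 add0r.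
  rewrite /sb derivD derivC add0r !derivM !derivC !mul0r !add0r derivX mulr1 hornerC.
  rewrite hornerM hornerC => E; apply: (mulfI te).
  rewrite mulrC E -{1}(prednK m_gt0) mulnS exprD; ring.
exists (map rho t); split.
- by rewrite size_map.
- rewrite map_inj_in_uniq // => y z yt zt E; have [<- _] := YP y yt; have [<- _] := YP z zt.
  by congr ccoef; apply/(mulfI te)/(addrI xi).
- by move=> _ /mapP[y yt ->]; rewrite rho0 Grho.
have [v vE] : exists v, v * \prod_(y <- t) (cst A).[rho y] = 1.
  apply: fps_inverse; rewrite rmorph_prod prodf_seq_neq0; apply/allP => y _ /=.
  by rewrite Arho.
exists ((e * m.-1) * m)%N, (v * \prod_(y <- t) q^`().[Y y]).
rewrite big_map; split.
  have prE : \prod_(y <- t) (cst A).[rho y] * \prod_(y <- t) G^`().[rho y] =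
      tau ^+ (e * m.-1 * m) * \prod_(y <- t) q^`().[Y y].
    transitivity (\prod_(y <- t) ((cst A).[rho y] * G^`().[rho y])); first by rewrite big_split.
    rewrite (eq_big_seq (fun y => tau ^+ (e * m.-1) * q^`().[Y y])) => [|y yt]; last exact: G'rho.
    by rewrite big_split /= big_const_seq count_predT szt iter_mulr_1 -exprM.
  by rewrite mulrCA -prE mulrA vE mul1r.
have v0 : ccoef v * A.[x] ^+ m = 1.
  have := congr1 ccoef vE; rewrite rmorphM rmorph_prod rmorph1 => <-; congr (_ * _).
  rewrite (eq_bigr (fun=> A.[x])) => [|y _]; last exact: Arho.
  by rewrite big_const_seq count_predT szt iter_mulr_1.
have w0 : \prod_(y <- t) ccoef q^`().[Y y] = (c ^+ m * m%:R) ^+ m * (\prod_(y <- t) y) ^+ m.-1.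
  rewrite (eq_big_seq (fun y => c ^+ m * m%:R * y ^+ m.-1)) => [|y yt]; last exact: q'.
  by rewrite big_split /= big_const_seq count_predT szt iter_mulr_1 prodrXl.
have cm : c ^+ m = f^`().[x] ^+ m * (A.[x] * g.[x]).
  by rewrite /c exprMn -(horner_exp b) bA hornerM.
rewrite rmorphM rmorph_prod w0 prt; apply: (mulfI Ax).
transitivity ((ccoef v * A.[x] ^+ m) * ((c ^+ m * m%:R) ^+ m * ((-1) ^+ m * (Dl.[x] / c ^+ m)) ^+
  m.-1)).
  have -> : A.[x] ^+ m = A.[x] * A.[x] ^+ m.-1 by rewrite -exprS prednK.
  have ac (a b' X y : k) : a * (b' * X * y) = b' * (a * y) * X by ring.
  exact: ac.
rewrite v0 mul1r.
transitivity (m%:R ^+ m * (c ^+ m * Dl.[x] ^+ m.-1)); last by rewrite cm; ring.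
(* m (m - 1) is even, so the sign in the product of the Kummer roots disappears. *)
have sg : ((-1) ^+ m) ^+ m.-1 = 1 :> k.
  by rewrite -exprM -signr_odd oddM; case: (m) m_gt0 => // m' _; rewrite /= andNb.
move: (c ^+ m) ((-1) ^+ m) (expf_neq0 m c0) sg => C sgn C0 sg.
rewrite !exprMn sg mul1r exprVn -{1}(prednK m_gt0) exprSr.
move: (C ^+ m.-1) (m%:R ^+ m) (Dl.[x] ^+ m.-1) (expf_neq0 m.-1 C0) => X M D X0.
by field.
Qed.
End Cluster.

(** * Decompositions in powers of t as identities over k[[t]] *)

Section SeriesSwap.
Variable k : fieldType.
Local Notation R := (fps k).
Local Notation red := (map_poly (@ccoef k)).
Local Notation cst := (map_poly (@fps_const k)).

(* Exchanges the variable 'X of the outer polynomials with tau. *)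
Definition swap (P : {poly {poly k}}) : {poly R} := (map_poly cst P).[tau%:P].

Lemma swap_is_zmod_morphism : zmod_morphism swap.
Proof. by move=> P Q; rewrite /swap rmorphB hornerD hornerN. Qed.
HB.instance Definition _ := GRing.isZmodMorphism.Build _ _ swap swap_is_zmod_morphism.

Lemma swap_is_monoid_morphism : monoid_morphism swap.
Proof. by split=> [|P Q]; rewrite /swap ?rmorph1 ?hornerC // rmorphM hornerM. Qed.
HB.instance Definition _ := GRing.isMonoidMorphism.Build _ _ swap swap_is_monoid_morphism.

Lemma swapC (p : {poly k}) : swap p%:P = cst p.
Proof. by rewrite /swap map_polyC hornerC. Qed.

Lemma swapXn n : swap 'X^n = (tau ^+ n)%:P.
Proof. by rewrite /swap map_polyXn hornerXn polyC_exp. Qed.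

Lemma swapX : swap 'X = tau%:P.
Proof. by rewrite -(expr1 'X) swapXn expr1. Qed.

Lemma red_cst (p : {poly k}) : red (cst p) = p.
Proof. by rewrite -map_poly_comp map_poly_id // => y _; rewrite /= ccoef_const. Qed.

Lemma red_swap P : red (swap P) = P`_0.
Proof.
elim/poly_ind: P => [|P c IHP]; first by rewrite !rmorph0 coef0.
rewrite rmorphD rmorphM /= swapX swapC rmorphD rmorphM /= map_polyC red_cst.
by rewrite /= ccoef_tau mulr0 add0r coefD coefMX coefC eqxx add0r.
Qed.

(** The coefficient of t^i; for the restriction of the series to a line it will be the restriction
    of F_i. *)
Definition layer i : {poly R} -> {poly k} := map_poly (fun a : R => fps_coef a i).

Lemma coef_layer i G j : (layer i G)`_j = fps_coef G`_j i.
Proof. by rewrite coef_map_id0. Qed.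

Lemma fps_truncation n (a : R) : exists b,
  a = \sum_(i < n) fps_const (fps_coef a i) * tau ^+ i + tau ^+ n * b.
Proof.
have [b bE] : exists b, a - \sum_(i < n) fps_const (fps_coef a i) * tau ^+ i = tau ^+ n * b.
  apply: tau_divides => j ltjn.
  have coefS (J : seq 'I_n) (E : 'I_n -> R) l :
      fps_coef (\sum_(i <- J) E i) l = \sum_(i <- J) fps_coef (E i) l.
    by elim: J => [|i J IHJ]; rewrite ?big_nil // !big_cons fps_coefD IHJ.
  rewrite fps_coefD -[fps_coef (- _) j]/(- fps_coef _ j) coefS.
  have term (i : nat) c : fps_coef (fps_const c * tau ^+ i) j =
      if (j < i)%N then 0 else fps_coef (fps_const c : R) (j - i) by rewrite mulrC coef_tauXM.
  rewrite (eq_bigr (fun i : 'I_n => if (j < i)%N then 0 else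
    fps_coef (fps_const (fps_coef a i) : R) (j - i))) => [|i _]; last exact: term.
  rewrite (bigD1 (Ordinal ltjn)) //= ltnn subnn big1 ?addr0 ?subrr // => i ij.
  case: ltnP => // leij.
  case E : (j - i)%N => //; move/eqP: E; rewrite subn_eq0 => leji.
  by case/eqP: ij; apply/val_inj/eqP; rewrite eqn_leq leij leji.
by exists b; rewrite -bE addrC subrK.
Qed.

Lemma series_truncation n (G : {poly R}) : exists E : {poly R},
  G = swap (\sum_(i < n) (layer i G)%:P * 'X^i) + (tau ^+ n)%:P * E.
Proof.
have [b bE] := choice (fps_truncation n).
exists (\poly_(j < size G) b G`_j); apply/polyP => j.
rewrite coefD coefCM coef_poly rmorph_sum coef_sum /=.
have -> : \sum_(i < n) (swap ((layer i G)%:P * 'X^i))`_j =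
    \sum_(i < n) fps_const (fps_coef G`_j i) * tau ^+ i.
  apply: eq_bigr => i _; rewrite rmorphM /= swapXn swapC coefMC coef_map /=.
  by rewrite coef_layer.
case: ltnP => [_|le]; first exact: bE.
rewrite nth_default // mulr0 addr0 big1 // => i _.
by rewrite rmorph0 mul0r.
Qed.

(** The hypothesis controls the coefficients up to t^N; everything beyond is divisible by t^(N+1)
    and goes into [Er]. *)
Lemma series_decomposition N m (A Dl : {poly k}) (Phi : {poly {poly k}}) (G : {poly R}) :
  (forall i, (i <= N)%N -> A * layer i G = (Phi ^+ m + Dl%:P * 'X^N)`_i) ->
  exists Er, cst A * G = swap Phi ^+ m + (tau ^+ N)%:P * (cst Dl + tau%:P * Er).
Proof.
move=> dec; have [E GE] := series_truncation N.+1 G.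
set T := \sum_(i < N.+1) _ in GE.
have [Q QE] : exists Q, Phi ^+ m + Dl%:P * 'X^N - A%:P * T = Q * 'X^(N.+1).
  exists (drop_poly N.+1 (Phi ^+ m + Dl%:P * 'X^N - A%:P * T)).
  rewrite -[LHS](poly_take_drop N.+1) [X in X + _](_ : _ = 0) ?add0r //.
  apply/polyP => i; rewrite coef_take_poly coef0 ltnS; case: leqP => // leiN.
  rewrite coefB -dec // coefCM; apply/eqP; rewrite subr_eq0; apply/eqP; congr (_ * _).
  rewrite /T coef_sum (bigD1 (Ordinal (leiN : i < N.+1)%N)) //= coefCM coefXn eqxx mulr1.
  rewrite big1 ?addr0 // => j ji; rewrite coefCM coefXn.
  by case: eqP => [ij|_]; rewrite ?mulr0 //; case/eqP: ji; apply: val_inj.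
exists (cst A * E - swap Q); rewrite GE.
have -> : cst A * (swap T + (tau ^+ N.+1)%:P * E) = swap (A%:P * T) + (tau ^+ N.+1)%:P * (cst A *
  E).
  by rewrite rmorphM /= swapC; ring.
have -> : A%:P * T = Phi ^+ m + Dl%:P * 'X^N - Q * 'X^(N.+1) by rewrite -QE opprB addrC subrK.
have S1 : swap (Phi ^+ m + Dl%:P * 'X^N - Q * 'X^(N.+1)) =
    swap Phi ^+ m + cst Dl * (tau ^+ N)%:P - swap Q * (tau ^+ N.+1)%:P.
  by rewrite rmorphB rmorphD rmorphXn !rmorphM /= !swapXn swapC.
by rewrite S1 exprSr polyCM; ring.
Qed.
End SeriesSwap.

Lemma laurent_pchar0 (k : fieldType) : [pchar k] =i pred0 -> [pchar laurent k] =i pred0.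
Proof.
move=> /pcharf0P K0; apply/pcharf0P => n.
rewrite -(rmorph_nat (@FracField.tofrac (fps k))) tofrac_eq0 -[n%:R](rmorph_nat (@fps_const k)).
by rewrite fmorph_eq0 K0.
Qed.

Lemma size_prodX (F : fieldType) (I : finType) (f : I -> {poly F}) (m : I -> nat) :
  (forall v, f v != 0) ->
  (size (\prod_v f v ^+ m v)%R).-1 = (\sum_v m v * (size (f v)).-1)%N.
Proof.
move=> f0.
suff : \prod_v f v ^+ m v != 0 /\ (size (\prod_v f v ^+ m v)%R).-1 = (\sum_v m v * (size (f
  v)).-1)%N.
  by case.
elim/big_rec2: _ => [|v d p _ [p0 pE]]; first by rewrite oner_eq0 size_poly1.
have fm0 : f v ^+ m v != 0 by rewrite expf_neq0.
split; first by rewrite mulf_neq0.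
rewrite size_mul // -pE; have := size_exp (f v) (m v); rewrite mulnC => <-.
move: fm0 p0; rewrite -!size_poly_gt0; move: (size _) (size _) => a b; clear; lia.
Qed.

Lemma clusters_prod (k : fieldType) (T : eqType) (S : seq T) (L : T -> seq (fps k))
    (D : fps k -> fps k) (a c : T -> k) :
  (forall p, p \in S -> exists E w, \prod_(r <- L p) D r = tau ^+ E * w /\ ccoef w * a p = c p) ->
  exists E w, \prod_(r <- flatten [seq L p | p <- S]) D r = tau ^+ E * w /\
    ccoef w * \prod_(p <- S) a p = \prod_(p <- S) c p.
Proof.
elim: S => [_|p S IHS H].
  by exists 0%N, 1; rewrite !big_nil mulr1 rmorph1 mulr1.
have [E [w [Ew wE]]] := H p (mem_head _ _).
have [q qS|E' [w' [Ew' wE']]] := IHS; first by apply: H; rewrite inE qS orbT.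
exists (E + E')%N, (w * w'); rewrite /= big_cat /= Ew Ew' !big_cons exprD rmorphM -wE -wE'.
by split; [rewrite mulrACA|rewrite mulrACA].
Qed.

(** * The leading coefficient of the discriminant from all clusters *)

Section LineDiscriminant.
Variable k : closedFieldType.
Hypothesis char_k : [pchar k] =i pred0.
Local Notation R := (fps k).
Local Notation red := (map_poly (@ccoef k)).
Variables (I : finType) (n : nat) (f A Dl : I -> {poly k}) (m N : I -> nat).
Variables (Phi : I -> {poly {poly k}}) (G : {poly R}) (s : I -> seq k) (b : bool).
Hypothesis bP : forall (F : fieldType) (s : seq F) (G : {poly F}),
  [pchar F] =i pred0 -> size s = n -> (0 < n)%N -> size G = n.+1 -> all (root G) s -> uniq s ->
  (lead_coef G *+ n) * binary_disc n G =
    (-1) ^+ b * ((lead_coef G *+ n) ^+ n.-1 * \prod_(x <- s) G^`().[x]).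
Hypotheses (n_gt0 : (0 < n)%N) (m_gt0 : forall v, (0 < m v)%N).
Hypotheses (szG : size G = n.+1) (sz_redG : size (red G) = n.+1).
Hypothesis redG : red G = \prod_v f v ^+ m v.
Hypothesis sep : forall v x, (f v).[x] = 0 -> (f v)^`().[x] != 0.
Hypothesis disj : forall v w x, v != w -> (f v).[x] = 0 -> (f w).[x] != 0.
Hypotheses (us : forall v, uniq (s v)) (szs : forall v, size (s v) = (size (f v)).-1).
Hypothesis rs : forall v, all (root (f v)) (s v).
Hypothesis dec : forall v, (1 < m v)%N -> [/\ (0 < N v)%N,
  exists b, (Phi v)`_0 = f v * b,
  forall i, (i <= N v)%N -> A v * layer i G = (Phi v ^+ m v + (Dl v)%:P * 'X^(N v))`_i &
  forall x, (f v).[x] = 0 -> (A v).[x] != 0 /\ (Dl v).[x] != 0].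

Let rootE v x : x \in s v -> (f v).[x] = 0.
Proof. by move=> xs; apply/rootP/(allP (rs v)). Qed.

Definition cofactor_value v x : k := \prod_(w | w != v) (f w).[x] ^+ m w.

Lemma cofactor_value_neq0 v x : (f v).[x] = 0 -> cofactor_value v x != 0.
Proof. by move=> fx; apply/prodf_neq0 => w wv; rewrite expf_neq0 // (@disj v) // eq_sym. Qed.

Lemma cofactor_horner v x : (\prod_(w | w != v) f w ^+ m w).[x] = cofactor_value v x.
Proof. by rewrite horner_prod; apply: eq_bigr => w _; rewrite horner_exp. Qed.

(** [expand M] substitutes tau^(M+1), whence the predecessor. M + 1 is a common multiple of all
    [m v], so that all ramified roots become power series in one tau. *)
Let M := (\prod_v m v)%N.-1.
Let Gt := map_poly (expand M) G.

Let expandK (p : {poly R}) : red (map_poly (expand M) p) = red p.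
Proof. by rewrite -map_poly_comp; apply: eq_map_poly => a /=; rewrite ccoef_expand. Qed.

Lemma line_cluster v x : x \in s v -> cluster Gt x (m v) (fun w =>
  w * (A v).[x] ^+ (m v).-1 = (m v)%:R ^+ m v *
   ((f v)^`().[x] ^+ m v * cofactor_value v x * (Dl v).[x] ^+ (m v).-1)).
Proof.
move=> /rootE fx; pose g := \prod_(w | w != v) f w ^+ m w.
have redGt : red Gt = f v ^+ m v * g by rewrite expandK redG (bigD1 v).
have gx : g.[x] = cofactor_value v x by rewrite cofactor_horner.
have g0 : g.[x] != 0 by rewrite gx cofactor_value_neq0.
have [m1|m1] := leqP (m v) 1.
  have m1E : m v = 1%N by apply/eqP; rewrite eqn_leq m1 m_gt0.
  rewrite m1E expr1 in redGt *.
  have [l [sl ul lP [E [w [wE wP]]]]] := simple_cluster redGt fx (sep fx) g0.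
  exists l; split=> //; exists E, w; split=> //.
  by rewrite wP gx !expr0 expr1n expr1 mul1r !mulr1.
have [N_gt0 [b' Phi0] dv nz] := dec m1; have [Ax Dx] := nz x fx.
have [Er AG] := series_decomposition dv.
(* Chosen so that e m_v = (M + 1) N_v: the power t^N in front of the error term becomes the m-th
   power of tau^e. *)
pose e := ((M.+1 %/ m v) * N v)%N.
have ME : M.+1 = (\prod_v m v)%N by rewrite /M prednK // prodn_gt0.
have mM : (m v %| M.+1)%N by rewrite ME (bigD1 v) //= dvdn_mulr.
have em : (e * m v = M.+1 * N v)%N by rewrite /e mulnAC divnK.
have e_gt0 : (0 < e)%N by rewrite muln_gt0 N_gt0 andbT divn_gt0 // dvdn_leq.
pose ex : {rmorphism {poly R} -> {poly R}} := map_poly (expand M).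
have cstE (p : {poly k}) : ex (map_poly (@fps_const k) p) = map_poly (@fps_const k) p.
  by rewrite /ex /= -map_poly_comp; apply: eq_map_poly => a /=; rewrite expand_const.
have AGt : map_poly (@fps_const k) (A v) * Gt = map_poly (expand M) (swap (Phi v)) ^+ m v +
    (tau ^+ (e * m v))%:P * (map_poly (@fps_const k) (Dl v) +
      tau%:P * ((tau ^+ M)%:P * map_poly (expand M) Er)).
  have := congr1 ex AG.
  rewrite (rmorphM ex) cstE => ->; rewrite (rmorphD ex) (rmorphXn ex) !(rmorphM ex) (rmorphD ex)
    (rmorphM ex) cstE.
  rewrite /ex /= !map_polyC /=.
  by rewrite rmorphXn /= expand_tau -exprM em mulrA -polyCM -exprS.
have redPhi : red (map_poly (expand M) (swap (Phi v))) = f v * b' by rewrite expandK red_swap.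
have [l [sl ul lP [E [w [wE wP]]]]] := ramified_cluster char_k (m_gt0 v) e_gt0 AGt redGt redPhi fx
  (sep fx) g0 Ax Dx.
by exists l; split=> //; exists E, w; split=> //; rewrite wP gx.
Qed.

(** The clusters over all pairs (v, x) are disjoint, because distinct [f v] have no common root on
    the line, and they have n elements in total; so they exhaust the roots of [Gt]. The expansion
    preserves leading coefficients, hence the result descends to [G]. *)
Theorem line_discriminant : exists beta delta, [/\ binary_disc n G = tau ^+ beta * delta,
  ccoef delta != 0 &
  (lead_coef (red G) *+ n) * ccoef delta * \prod_v \prod_(x <- s v) (A v).[x] ^+ (m v).-1 =
  (-1) ^+ b * ((lead_coef (red G) *+ n) ^+ n.-1 * \prod_v \prod_(x <- s v) ((m v)%:R ^+ m v *
   ((f v)^`().[x] ^+ m v * cofactor_value v x * (Dl v).[x] ^+ (m v).-1)))].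
Proof.
pose S := [seq (v, x) | v <- enum I, x <- s v].
have SP p : p \in S -> p.2 \in s p.1.
  by move=> /allpairsPdep[v [x [_ xs ->]]].
have exL (p : I * k) : exists l, p \in S -> [/\ size l = m p.1, uniq l,
    forall r, r \in l -> ccoef r = p.2 /\ Gt.[r] = 0 &
    exists E w, \prod_(r <- l) Gt^`().[r] = tau ^+ E * w /\
     ccoef w * (A p.1).[p.2] ^+ (m p.1).-1 = (m p.1)%:R ^+ m p.1 *
     ((f p.1)^`().[p.2] ^+ m p.1 * cofactor_value p.1 p.2 * (Dl p.1).[p.2] ^+ (m p.1).-1)].
  have [pS|_] := boolP (p \in S); last by exists [::].
  by have [l lP] := line_cluster (SP p pS); exists l.
have [L LP] := choice exL.
have prodS (h : I -> k -> k) : \prod_(p <- S) h p.1 p.2 = \prod_v \prod_(x <- s v) h v x.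
  by rewrite /S big_allpairs_dep /= big_enum.
have [E [w [wE wP]]] := clusters_prod (L := L) (D := fun r => Gt^`().[r])
  (a := fun p => (A p.1).[p.2] ^+ (m p.1).-1)
  (c := fun p => (m p.1)%:R ^+ m p.1 *
     ((f p.1)^`().[p.2] ^+ m p.1 * cofactor_value p.1 p.2 * (Dl p.1).[p.2] ^+ (m p.1).-1))
  (fun p pS => let: And4 _ _ _ H := LP p pS in H).
rewrite (prodS (fun v x => (A v).[x] ^+ (m v).-1)) (prodS (fun v x => (m v)%:R ^+ m v *
     ((f v)^`().[x] ^+ m v * cofactor_value v x * (Dl v).[x] ^+ (m v).-1))) in wP.
set T := flatten _ in wE.
have f0 v : f v != 0.
  have : red G != 0 by rewrite -size_poly_gt0 sz_redG.
  by rewrite redG => /prodf_neq0/(_ v isT); apply: contraNneq => ->; rewrite expr0n gtn_eqF.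
have szT : size T = n.
  rewrite size_flatten /shape -map_comp.
  have -> : [seq (size \o L) p | p <- S] = [seq m p.1 | p <- S].
    by apply/eq_in_map => p /LP[].
  rewrite sumnE big_map /S big_allpairs_dep /= big_enum /=.
  rewrite -[n]/(n.+1.-1) -sz_redG redG size_prodX //; apply: eq_bigr => v _.
  by rewrite big_const_seq count_predT iter_addn_0 szs.
have Troot r : r \in T -> Gt.[r] = 0.
  by move=> /flatten_mapP[p /LP[_ _ H _] /H[]].
have uT : uniq T.
  have uS : uniq S.
    apply: allpairs_uniq_dep => [|v _|[v x] [w' y] _ _ /= [<- <-]] //; exact: enum_uniq.
  have inj : {in S &, injective snd}.
    move=> [v x] [w' y] /SP /= xs /SP /= ys E2; congr pair => //; apply/eqP.
    apply: contraT => vw; have := disj vw (rootE xs); by rewrite E2 (rootE ys) eqxx.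
  rewrite /T; elim: (S) uS inj LP => //= p S' IHS /andP[pS' uS'] inj LP'.
  rewrite cat_uniq; have [_ -> rP _] := LP' p (mem_head _ _); rewrite /= IHS //; last 2 first.
  - by move=> a c aS cS; apply: inj; rewrite inE ?aS ?cS orbT.
  - by move=> a aS; apply: LP'; rewrite inE aS orbT.
  rewrite andbT; apply/hasPn => r /flatten_mapP[q qS' rq].
  have [_ _ qP _] := LP' q (mem_behead (s := p :: S') qS').
  apply: contraNN pS' => rp; have -> // : p = q.
  apply: inj; rewrite ?mem_head ?inE ?qS' ?orbT //.
  by have [<- _] := rP r rp; have [<- _] := qP r rq.
have lead0 : lead_coef (red G) != 0 by rewrite lead_coef_eq0 -size_poly_gt0 sz_redG.
have leadE : lead_coef (red G) = ccoef (lead_coef G).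
  by rewrite !lead_coefE sz_redG szG coef_map.
have eG0 : expand M (lead_coef G) != 0.
  by apply: contraNneq lead0 => E0; rewrite leadE -(ccoef_expand M) E0 rmorph0.
have szGt : size Gt = n.+1 by rewrite size_map_poly_id0.
have leadGt : lead_coef Gt = expand M (lead_coef G) by rewrite lead_coef_map_id0 ?rmorph0.
pose tof : {rmorphism R -> laurent k} := @FracField.tofrac R.
have tof_inj : injective tof by move=> x y /eqP; rewrite /tof /= tofrac_eq => /eqP.
(* Poisson's formula needs a field, so it is applied over the Laurent series and pulled back along
   the injection of the power series. *)
have disc : (lead_coef Gt *+ n) * binary_disc n Gt =
    (-1) ^+ b * ((lead_coef Gt *+ n) ^+ n.-1 * \prod_(r <- T) Gt^`().[r]).
  apply: (tof_inj); have szF : size (map_poly tof Gt) = n.+1.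
    by rewrite size_map_poly_id0 // /tof /= tofrac_eq0 lead_coef_eq0 -size_poly_gt0 szGt.
  have leadF : lead_coef (map_poly tof Gt) = tof (lead_coef Gt).
    by rewrite !lead_coefE szF szGt coef_map.
  have rT : all (root (map_poly tof Gt)) (map tof T).
    by apply/allP => _ /mapP[r rT ->]; apply/rootP; rewrite horner_map Troot // rmorph0.
  have szT' : size (map tof T) = n by rewrite size_map.
  have uT' : uniq (map tof T) by rewrite (map_inj_uniq tof_inj).
  have := bP (laurent_pchar0 char_k) szT' n_gt0 szF rT uT'.
  rewrite leadF -map_binary_disc big_map => H.
  have prodE : \prod_(r <- T) (map_poly tof Gt)^`().[tof r] = tof (\prod_(r <- T) Gt^`().[r]).
    by rewrite rmorph_prod; apply: eq_bigr => r _; rewrite deriv_map horner_map.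
  rewrite prodE -rmorphMn in H.
  rewrite (rmorphM tof) H !(rmorphM tof) !(rmorphXn tof) (rmorphN1 tof) //.
pose l := lead_coef G *+ n; have K0 := (pcharf0P _).1 char_k.
have l0 : ccoef l = lead_coef (red G) *+ n by rewrite leadE rmorphMn.
have l0n : ccoef l != 0 by rewrite l0 -mulr_natr mulf_neq0 // K0 -lt0n.
have elE : lead_coef Gt *+ n = expand M l by rewrite leadGt rmorphMn.
rewrite elE -map_binary_disc wE in disc.
have el0 : ccoef (expand M l) != 0 by rewrite ccoef_expand.
have w0 : ccoef w != 0.
  apply: contra_eq_neq wP => ->; rewrite mul0r eq_sym.
  apply/prodf_neq0 => v _; rewrite prodf_seq_neq0; apply/allP => x xs /=.
  have fx := rootE xs; have Dx : (Dl v).[x] ^+ (m v).-1 != 0.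
    have [m1|m1] := leqP (m v) 1; last by rewrite expf_neq0 //; have [_ _ _ /(_ x fx)[]] := dec m1.
    by case: (m v) m1 => [|[|]] //; rewrite expr0 oner_eq0.
  by rewrite !mulf_neq0 // ?expf_neq0 ?sep ?cofactor_value_neq0 ?K0 -?lt0n.
have w'0 : ccoef ((-1) ^+ b * (expand M l ^+ n.-1 * w)) != 0.
  by rewrite !rmorphM !rmorphXn rmorphN1 !mulf_neq0 ?signr_eq0 ?expf_neq0.
have nz a : ccoef a != 0 -> a != 0 by apply: contraNneq => ->; rewrite rmorph0.
have RE : (-1) ^+ b * (expand M l ^+ n.-1 * (tau ^+ E * w)) =
    tau ^+ E * ((-1) ^+ b * (expand M l ^+ n.-1 * w)).
  rewrite [RHS]mulrCA; congr (_ * _); exact: mulrCA.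
rewrite RE in disc.
have D0 : binary_disc n G != 0.
  apply: contra_eq_neq (disc) => ->; rewrite rmorph0 mulr0 eq_sym.
  by rewrite mulf_neq0 ?expf_neq0 ?tau_neq0 //; apply: nz.
have [beta [delta [DE d0]]] := fps_order D0; exists beta, delta; split=> //.
have E1 : tau ^+ (M.+1 * beta) * (expand M l * expand M delta) =
    tau ^+ E * ((-1) ^+ b * (expand M l ^+ n.-1 * w)).
  have := disc; rewrite DE rmorphM rmorphXn /= expand_tau -exprM => E2.
  by rewrite mulrCA E2.
have := tau_order_unique _ w'0 E1.
rewrite !rmorphM !rmorphXn rmorphN1 /= !ccoef_expand l0 mulf_neq0 -?l0 // => /(_ isT) E2.
by rewrite E2 -wP !mulrA.
Qed.
End LineDiscriminant.

(** * Limits of curves over k((t)) *)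

Lemma scale_shuffle (L : fieldType) n (h D : {mpoly L[n]}) (a b c : L) :
  (a * (b * c^-1) * c) *: (h * D) = (a *: (b *: (c^-1 *: h))) * (c *: D).
Proof. by rewrite -!scalerAl -scalerAr !scalerA !mulrA. Qed.

Section Limit.
Variable k : fieldType.
Local Notation R := (fps k).
Local Notation red := (map_mpoly (@ccoef k)).
Local Notation tof := (@to_laurent k).

Lemma fps_shift_is_zmod_morphism : zmod_morphism (@fps_shift k).
Proof. by move=> a b; apply: fpsP. Qed.
HB.instance Definition _ := GRing.isZmodMorphism.Build R R (@fps_shift k)
  fps_shift_is_zmod_morphism.

HB.instance Definition _ := GRing.RMorphism.copy tof (@FracField.tofrac R).

Lemma to_laurent_inj : injective tof.
Proof. by move=> x y /eqP; rewrite /to_laurent tofrac_eq => /eqP. Qed.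

Lemma map_to_laurent_inj : injective (map_mpoly tof : {mpoly R[3]} -> _).
Proof.
move=> H H' E; apply/mpolyP => m; apply: to_laurent_inj.
by rewrite -!mcoeff_map_mpoly E.
Qed.

Lemma laurent_frac (c : laurent k) : exists a b, b != 0 /\ tof b * c = tof a.
Proof.
elim/quotW: c => x; have x0 := denom_ratioP x; exists (frac x).1, (frac x).2; split=> //.
rewrite /to_laurent; unlock FracField.tofrac; rewrite -[LHS]FracField.pi_mul.
apply/eqmodP; rewrite /= FracField.equivfE /FracField.mulf /=.
by rewrite !numden_Ratio ?oner_eq0 ?mulf_neq0 ?oner_eq0 //= mulr1 mul1r.
Qed.

Lemma clear_denominators (D : {mpoly (laurent k)[3]}) : exists b D',
  b != 0 /\ map_mpoly tof D' = tof b *: D.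
Proof.
elim/mpolyind: D => [|c m D _ _ [b [D' [b0 DE]]]].
  by exists 1, 0; rewrite oner_eq0 rmorph0 scaler0.
have [a [b' [b'0 cE]]] := laurent_frac c.
exists (b * b'), ((b * a) *: 'X_[m] + b' *: D'); split; first by rewrite mulf_neq0.
rewrite rmorphD /= !map_mpolyZ map_mpolyX DE /= scalerDr !scalerA.
have tM x y : tof (x * y) = tof x * tof y by apply: rmorphM.
rewrite !tM -cE mulrA; congr (_ + _ *: _); exact: mulrC.
Qed.

Lemma red_eq0 (H : {mpoly R[3]}) : red H = 0 -> exists H', H = tau *: H'.
Proof.
move=> H0; exists (map_mpoly (@fps_shift k) H); apply/mpolyP => m.
rewrite mcoeffZ mcoeff_map_mpoly; apply: ccoef_eq0.
by rewrite -mcoeff_map_mpoly H0 mcoeff0.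
Qed.

Lemma tau_primitive_part (D : {mpoly R[3]}) : D != 0 -> exists i D', D = tau ^+ i *: D' /\ red D'
  != 0.
Proof.
move=> D0; have [m [s Dm]] : exists m s, fps_coef D@_m s != 0.
  apply: contrapT => /forallNP nD; case/eqP: D0; apply/mpolyP => m; apply: fpsP => s.
  rewrite mcoeff0; apply/eqP/negPn/negP => Dm; apply: (nD m); by exists s.
elim: s D Dm {D0} => [|s IHs] D Dm; have [D0|D0] := eqVneq (red D) 0;
    try by (exists 0%N, D; rewrite scale1r).
  by have := congr1 (mcoeff m) D0; rewrite mcoeff_map_mpoly mcoeff0 => /eqP; rewrite (negPf Dm).
have [D1 DE] := red_eq0 D0; have [|i [D' [D1E D'0]]] := IHs D1.
  by move: Dm; rewrite DE mcoeffZ coef_tauM.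
by exists i.+1, D'; rewrite DE D1E scalerA -exprS.
Qed.

Lemma primitive_multiple (D : {mpoly (laurent k)[3]}) : D != 0 -> exists c D',
  [/\ c != 0, map_mpoly tof D' = c *: D & red D' != 0].
Proof.
move=> D0; have [b [D1 [b0 D1E]]] := clear_denominators D.
have tb0 : tof b != 0 by rewrite /to_laurent tofrac_eq0.
have tt0 i : tof (tau ^+ i) != 0 by rewrite /to_laurent tofrac_eq0 expf_neq0 ?tau_neq0.
have D10 : D1 != 0.
  apply: contraNneq D0 => D10; move/esym/eqP: D1E; rewrite D10 rmorph0.
  by rewrite scaler_eq0 (negPf tb0).
have [i [D' [DE D'0]]] := tau_primitive_part D10.
exists ((tof (tau ^+ i))^-1 * tof b), D'; split=> //.
  by rewrite mulf_neq0 ?invr_eq0.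
by rewrite -scalerA -D1E DE map_mpolyZ scalerA mulVf // scale1r.
Qed.

(** Reduction modulo tau takes values in a domain, so a factor tau of [h * D] must come from [h]
    when the reduction of [D] is nonzero. *)
Lemma primitive_divides (D H h : {mpoly R[3]}) s : red D != 0 ->
  tau ^+ s *: H = h * D -> divides D H.
Proof.
move=> D0; elim: s h => [|s IHs] h E; first by exists h; rewrite -E scale1r.
have h0 : red h = 0.
  have := congr1 red E; rewrite map_mpolyZ rmorphXn /= ccoef_tau exprS mul0r scale0r rmorphM /=.
  by move/esym/eqP; rewrite mulf_eq0 (negPf D0) orbF => /eqP.
have [h' hE] := red_eq0 h0; apply: (IHs h').
have t0 : tau%:MP != 0 :> {mpoly R[3]} by rewrite mpolyC_eq0 tau_neq0.
apply: (mulfI t0); rewrite !mul_mpolyC scalerA -exprS E hE scalerAl //.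
Qed.

(** The ideal of the closure is generated by D': denominators are units times powers of tau, and
    these powers cancel because D' has nonzero reduction. The reduction of the generator then
    generates the ideal of the special fiber. *)
Theorem limit_divisorI (D : {mpoly (laurent k)[3]}) (D' : {mpoly R[3]}) c d (E : divisor k) :
  D \is d.-homog -> c != 0 -> map_mpoly tof D' = c *: D -> red D' != 0 ->
  E =1 zero_divisor (red D') -> limit_divisor D E.
Proof.
move=> Dh c0 DE D'0 EE; exists (red D').
have clos H : closure_ideal D H <-> divides D' H.
  split=> [[h hE]|[h hE]]; last first.
    by exists (c *: map_mpoly tof h); rewrite hE rmorphM /= DE -scalerAl scalerAr.
  have [b [h' [b0 h'E]]] := clear_denominators (c^-1 *: h).
  have [s [u [bE u0]]] := fps_order b0.
  have [v vu] := fps_inverse u0.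
  apply: (primitive_divides (h := v *: h') (s := s)) => //.
  apply: map_to_laurent_inj; rewrite map_mpolyZ hE rmorphM /= map_mpolyZ h'E DE bE.
  have tM x y : tof (x * y) = tof x * tof y by apply: rmorphM.
  have E1 : tof (tau ^+ s) = tof v * (tof (tau ^+ s * u) * c^-1) * c.
    by rewrite mulrA -mulrA mulVf // mulr1 -tM mulrCA vu mulr1.
  by rewrite -scale_shuffle -E1.
split=> //.
- have D'h : D' \is d.-homog.
    apply/dhomogP => m mD; apply: (dhomog_mf Dh); move: mD; rewrite !mcoeff_msupp.
    apply: contraNneq => Dm; have := congr1 (mcoeff m) DE.
    rewrite mcoeff_map_mpoly mcoeffZ Dm mulr0 => /eqP.
    by rewrite /to_laurent tofrac_eq0.
  exact: dhomog_msize (map_mpoly_homog (@ccoef k) D'h).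
- have redM (a b : {mpoly R[3]}) : red (a * b) = red a * red b by apply: rmorphM.
  apply/seteqP; split=> [_ [H /clos[h ->] <-]|H [h ->]] /=.
    by exists (red h); exact: redM.
  exists (map_mpoly (@fps_const k) h * D'); first by apply/clos; exists (map_mpoly (@fps_const k)
    h).
  rewrite -[LHS]/(red _) redM; congr (_ * _); apply/mpolyP => m.
  by rewrite !mcoeff_map_mpoly.
Qed.
End Limit.

(** * The degrees in the decomposition *)

Section HomogeneousCoefs.
Variables (n : nat) (R : fieldType).
Implicit Types P Q : {poly {mpoly R[n]}}.

Definition homog_coefs b P := forall i, P`_i \is b.-homog.

Lemma homog_coefsM b c P Q : homog_coefs b P -> homog_coefs c Q -> homog_coefs (b + c) (P * Q).
Proof.
by move=> Ph Qh i; rewrite coefM; apply: rpred_sum => j _; apply: dhomogM.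
Qed.

Lemma homog_coefsX b P m : homog_coefs b P -> homog_coefs (m * b) (P ^+ m).
Proof.
move=> Ph; elim: m => [|m IHm] i.
  by rewrite expr0 coef1; case: eqP => _; rewrite ?dhomog1 // rpred0.
by rewrite exprS mulSn; apply: homog_coefsM.
Qed.

(** Write P as its truncation below index j plus a multiple of 'X^j. In the Taylor expansion of the
    m-th power the quadratic remainder is divisible by 'X^(2j), so only the linear term meets index
    j. *)
Lemma coef_exp_leading (S : comNzRingType) (P : {poly S}) m j : (0 < j)%N ->
  (P ^+ m)`_j = P`_0 ^+ m.-1 * P`_j *+ m + (take_poly j P ^+ m)`_j.
Proof.
move=> j_gt0; pose T := take_poly j P; pose h := 'X^j * drop_poly j P.
have PE : P = T + h by rewrite /h mulrC poly_take_drop.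
have [r rE] := taylor2 ('X^m : {poly {poly S}}) T h.
move: rE; rewrite !hornerXn derivXn hornerMn hornerXn -PE => ->.
have low (u : {poly S}) : ('X^j * u)`_j = u`_0 by rewrite coefXnM ltnn subnn.
have T0 : T`_0 = P`_0 by rewrite coef_take_poly j_gt0.
rewrite !coefD addrC [in RHS]addrC addrA; congr (_ + _).
have -> : (h ^+ 2 * r)`_j = 0.
  by rewrite /h expr2 -!mulrA low coef0M coefXnM j_gt0 mulr0.
rewrite add0r //.
rewrite /h -mulrA low coef0M coefMn coef_drop_poly add0n mulrnAr mulrC.
by rewrite -[(T ^+ _)`_0]horner_coef0 horner_exp horner_coef0 T0.
Qed.

(** The coefficient of index j of P^m is m P_0^(m-1) P_j plus terms in lower coefficients, so
    induction makes P_j homogeneous of the degree of P_0; characteristic 0 allows the division by m.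
    This determines the degree of [Delta v], the term left over at index N. *)
Lemma homog_root_coefs (P : {poly {mpoly R[n]}}) m N d : [pchar R] =i pred0 ->
  (0 < m)%N -> P`_0 != 0 -> (size P <= N)%N ->
  (forall i, (i < N)%N -> (P ^+ m)`_i \is d.-homog) -> homog_coefs d (P ^+ m).
Proof.
move=> R0 m_gt0 P00 szP Ph.
have N_gt0 : (0 < N)%N by apply: leq_trans szP; rewrite size_poly_gt0; apply: contraNneq P00 =>
  ->; rewrite coef0.
have P0m : (P ^+ m)`_0 = P`_0 ^+ m by rewrite -!horner_coef0 horner_exp.
pose b := (msize P`_0).-1.
have P0h : P`_0 \is b.-homog.
  have /homog_factor : P`_0 * P`_0 ^+ m.-1 \is d.-homog by rewrite -exprS prednK // -P0m; apply: Ph.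
  by rewrite -exprS prednK // expf_neq0 // => /(_ isT).
have dE : d = (m * b)%N.
  have h1 : P`_0 ^+ m \is d.-homog by rewrite -P0m; apply: Ph.
  by rewrite mulnC; apply: (dhomog_uniq (expf_neq0 m P00) h1 (dhomogMn m P0h)).
rewrite dE; apply: homog_coefsX => i.
have [leNi|] := leqP N i; first by rewrite nth_default ?rpred0 ?(leq_trans szP).
elim/ltn_ind: i => -[|j] IHj ltjN //.
have Th : homog_coefs b (take_poly j.+1 P).
  move=> i; rewrite coef_take_poly; case: ltnP => [lti|_]; last exact: rpred0.
  by apply: IHj => //; apply: ltn_trans ltjN.
have [->|Pj] := eqVneq P`_j.+1 0; first exact: rpred0.
have E := coef_exp_leading P m (ltn0Sn j).
have Ph' : P`_0 ^+ m.-1 * P`_j.+1 *+ m \is (m * b).-homog.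
  rewrite -[X in X \is _](addrK (take_poly j.+1 P ^+ m)`_j.+1) -E -dE.
  by apply: rpredB; [apply: Ph|rewrite dE; apply: homog_coefsX].
have mR : m%:R != 0 :> R by rewrite ((pcharf0P _).1 R0) -lt0n.
have P1h : P`_j.+1 * P`_0 ^+ m.-1 \is (m * b).-homog.
  rewrite mulrC -[X in X \is _]scale1r -(mulVf mR) -scalerA scaler_nat.
  exact: rpredZ.
have P10 : P`_j.+1 * P`_0 ^+ m.-1 != 0 by rewrite mulf_neq0 ?expf_neq0.
have P2h := homog_factor P1h P10.
have := dhomog_uniq P10 P1h (dhomogM P2h (dhomogMn m.-1 P0h)).
rewrite -{1}(prednK m_gt0) mulSn [(b * _)%N]mulnC => /addIn bE.
by rewrite bE; exact: P2h.
Qed.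
End HomogeneousCoefs.

(** * General lines and the restriction of the series *)

Section GoodLines.
Variable K : fieldType.
Hypothesis Kinf : infinite_ring K.

(** [p] is taken as the intersection of an unknown line l with a fixed line v, so that F(p) is a
    polynomial in l. It is not the zero polynomial, because v passes through a point off the
    curve. *)
Lemma good_line_exists (F W : {mpoly K[3]}) n : (0 < n)%N -> F \is n.-homog ->
  F != 0 -> W != 0 -> exists p q, F.@[p] != 0 /\ W.@[join_line p q] != 0.
Proof.
move=> n_gt0 Fh F0 W0; have [z Fz] := mpoly_neq0_point Kinf F0.
have [v [i [vi vz]]] := orthogonal_exists z; have [x zE] := join_line_onto vi vz.
pose E : {mpoly K[3]} := mmap (@mpolyC 3 K) (join_line (fun i => 'X_i) (fun i => (v i)%:MP)) F.
have EE y : E.@[y] = F.@[join_line y v].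
  rewrite /E -[LHS]/(meval y _) (mmap_comp (meval y)); congr (mmap _ _ _).
    by apply/funext => c /=; rewrite mevalC.
  by apply/funext => j /=; rewrite /join_line mevalB !mevalM !mevalC !mevalXU.
have E0 : E != 0 by apply: (@eval_neq0 _ _ x); rewrite EE -zE.
have [l] := mpoly_neq0_point Kinf (mulf_neq0 E0 W0).
rewrite mevalM mulf_eq0 negb_or EE => /andP[Fp Wl].
have [j pj] : exists j, join_line l v j != 0.
  apply: contrapT => /forallNP np; case/eqP: Fp.
  have {}np a : join_line l v a = 0 * z a by rewrite mul0r; apply/eqP/negPn/negP/np.
  by rewrite (meval_eq _ np) (meval_scale _ _ Fh) expr0n gtn_eqF // mul0r.
have pl : dot3 (join_line l v) l = 0 by rewrite /dot3 !join_lineE; ring.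
have [y lE] := join_line_onto pj pl.
exists (join_line l v), (fun i => - y i); split=> //.
rewrite (_ : join_line _ _ = l) // [RHS]lE; move: (join_line l v) => p.
by apply/funext => a; rewrite /join_line; ring.
Qed.
End GoodLines.

Section SeriesRestriction.
Variables (k : fieldType) (n : nat) (F : nat -> {mpoly k[3]}).
Hypothesis Fh : forall i, F i \is n.-homog.
Variables p q : 'I_3 -> k.
Local Notation cp := (fun i => fps_const (p i)).
Local Notation cq := (fun i => fps_const (q i)).
Local Notation S := (series_form n F).

Lemma series_form_homog : S \is n.-homog.
Proof.
apply: rpred_sum => m _; have [mn|mn] := eqVneq (mdeg m) n.
  by apply: rpredZ; rewrite dhomogX; apply/eqP.
rewrite [Fps _](_ : _ = 0) ?scale0r ?rpred0 //.
by apply: fpsP => i /=; apply: dhomog_nemf_coeff (Fh i) mn.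
Qed.

Lemma restrict_lineD (R : comNzRingType) (G H : {mpoly R[3]}) x y :
  restrict_line (G + H) x y = restrict_line G x y + restrict_line H x y.
Proof. exact: mmapD. Qed.

Lemma restrict_lineZ (R : comNzRingType) c (G : {mpoly R[3]}) x y :
  restrict_line (c *: G) x y = c%:P * restrict_line G x y.
Proof. exact: mmapZ. Qed.

Lemma restrict_line_sum (R : comNzRingType) (J : finType) (c : J -> R) (G : J -> {mpoly R[3]}) x y :
  restrict_line (\sum_j c j *: G j) x y = \sum_j (c j)%:P * restrict_line (G j) x y.
Proof.
rewrite (big_morph (fun G => restrict_line G x y) (fun G H => restrict_lineD G H x y) (mmap0 _ _)).
by apply: eq_bigr => j _; exact: restrict_lineZ.
Qed.

Lemma layer_sum (J : finType) (H : J -> {poly fps k}) i :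
  layer i (\sum_j H j) = \sum_j layer i (H j).
Proof.
apply: (big_morph (layer i)) => [G G'|].
  by apply/polyP => l; rewrite coefD !coef_layer coefD.
by apply/polyP => l; rewrite coef_layer !coef0.
Qed.

Lemma layer_scale i a (g : {poly k}) :
  layer i (a%:P * map_poly (@fps_const k) g) = (fps_coef a i)%:P * g.
Proof.
have cM c : fps_coef (a * fps_const c) i = fps_coef a i * c.
  rewrite mulrC fps_coefM big_ord_recl big1 ?addr0 => [|j _]; first by rewrite subn0 mulrC.
  by rewrite mul0r.
by apply/polyP => l; rewrite coef_layer !coefCM coef_map cM.
Qed.

Lemma layer_restrict_series i : layer i (restrict_line S cp cq) = restrict_line (F i) p q.
Proof.
have mon (m : 'X_{1..3}) : restrict_line 'X_[m] cp cq =
    map_poly (@fps_const k) (restrict_line 'X_[m] p q).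
  by rewrite map_restrict_line map_mpolyX.
have szF : (msize (F i) <= n.+1)%N.
  have [->|F0] := eqVneq (F i) 0; first by rewrite msize0.
  by rewrite -(homog_msize_pred (Fh i) F0); apply: leqSpred.
rewrite [in RHS](mpolywE szF) /series_form !restrict_line_sum layer_sum; apply: eq_bigr => m _.
by rewrite mon layer_scale.
Qed.
End SeriesRestriction.

(** * The discriminant on a general line *)

Lemma disc_constant (K : fieldType) d : [pchar K] =i pred0 -> (0 < d)%N ->
  exists2 c : K, c != 0 & forall (s : seq K) (G : {poly K}), size s = d -> size G = d.+1 ->
    all (root G) s -> uniq s ->
    lead_coef G ^+ d.-1 * \prod_(x <- s) G^`().[x] = c * (lead_coef G * binary_disc d G).
Proof.
move=> K0 d_gt0; have [b bP] := binary_disc_roots d.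
have dn : d%:R != 0 :> K by rewrite ((pcharf0P _).1 K0) -lt0n.
have dn' := expf_neq0 d.-1 dn.
exists ((-1) ^+ b * (d%:R / d%:R ^+ d.-1)).
  by rewrite !mulf_neq0 ?signr_eq0 ?invr_eq0.
move=> s G szs szG rs us; have := bP K s G K0 szs d_gt0 szG rs us.
rewrite -[_ *+ d]mulr_natl exprMn.
have := sqrr_sign K b; rewrite expr2.
move: ((-1) ^+ b : K) (binary_disc d G) (\prod_(x <- s) _) (lead_coef G) => e B Q l ee E.
apply: (mulfI dn'); transitivity (e * (d%:R * l * B)).
  by rewrite E [RHS]mulrA ee mul1r mulrA.
by field.
Qed.

Section GoodLine.
Variable k : closedFieldType.
Hypothesis char_k : [pchar k] =i pred0.
Variables (n : nat) (F : nat -> {mpoly k[3]}) (I : finType) (f : I -> {mpoly k[3]}).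
Variables (m N : I -> nat) (A Dl : I -> {mpoly k[3]}) (Psi : I -> {poly {mpoly k[3]}}).
Variables (d a : I -> nat) (kappa : I -> k) (b : bool).
Hypotheses (n_gt0 : (0 < n)%N) (Fh : forall i, F i \is n.-homog).
Hypothesis m_gt0 : forall v, (0 < m v)%N.
Hypotheses (fp : forall v, prime_elt (f v)) (fh : forall v, f v \is (d v).-homog).
Hypothesis d_gt0 : forall v, (0 < d v)%N.
Hypothesis F0E : F 0%N = \prod_v f v ^+ m v.
Hypothesis decomp : forall v, (1 < m v)%N -> [/\ (0 < N v)%N, A v \is (a v).-homog,
  Dl v \is (a v + n).-homog, A v != 0 /\ Dl v != 0 & (exists B, (Psi v)`_0 = f v * B) /\
  forall i, (i <= N v)%N -> A v * F i = (Psi v ^+ m v + (Dl v)%:P * 'X^(N v))`_i].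
Hypothesis bP : forall (F : fieldType) (s : seq F) (G : {poly F}),
  [pchar F] =i pred0 -> size s = n -> (0 < n)%N -> size G = n.+1 -> all (root G) s -> uniq s ->
  (lead_coef G *+ n) * binary_disc n G =
    (-1) ^+ b * ((lead_coef G *+ n) ^+ n.-1 * \prod_(x <- s) G^`().[x]).
Hypothesis kappaP : forall v (s : seq k) (G : {poly k}), size s = d v -> size G = (d v).+1 ->
  all (root G) s -> uniq s ->
  lead_coef G ^+ (d v).-1 * \prod_(x <- s) G^`().[x] = kappa v * (lead_coef G * binary_disc (d v)
    G).

Variables p q : 'I_3 -> k.
Local Notation l := (join_line p q).
Hypothesis F0p : (F 0%N).@[p] != 0.
Hypothesis disc_l : forall v, (dual_form (f v)).@[l] != 0.
Hypothesis res_l : forall v w, v != w -> (line_res (f v) (f w)).@[l] != 0.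
Hypothesis decomp_l : forall v, (1 < m v)%N ->
  (line_res (f v) (A v)).@[l] != 0 /\ (line_res (f v) (Dl v)).@[l] != 0.

Let rest : {rmorphism {mpoly k[3]} -> {poly k}} :=
  mmap (@polyC k) (fun i => (p i)%:P * 'X + (q i)%:P).
Let fl v := restrict_line (f v) p q.
Let lam v := (f v).@[p].
Let f0 v : f v != 0. Proof. by case: (fp v). Qed.

Let lam0 v : lam v != 0.
Proof.
move: F0p; rewrite F0E rmorph_prod => /prodf_neq0/(_ v isT).
by rewrite rmorphXn /=; apply: contraNneq; rewrite -/(lam v) => ->; rewrite expr0n gtn_eqF.
Qed.

Let flE v : size (fl v) = (d v).+1 /\ lead_coef (fl v) = lam v.
Proof.
have cf : (fl v)`_(d v) = lam v by apply: coef_restrict_line.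
have sz : size (fl v) = (d v).+1.
  apply/eqP; rewrite eqn_leq size_restrict_line //= ltnNge; apply: contraNN (lam0 v) => sz.
  by rewrite -cf nth_default.
by split; rewrite // lead_coefE sz.
Qed.

Let sep v x : (fl v).[x] = 0 -> (fl v)^`().[x] != 0.
Proof.
move=> fx; apply: contraTneq (disc_l v) => f'x.
have [_ DE] := dual_formP (homogE (fh v)); rewrite (homog_msize_pred (fh v) (f0 v)) in DE.
rewrite DE negbK; have [sz lc] := flE v.
have [d1|d1] := leqP (d v) 1; last by rewrite (binary_disc_common_root d1 _ fx f'x) ?sz.
have d1E : d v = 1%N by apply/eqP; rewrite eqn_leq d1 d_gt0.
move: f'x (lam0 v); rewrite -lc lead_coefE sz d1E /=.
have -> : (fl v)^`() = ((fl v)`_1)%:P.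
  apply/polyP => -[|i]; rewrite coefC coef_deriv //= nth_default ?mul0rn // sz d1E //.
by rewrite hornerC => ->; rewrite eqxx.
Qed.

Let root_res v g x e : g \is e.-homog -> g != 0 -> (line_res (f v) g).@[l] != 0 ->
  (fl v).[x] = 0 -> (restrict_line g p q).[x] != 0.
Proof.
move=> gh g0 R0 fx; apply: contraNneq R0 => gx.
rewrite (line_res_eval p q (fh v) gh (f0 v) g0).
by rewrite (res_common_root _ _ _ fx gx) ?size_restrict_line // addn_gt0 d_gt0.
Qed.

Let roots_exist : exists s : I -> seq k, forall v,
  [/\ uniq (s v), size (s v) = d v & all (root (fl v)) (s v)].
Proof.
have ex v : exists s, [/\ uniq s, size s = d v & all (root (fl v)) s].
  by have [s [us szs rs _]] := split_separable (flE v).1 (@sep v); exists s.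
by have [s sP] := choice ex; exists s.
Qed.

Let G := restrict_line (series_form n F) (fun i => fps_const (p i)) (fun i => fps_const (q i)).

Let layerG i : layer i G = rest (F i). Proof. exact: layer_restrict_series. Qed.

Let redG : map_poly ccoef G = \prod_v fl v ^+ m v.
Proof.
rewrite -[LHS]/(layer 0 G) layerG F0E rmorph_prod; apply: eq_bigr => v _.
by rewrite rmorphXn.
Qed.

Let sz_redG : size (map_poly ccoef G) = n.+1.
Proof.
rewrite -[map_poly _ _]/(layer 0 G) layerG; apply/eqP; rewrite eqn_leq size_restrict_line //=.
by rewrite ltnNge; apply: contraNN F0p => sz; rewrite -(coef_restrict_line p q (Fh 0)) nth_default.
Qed.

Let szG : size G = n.+1.
Proof.
apply/eqP; rewrite eqn_leq size_restrict_line; last exact: series_form_homog.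
by rewrite -sz_redG size_poly.
Qed.

Let fl0 v : fl v != 0. Proof. by rewrite -size_poly_gt0 (flE v).1. Qed.

Let nE : n = (\sum_v m v * d v)%N.
Proof.
rewrite -[LHS]/(n.+1.-1) -sz_redG redG size_prodX //; apply: eq_bigr => v _.
by rewrite (flE v).1.
Qed.

Let line_res_prod v g e s : g \is e.-homog -> g != 0 -> uniq s -> size s = d v ->
  all (root (fl v)) s ->
  (line_res (f v) g).@[l] = lam v ^+ e * \prod_(x <- s) (restrict_line g p q).[x].
Proof.
move=> gh g0 us szs rs; rewrite (line_res_eval p q (fh v) gh (f0 v) g0) -/(fl v).
have [sz <-] := flE v; rewrite -szs in sz *.
by rewrite (res_roots sz rs us) ?size_restrict_line.
Qed.

(** With [x] the evaluation at a line, this is the factor of index v on the right side of the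
    identity of forms. *)
Definition line_factor v (x : {mpoly k[3]} -> k) : k :=
  x (dual_form (f v)) ^+ m v * (\prod_(w | w != v) x (line_res (f v) (f w)) ^+ m w) *
  x (line_res (f v) (Dl v)) ^+ (m v).-1.

(** Poisson's formula turns the products over the roots of each [f v] into resultants and
    discriminants at the line, up to powers of the leading coefficients [lam v]; these cancel for
    reasons of degree. *)
Theorem good_line : exists beta delta, [/\ binary_disc n G = tau ^+ beta * delta,
  ccoef delta != 0 &
  n%:R * ccoef delta * \prod_v (line_res (f v) (A v)).@[l] ^+ (m v).-1 =
  (-1) ^+ b * n%:R ^+ n.-1 * (\prod_v ((m v)%:R ^+ (m v * d v) * kappa v ^+ m v)) *
  \prod_v line_factor v (meval l)].
Proof.
have [s sP] := roots_exist.
have us v : uniq (s v) by case: (sP v).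
have szs v : size (s v) = d v by case: (sP v).
have rs v : all (root (fl v)) (s v) by case: (sP v).
pose Al v := rest (A v); pose Dll v := rest (Dl v); pose Phi v := map_poly rest (Psi v).
have disj v w x : v != w -> (fl v).[x] = 0 -> (fl w).[x] != 0.
  by move=> vw; apply: root_res (fh w) (f0 w) (res_l vw).
have dec v : (1 < m v)%N -> [/\ (0 < N v)%N, exists b, (Phi v)`_0 = fl v * b,
    forall i, (i <= N v)%N -> Al v * layer i G = (Phi v ^+ m v + (Dll v)%:P * 'X^(N v))`_i &
    forall x, (fl v).[x] = 0 -> (Al v).[x] != 0 /\ (Dll v).[x] != 0].
  move=> m1; have [N_gt0 Ah Dh [A0 D0] [[B B0] dv]] := decomp m1; have [Al0 Dl0] := decomp_l m1.
  split=> // [|i lei|x fx].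
  - by exists (rest B); rewrite coef_map B0; exact: (rmorphM rest).
  - rewrite layerG -(rmorphM rest) dv // -(coef_map rest); congr (_`_i).
    by rewrite rmorphD rmorphXn rmorphM /= map_polyC map_polyXn.
  - by split; [apply: root_res Ah A0 Al0 fx|apply: root_res Dh D0 Dl0 fx].
have szs' v : size (s v) = (size (fl v)).-1 by rewrite (flE v).1 szs.
have [beta [delta [DE d0 dE]]] := line_discriminant char_k bP n_gt0 m_gt0 szG sz_redG redG
  (@sep) disj us szs' rs dec.
exists beta, delta; split=> //.
pose Lam := \prod_v lam v ^+ m v.
have LamE : lead_coef (map_poly ccoef G) = Lam.
  by rewrite redG lead_coef_prod; apply: eq_bigr => v _; rewrite lead_coef_exp (flE v).2.
have Lam0 : Lam != 0 by apply/prodf_neq0 => v _; rewrite expf_neq0.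
rewrite LamE -mulr_natl in dE.
have RA v : (line_res (f v) (A v)).@[l] ^+ (m v).-1 =
    lam v ^+ (a v * (m v).-1) * \prod_(x <- s v) (Al v).[x] ^+ (m v).-1.
  have [m1|m1] := leqP (m v) 1.
    have -> : (m v).-1 = 0%N by case: (m v) m1 => [|[|]].
    by rewrite muln0 big1 ?mulr1.
  have [_ Ah _ [A0 _] _] := decomp m1.
  by rewrite (line_res_prod Ah A0 (us v) (szs v) (rs v)) exprMn -exprM prodrXl.
have RD v : (line_res (f v) (Dl v)).@[l] ^+ (m v).-1 =
    lam v ^+ ((a v + n) * (m v).-1) * \prod_(x <- s v) (Dll v).[x] ^+ (m v).-1.
  have [m1|m1] := leqP (m v) 1.
    have -> : (m v).-1 = 0%N by case: (m v) m1 => [|[|]].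
    by rewrite muln0 big1 ?mulr1.
  have [_ _ Dh [_ D0] _] := decomp m1.
  by rewrite (line_res_prod Dh D0 (us v) (szs v) (rs v)) exprMn -exprM prodrXl.
pose PB v := \prod_(x <- s v) ((m v)%:R ^+ m v * ((fl v)^`().[x] ^+ m v *
   cofactor_value fl m v x * (Dll v).[x] ^+ (m v).-1)).
have factor v : lam v ^+ (m v * n.-1) * lam v ^+ (a v * (m v).-1) * PB v =
    (m v)%:R ^+ (m v * d v) * kappa v ^+ m v * (lam v ^+ m v * line_factor v (meval l)).
  pose Pf := \prod_(x <- s v) (fl v)^`().[x]; pose Pw w := \prod_(x <- s v) (fl w).[x].
  pose PD := \prod_(x <- s v) (Dll v).[x] ^+ (m v).-1; pose Sg := (\sum_(w | w != v) m w * d w)%N.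
  have PBE : PB v = (m v)%:R ^+ (m v * d v) * (Pf ^+ m v * (\prod_(w | w != v) Pw w ^+ m w) * PD).
    rewrite /PB !big_split /= big_const_seq count_predT szs iter_mulr_1 -exprM prodrXl.
    congr (_ * (_ * _ * _)); rewrite /cofactor_value exchange_big /=.
    by apply: eq_bigr => w _; rewrite prodrXl.
  have RW : \prod_(w | w != v) (line_res (f v) (f w)).@[l] ^+ m w =
      lam v ^+ Sg * \prod_(w | w != v) Pw w ^+ m w.
    rewrite -prodrXr -big_split /=; apply: eq_bigr => w _.
    by rewrite (line_res_prod (fh w) (f0 w) (us v) (szs v) (rs v)) exprMn -exprM mulnC.
  have disc : lam v ^+ (d v).-1 * Pf = kappa v * (lam v * (dual_form (f v)).@[l]).
    have [_ ->] := dual_formP (homogE (fh v)); rewrite (homog_msize_pred (fh v) (f0 v)).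
    have [sz lc] := flE v; have := kappaP (szs v) sz (rs v) (us v).
    by rewrite lc.
  have LF : line_factor v (meval l) = (dual_form (f v)).@[l] ^+ m v *
      (lam v ^+ Sg * \prod_(w | w != v) Pw w ^+ m w) * (lam v ^+ ((a v + n) * (m v).-1) * PD).
    by congr (_ * _ * _); [exact: RW|exact: RD].
  rewrite PBE LF.
  (* The balance of the exponents of [lam v]; it rests on n being the sum of the m_w d_w, and on the
     degree a + n of [Dl v]. *)
  have ar : (m v * n.-1 + a v * (m v).-1 = (d v).-1 * m v + Sg + (a v + n) * (m v).-1)%N.
    have nS : n = (m v * d v + Sg)%N by rewrite {1}nE (bigD1 v).
    move: nS (m_gt0 v) (d_gt0 v) n_gt0; clear; case: (m v) => // m'; case: (d v) => // d'.
    case: n => // n' /= + _ _ _; nia.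
  have pw : lam v ^+ (m v * n.-1) * lam v ^+ (a v * (m v).-1) =
      lam v ^+ (d v).-1 ^+ m v * lam v ^+ Sg * lam v ^+ ((a v + n) * (m v).-1).
    by rewrite -exprD ar !exprD exprM.
  have disc_m : kappa v ^+ m v * (lam v ^+ m v * (dual_form (f v)).@[l] ^+ m v) =
      lam v ^+ (d v).-1 ^+ m v * Pf ^+ m v.
    by rewrite -!exprMn -disc exprMn.
  rewrite pw; move: disc_m; clear PBE LF; move: PD => x5.
  move: (lam v ^+ (d v).-1 ^+ m v) (lam v ^+ Sg) (lam v ^+ (_ * _)) (Pf ^+ _) (\prod_(w | _) _).
  move: ((m v)%:R ^+ _) (kappa v ^+ _) (lam v ^+ m v) ((dual_form (f v)).@[l] ^+ _).
  move=> x1 x2 x3 x4 y1 y2 y3 y4 y5 E.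
  transitivity (x1 * (y1 * y4) * y2 * y3 * y5 * x5); first by ring.
  by rewrite -E; ring.
apply: (mulfI Lam0).
transitivity ((-1) ^+ b * n%:R ^+ n.-1 * \prod_v (lam v ^+ (m v * n.-1) * lam v ^+ (a v * (m
  v).-1) * PB v)).
  rewrite (eq_bigr _ (fun v _ => RA v)) !big_split /=.
  have -> : \prod_v lam v ^+ (m v * n.-1) = Lam ^+ n.-1.
    by rewrite -prodrXl; apply: eq_bigr => v _; rewrite exprM.
  move: dE; rewrite exprMn -/(PB _).
  move: (\prod_v \prod_(x <- s v) (Al v).[x] ^+ _) (\prod_v lam v ^+ (a v * _)) => PA LA.
  rewrite -[X in _ = _ * (_ * X)]/(\prod_v PB v).
  move: (\prod_v PB v) (Lam ^+ _) (n%:R ^+ _) (_ ^+ b) => B L1 n1 e E.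
  transitivity (n%:R * Lam * ccoef delta * PA * LA); first by ring.
  by rewrite E; ring.
rewrite (eq_bigr _ (fun v _ => factor v)) !big_split /= -/Lam.
have ac (x y L z : k) : x * (y * (L * z)) = L * (x * y * z) by ring.
exact: ac.
Qed.
End GoodLine.

Lemma meval_neq0M (K : fieldType) n (p q : {mpoly K[n]}) l :
  (p * q).@[l] != 0 -> p.@[l] != 0 /\ q.@[l] != 0.
Proof. by rewrite mevalM mulf_eq0 negb_or => /andP[]. Qed.

Lemma meval_neq0_prod (K : fieldType) n (J : finType) (p : pred J) (E : J -> {mpoly K[n]}) l :
  (\prod_(j | p j) E j).@[l] != 0 -> forall j, p j -> (E j).@[l] != 0.
Proof. by rewrite rmorph_prod => /prodf_neq0. Qed.

Lemma sum_Posz (J : finType) (p : pred J) (g : J -> nat) :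
  (\sum_(j | p j) g j)%N%:Z = \sum_(j | p j) (g j)%:Z.
Proof. exact: (big_morph Posz PoszD erefl). Qed.

Lemma sum_balance (J : finType) (x : nat) (a b c e : J -> nat) :
  (x + \sum_j a j = \sum_j b j + \sum_j c j + \sum_j e j)%N ->
  \sum_j (b j)%:Z + \sum_j (c j)%:Z + \sum_j ((e j)%:Z - (a j)%:Z) = x%:Z.
Proof.
rewrite sumrB -!sum_Posz; move: (\sum_j a j)%N (\sum_j b j)%N (\sum_j c j)%N (\sum_j e j)%N.
by move=> y1 y2 y3 y4; clear; lia.
Qed.

Lemma Posz_predM (i x y : nat) : (0 < i)%N ->
  (i%:Z - 1) * (x%:Z - y%:Z) = (i.-1 * x)%N%:Z - (i.-1 * y)%N%:Z.
Proof. by case: i => // i _; rewrite !PoszM -mulrBr -subn1 -subzn. Qed.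

(** * The identity of forms and the limit divisor *)

Section Assembly.
Variables (k : closedFieldType) (char_k : [pchar k] =i pred0).
Variables (n : nat) (n_gt0 : (0 < n)%N).
Variables (F : nat -> {mpoly k[3]}) (F_homog : forall i, F i \is n.-homog).
Hypothesis F0_neq0 : F 0%N != 0.
Variables (I : finType) (f : I -> {mpoly k[3]}) (m : I -> nat).
Hypothesis m_gt0 : forall v, (0 < m v)%N.
Hypothesis f_irr : forall v, irreducible_elt (f v).
Hypothesis f_nassoc : forall v w, v != w -> ~ associated (f v) (f w).
Hypothesis F0_fact : F 0%N = \prod_v f v ^+ m v.
Variables (N : I -> nat) (A Delta : I -> {mpoly k[3]}) (B : I -> nat -> {mpoly k[3]}).
Hypothesis decomp : forall v, (1 < m v)%N ->
  [/\ (1 <= N v)%N,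
      [/\ A v \is homog mdeg, Delta v \is homog mdeg &
          forall j, (j < N v)%N -> B v j \is homog mdeg],
      coprime_elt (A v * Delta v) (f v) &
      forall i, (i <= N v)%N ->
        A v * F i =
        (((f v * B v 0%N)%:P + \sum_(1 <= j < N v) (B v j)%:P * 'X^j)
           ^+ m v + (Delta v)%:P * 'X^(N v))`_i].

Let Kinf : infinite_ring k := pchar0_infinite char_k.
Let fp v : prime_elt (f v) := irreducible_prime (f_irr v).
Let f0 v : f v != 0. Proof. by case: (fp v). Qed.
Let d v := (msize (f v)).-1.
Let a v := (msize (A v)).-1.

Let fh v : f v \is (d v).-homog.
Proof.
have F0E : F 0%N = f v * (f v ^+ (m v).-1 * \prod_(w | w != v) f w ^+ m w).
  by rewrite mulrA -exprS prednK // F0_fact (bigD1 v).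
by apply: (@homog_factor _ _ n _ (f v ^+ (m v).-1 * \prod_(w | w != v) f w ^+ m w)); rewrite -F0E.
Qed.

Let d_gt0 v : (0 < d v)%N.
Proof. by have := prime_msize (fp v); rewrite /d; case: (msize (f v)) => [|[|]]. Qed.

Let ndvd v w : v != w -> ~ divides (f v) (f w).
Proof.
move=> vw /(prime_divides_prime (fp v) (fp w))[u uU fE].
by rewrite eq_sym in vw; apply: (f_nassoc vw); exists u.
Qed.

Let ndvdAD v : (1 < m v)%N -> ~ divides (f v) (A v) /\ ~ divides (f v) (Delta v).
Proof.
move=> m1; have [_ _ cop _] := decomp m1; have [_ fU _] := fp v.
suff nAD : ~ divides (f v) (A v * Delta v).
  by split=> h; apply: nAD; [apply: divides_mulr|apply: divides_mull].
by move=> h; move: fU; rewrite (cop (f v)) //; apply: divides_refl.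
Qed.

Let neq0_ndvd v g : ~ divides (f v) g -> g != 0.
Proof. by apply: contra_notN => /eqP ->; apply: divides0. Qed.

Let Psi v : {poly {mpoly k[3]}} :=
  (f v * B v 0%N)%:P + \sum_(1 <= j < N v) (B v j)%:P * 'X^j.

Let Psi0 v : (Psi v)`_0 = f v * B v 0%N.
Proof.
rewrite coefD coefC eqxx coef_sum big_nat_cond big1 ?addr0 // => j /andP[/andP[j1 _] _].
by rewrite coefCM coefXn; case: j j1 => // j _; rewrite mulr0.
Qed.

Let size_Psi v : (0 < N v)%N -> (size (Psi v) <= N v)%N.
Proof.
move=> N_gt0; apply/leq_sizeP => i lei; rewrite coefD coefC coef_sum.
rewrite gtn_eqF ?(leq_trans N_gt0) // add0r big_nat_cond big1 // => j /andP[/andP[_ ltj] _].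
by rewrite coefCM coefXn gtn_eqF ?mulr0 // (leq_trans ltj).
Qed.

Let decomp_homog v : (1 < m v)%N -> [/\ (0 < N v)%N, A v \is (a v).-homog,
  Delta v \is (a v + n).-homog, A v != 0 /\ Delta v != 0 & (exists B, (Psi v)`_0 = f v * B) /\
  forall i, (i <= N v)%N -> A v * F i = (Psi v ^+ m v + (Delta v)%:P * 'X^(N v))`_i].
Proof.
move=> m1; have [N_gt0 [Ah _ _] _ dv] := decomp m1; have [nA nD] := ndvdAD m1.
have A0 := neq0_ndvd nA; have D0 := neq0_ndvd nD.
rewrite -/(Psi v) in dv.
have Ah' : A v \is (a v).-homog := Ah.
split=> //; last by split=> //; exists (B v 0%N); apply: Psi0.
have low i : (i < N v)%N -> (Psi v ^+ m v)`_i = A v * F i.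
  move=> lti; rewrite dv ?(ltnW lti) // coefD coefCM coefXn (ltn_eqF lti).
  by rewrite mulr0 addr0.
have P00 : (Psi v)`_0 != 0.
  have : A v * F 0%N != 0 by rewrite mulf_neq0.
  rewrite -(low 0%N N_gt0) -horner_coef0 horner_exp horner_coef0.
  by apply: contraNneq => ->; rewrite expr0n gtn_eqF.
have Ph := homog_root_coefs char_k (m_gt0 v) P00 (size_Psi N_gt0) (d := (a v + n)%N).
have DE : Delta v = A v * F (N v) - (Psi v ^+ m v)`_(N v).
  by rewrite dv // coefD coefCM coefXn eqxx mulr1 addrAC subrr add0r.
rewrite DE; apply: rpredB; first exact: dhomogM.
by apply: Ph => i /low ->; apply: dhomogM.
Qed.

(** The zeros of this form are the lines to be avoided, at which roots collide or a root meets a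
    zero of [A v] or [Delta v]. *)
Let W := (\prod_v dual_form (f v)) * (\prod_v \prod_(w | w != v) line_res (f v) (f w)) *
  (\prod_(v | (1 < m v)%N) (line_res (f v) (A v) * line_res (f v) (Delta v))).

Let dual_neq0 v : dual_form (f v) != 0.
Proof. exact: dual_form_neq0 char_k (fh v) (fp v). Qed.

Let res_neq0 v w : v != w -> line_res (f v) (f w) != 0.
Proof. by move=> vw; apply: (line_res_neq0 Kinf (fh v) (fh w) (fp v) (ndvd vw)). Qed.

Let resAD_neq0 v : (1 < m v)%N -> line_res (f v) (A v) != 0 /\ line_res (f v) (Delta v) != 0.
Proof.
move=> m1; have [nA nD] := ndvdAD m1; have [_ Ah Dh _ _] := decomp_homog m1.
by split; [apply: (line_res_neq0 Kinf (fh v) Ah (fp v) nA)|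
  apply: (line_res_neq0 Kinf (fh v) Dh (fp v) nD)].
Qed.

Let W_neq0 : W != 0.
Proof.
apply: mulf_neq0; first apply: mulf_neq0; apply/prodf_neq0 => v.
- by move=> _; exact: dual_neq0.
- by move=> _; apply/prodf_neq0 => w; rewrite eq_sym; apply: res_neq0.
- by move=> /resAD_neq0[A0 D0]; exact: mulf_neq0 A0 D0.
Qed.

Let W_eval l : W.@[l] != 0 -> [/\ forall v, (dual_form (f v)).@[l] != 0,
  forall v w, v != w -> (line_res (f v) (f w)).@[l] != 0 &
  forall v, (1 < m v)%N -> (line_res (f v) (A v)).@[l] != 0 /\ (line_res (f v) (Delta v)).@[l] !=
    0].
Proof.
move=> /meval_neq0M[/meval_neq0M[/meval_neq0_prod W1 /meval_neq0_prod W2] /meval_neq0_prod W3].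
split=> [v|v w vw|v m1]; first exact: W1.
  by apply: (meval_neq0_prod (W2 v isT)); rewrite eq_sym.
exact: meval_neq0M (W3 v m1).
Qed.

Let G p q := restrict_line (series_form n F) (fun i => fps_const (p i)) (fun i => fps_const (q i)).
Let RA v := line_res (f v) (A v) ^+ (m v).-1.
Let LF v := dual_form (f v) ^+ m v * (\prod_(w | w != v) line_res (f v) (f w) ^+ m w) *
  line_res (f v) (Delta v) ^+ (m v).-1.

(** The order of the quantifiers matters: [C] is built from signs, degrees and multiplicities, so it
    is the same for all lines. *)
Let line_formula : exists2 C : k, C != 0 & forall p q,
  (F 0%N).@[p] != 0 -> W.@[join_line p q] != 0 ->
  exists beta delta, [/\ binary_disc n (G p q) = tau ^+ beta * delta, ccoef delta != 0 &
  ccoef delta * (\prod_v RA v).@[join_line p q] = C * (\prod_v LF v).@[join_line p q]].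
Proof.
have [kappa kP] : exists kappa : I -> k, forall v, kappa v != 0 /\
    forall (s : seq k) (G : {poly k}), size s = d v -> size G = (d v).+1 ->
    all (root G) s -> uniq s ->
    lead_coef G ^+ (d v).-1 * \prod_(x <- s) G^`().[x] = kappa v * (lead_coef G * binary_disc (d
      v) G).
  have ex v : exists c : k, c != 0 /\
    forall (s : seq k) (G : {poly k}), size s = d v -> size G = (d v).+1 ->
    all (root G) s -> uniq s ->
    lead_coef G ^+ (d v).-1 * \prod_(x <- s) G^`().[x] = c * (lead_coef G * binary_disc (d v) G).
    by have [c c0 cP] := disc_constant char_k (d_gt0 v); exists c.
  by have [kappa kP] := choice ex; exists kappa.
have [b bP] := binary_disc_roots n.
have K0 := (pcharf0P _).1 char_k.
have n0 : n%:R != 0 :> k by rewrite K0 -lt0n.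
pose C := n%:R^-1 * ((-1) ^+ b * n%:R ^+ n.-1 * (\prod_v ((m v)%:R ^+ (m v * d v) * kappa v ^+ m
  v))).
exists C.
  rewrite !mulf_neq0 ?invr_eq0 ?signr_eq0 ?expf_neq0 //; apply/prodf_neq0 => v _.
  by rewrite mulf_neq0 ?expf_neq0 ?K0 -?lt0n //; case: (kP v).
move=> p q F0p /W_eval[Wd Wr WAD].
have [beta [delta [DE d0 dE]]] := good_line char_k n_gt0 F_homog m_gt0 fp fh d_gt0 F0_fact
  decomp_homog bP (fun v => (kP v).2) F0p Wd Wr WAD.
exists beta, delta; split=> //.
have RE : (\prod_v RA v).@[join_line p q] =
    \prod_v (line_res (f v) (A v)).@[join_line p q] ^+ (m v).-1.
  by rewrite rmorph_prod; apply: eq_bigr => v _; rewrite /RA rmorphXn.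
have LE : (\prod_v LF v).@[join_line p q] = \prod_v line_factor f m Delta v (meval (join_line p q)).
  rewrite rmorph_prod; apply: eq_bigr => v _; rewrite /LF /line_factor /=.
  rewrite !mevalM !rmorphXn rmorph_prod /=; congr (_ * _ * _).
  by apply: eq_bigr => w _; rewrite rmorphXn.
rewrite RE LE /C; apply: (mulfI n0).
by rewrite mulrA dE -[n%:R^-1 * _ * _]mulrA mulVKf.
Qed.

Let tof : {rmorphism fps k -> laurent k} := @to_laurent k.
Let gf := generic_fiber n F.

Let gf_homog : gf \is n.-homog.
Proof. exact: (map_mpoly_homog tof (series_form_homog F_homog)). Qed.

Let gf_neq0 : gf != 0.
Proof.
have [p F0p] := mpoly_neq0_point Kinf F0_neq0.
apply: contraNneq F0p => gf0.
have S0 : series_form n F = 0 by apply: map_to_laurent_inj; rewrite rmorph0.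
rewrite -(coef_restrict_line p p (F_homog 0)) -(layer_restrict_series F_homog) S0.
by rewrite coef_layer /restrict_line mmap0 coef0.
Qed.

Let lift (p : 'I_3 -> k) : 'I_3 -> fps k := fun i => fps_const (p i).

Let lift_join p q i : lift (join_line p q) i = join_line (lift p) (lift q) i.
Proof. by rewrite /lift /join_line rmorphB !rmorphM. Qed.

Let disc_eval p q : (dual_form gf).@[tof \o lift (join_line p q)] = tof (binary_disc n (G p q)).
Proof.
have [_ DE] := dual_formP (homogE gf_homog); rewrite (homog_msize_pred gf_homog gf_neq0) in DE.
rewrite (map_binary_disc tof) map_restrict_line -DE; apply: meval_eq => i /=.
by rewrite lift_join /join_line rmorphB !rmorphM.
Qed.

(** The multiplicity along [Q] turns products into sums. With the resultants of the [A v] on the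
    side of [P] the count takes place in [nat], and signs appear only on passing to integers. *)
Let multiplicity_formula (P : {mpoly k[3]}) (c1 c2 : k) (Q : prime_divisor k) :
  P != 0 -> c1 != 0 -> c2 != 0 -> c1%:MP * P * \prod_v RA v = c2%:MP * \prod_v LF v ->
  \sum_v (m v)%:Z * dual_divisor (f v) Q
  + \sum_v \sum_(w | w != v) (m w)%:Z * dual_cycle (f v) (f w) Q
  + \sum_v ((m v)%:Z - 1) * (dual_cycle (Delta v) (f v) Q - dual_cycle (A v) (f v) Q)
  = zero_divisor P Q.
Proof.
move=> P0 c10 c20 E; have Qp := prime_divisor_prime Q.
have unitC c : c != 0 -> mult_along Q c%:MP = 0%N.
  by move=> c0; apply: (mult_along_unit Qp); apply: rmorph_unit; rewrite unitfE.
have C0 c : c != 0 -> c%:MP != 0 :> {mpoly k[3]} by rewrite mpolyC_eq0.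
(* When [m v] is 1 no decomposition is given and [g] may be zero, but then the exponent is 0 and the
   power is 1. *)
have X0 v g : ((1 < m v)%N -> g != 0) -> g ^+ (m v).-1 != 0 :> {mpoly k[3]}.
  have [m1 _|m1 g0] := leqP (m v) 1; last by rewrite expf_neq0 ?g0.
  by case: (m v) m1 => [|[|]] //; rewrite expr0 oner_eq0.
have multX v g : ((1 < m v)%N -> g != 0) ->
    mult_along Q (g ^+ (m v).-1) = ((m v).-1 * mult_along Q g)%N.
  have [m1 _|m1 g0] := leqP (m v) 1; last by rewrite mult_alongX ?g0.
  by case: (m v) m1 => [|[|]] //; rewrite expr0 mul0n mult_along_unit ?unitr1.
have A0 v (m1 : (1 < m v)%N) := (resAD_neq0 m1).1.
have D0 v (m1 : (1 < m v)%N) := (resAD_neq0 m1).2.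
have res0 v w : w != v -> line_res (f v) (f w) != 0 by rewrite eq_sym; apply: res_neq0.
have RA0 v : RA v != 0 by apply: (X0 v); apply: A0.
have res_prod0 v : \prod_(w | w != v) line_res (f v) (f w) ^+ m w != 0.
  by apply/prodf_neq0 => w wv; rewrite expf_neq0 ?res0.
have dm0 v := expf_neq0 (m v) (dual_neq0 v).
have lm0 v := X0 v _ (@D0 v).
have LF0 v : LF v != 0 := mulf_neq0 (mulf_neq0 (dm0 v) (res_prod0 v)) (lm0 v).
have PR0 : \prod_v RA v != 0 by apply/prodf_neq0.
have PL0 : \prod_v LF v != 0 by apply/prodf_neq0.
have multLF v : mult_along Q (LF v) = (m v * mult_along Q (dual_form (f v)) +
    \sum_(w | w != v) m w * mult_along Q (line_res (f v) (f w)) +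
    (m v).-1 * mult_along Q (line_res (f v) (Delta v)))%N.
  rewrite (mult_alongM Qp (mulf_neq0 (dm0 v) (res_prod0 v)) (lm0 v)).
  rewrite (mult_alongM Qp (dm0 v) (res_prod0 v)) (multX v _ (@D0 v)).
  rewrite (mult_alongX (m v) Qp (dual_neq0 v)); congr (_ + _ + _)%N.
  rewrite (mult_along_prod Qp (fun w wv => expf_neq0 (m w) (res0 v w wv))).
  by apply: eq_bigr => w wv; exact: mult_alongX (m w) Qp (res0 v w wv).
have := congr1 (mult_along Q) E.
rewrite (mult_alongM Qp (mulf_neq0 (C0 _ c10) P0) PR0) (mult_alongM Qp (C0 _ c10) P0).
rewrite (mult_alongM Qp (C0 _ c20) PL0) (unitC _ c10) (unitC _ c20) !add0n.
rewrite (mult_along_prod Qp (fun v _ => RA0 v)) (mult_along_prod Qp (fun v _ => LF0 v)).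
rewrite (eq_bigr _ (fun v _ => multLF v)) !big_split /=.
rewrite (eq_bigr _ (fun v _ => multX v _ (@A0 v))) => nat_id.
rewrite /zero_divisor -(sum_balance nat_id).
have cyc v g e : g \is e.-homog -> ~ divides (f v) g ->
    dual_cycle (f v) g Q = (mult_along Q (line_res (f v) g))%:Z.
  by move=> gh ng; apply: (dual_cycle_line_res Kinf (fh v) gh (fp v) ng).
congr (_ + _ + _); apply: eq_bigr => v _.
  rewrite sum_Posz; apply: eq_bigr => w wv.
  by rewrite PoszM (cyc _ _ _ (fh w)) //; apply: ndvd; rewrite eq_sym.
have [m1|m1] := leqP (m v) 1.
  have -> : m v = 1%N by apply/eqP; rewrite eqn_leq m1 m_gt0.
  by rewrite subrr !mul0r.
have [_ Ah Dh _ _] := decomp_homog m1; have [nA nD] := ndvdAD m1.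
rewrite (etrans (dual_cycleC (A v) (f v) Q) (cyc _ _ _ Ah nA)).
rewrite (etrans (dual_cycleC (Delta v) (f v) Q) (cyc _ _ _ Dh nD)).
exact: Posz_predM.
Qed.

(** On a good line the leading coefficients of the discriminant and of the primitive multiple D'
    differ by the constant terms of [u1] and [u2], which do not depend on the line. The formula for
    lines thus becomes one for the values of [P]. *)
Lemma limit_dual : limit_divisor (dual_form (generic_fiber n F))
    (fun Q =>
       \sum_v (m v)%:Z * dual_divisor (f v) Q
       + \sum_v \sum_(w | w != v) (m w)%:Z * dual_cycle (f v) (f w) Q
       + \sum_v ((m v)%:Z - 1)
           * (dual_cycle (Delta v) (f v) Q - dual_cycle (A v) (f v) Q)).
Proof.
have [C C0 CP] := line_formula.
have D0 : dual_form gf != 0.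
  have [p [q [F0p Wl]]] := good_line_exists Kinf n_gt0 (F_homog 0) F0_neq0 W_neq0.
  have [beta [delta [DE d0 _]]] := CP p q F0p Wl.
  apply: contraTneq isT => D0; have := disc_eval p q; rewrite D0 meval0 => /esym/eqP.
  rewrite -[0](rmorph0 tof) (inj_eq (@to_laurent_inj k)) DE mulf_eq0 expf_eq0 (negPf (tau_neq0
    k)) andbF /=.
  by move=> /eqP dl0; rewrite dl0 rmorph0 eqxx in d0.
have [c [D' [c0 D'E P0]]] := primitive_multiple D0.
have [a1 [b1 [b10 cE]]] := laurent_frac c.
have {}cE : tof b1 * c = tof a1 := cE.
have a10 : a1 != 0.
  apply: contraNneq c0 => a10; move/eqP: cE; rewrite a10 (rmorph0 tof) mulf_eq0 => /orP[|//].
  by rewrite -[0](rmorph0 tof) (inj_eq (@to_laurent_inj k)) (negPf b10).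
have [s1 [u1 [a1E u10]]] := fps_order a10; have [s2 [u2 [b1E u20]]] := fps_order b10.
pose P := map_mpoly (@ccoef k) D'.
have D'_eval p q : b1 * D'.@[lift (join_line p q)] = a1 * binary_disc n (G p q).
  apply: (@to_laurent_inj k); rewrite !(rmorphM tof) -disc_eval -cE -mulrA; congr (_ * _).
  rewrite -mevalZ -D'E /meval (mmap_comp tof) mmap_map_mpoly //.
have P_eval l : ccoef D'.@[lift l] = P.@[l].
  rewrite /meval (mmap_comp ccoef) mmap_map_mpoly; congr (mmap _ _ _).
have id : (ccoef u2)%:MP * P * \prod_v RA v = (ccoef u1 * C)%:MP * \prod_v LF v.
  apply/eqP; rewrite -subr_eq0; apply/negPn/negP => X0.
  (* If the two sides differed, some good line would avoid the zeros of their difference and those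
     of P. The value of P has to be nonzero there in order to be a leading coefficient. *)
  have WX0 := mulf_neq0 (mulf_neq0 W_neq0 P0) X0.
  have [p [q [F0p]]] := good_line_exists Kinf n_gt0 (F_homog 0) F0_neq0 WX0.
  move=> /meval_neq0M[/meval_neq0M[Wl Pl] /negP[]].
  have [beta [delta [DE d0 dE]]] := CP p q F0p Wl.
  rewrite mevalB subr_eq0 !mevalM !mevalC -[_ * C * _]mulrA -dE mulrA.
  have E := D'_eval p q; rewrite a1E b1E DE in E.
  have E1 : tau ^+ s2 * (u2 * D'.@[lift (join_line p q)]) = tau ^+ (s1 + beta) * (u1 * delta).
    by rewrite mulrA E exprD mulrACA.
  have l1 : ccoef (u2 * D'.@[lift (join_line p q)]) = ccoef u2 * P.@[join_line p q].
    by rewrite (rmorphM ccoef); congr (_ * _); exact: P_eval.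
  have l2 : ccoef (u1 * delta) = ccoef u1 * ccoef delta by rewrite (rmorphM ccoef).
  have n1 : ccoef (u2 * D'.@[lift (join_line p q)]) != 0 by rewrite l1 mulf_neq0.
  have n2 : ccoef (u1 * delta) != 0 by rewrite l2 mulf_neq0.
  by rewrite -l1 (tau_order_unique n1 n2 E1) l2.
exact: (limit_divisorI (dual_formP (homogE gf_homog)).1 c0 D'E P0
  (fun Q => multiplicity_formula Q P0 u20 (mulf_neq0 u10 C0) id)).
Qed.
End Assembly.
Theorem corollary1p3 (k : closedFieldType) (char_k : [pchar k] =i pred0)
    (n : nat) (n_gt0 : (0 < n)%N)
    (F : nat -> {mpoly k[3]}) (F_homog : forall i, F i \is n.-homog)
    (F0_neq0 : F 0%N != 0)
    (F_smooth : smooth_curve (generic_fiber n F))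
    (I : finType) (f : I -> {mpoly k[3]}) (m : I -> nat)
    (m_gt0 : forall v, (0 < m v)%N)
    (f_irr : forall v, irreducible_elt (f v))
    (f_nassoc : forall v w, v != w -> ~ associated (f v) (f w))
    (F0_fact : F 0%N = \prod_v f v ^+ m v)
    (N : I -> nat) (A Delta : I -> {mpoly k[3]}) (B : I -> nat -> {mpoly k[3]})
    (decomp : forall v, (1 < m v)%N ->
      [/\ (1 <= N v)%N,
          [/\ A v \is homog mdeg, Delta v \is homog mdeg &
              forall j, (j < N v)%N -> B v j \is homog mdeg],
          coprime_elt (A v * Delta v) (f v) &
          forall i, (i <= N v)%N ->
            A v * F i =
            (((f v * B v 0%N)%:P + \sum_(1 <= j < N v) (B v j)%:P * 'X^j)
               ^+ m v + (Delta v)%:P * 'X^(N v))`_i]) :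
  limit_divisor (dual_form (generic_fiber n F))
    (fun Q =>
       \sum_v (m v)%:Z * dual_divisor (f v) Q
       + \sum_v \sum_(w | w != v) (m w)%:Z * dual_cycle (f v) (f w) Q
       + \sum_v ((m v)%:Z - 1)
           * (dual_cycle (Delta v) (f v) Q - dual_cycle (A v) (f v) Q)).
Proof.
exact (limit_dual char_k n_gt0 F_homog F0_neq0 m_gt0 f_irr f_nassoc F0_fact decomp).
Qed.
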